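(* Let $d\ge 1$, $\sigma>0$, $1<p\le q<\infty$, $a<d/p'$, $b<d/q$, $a+b\ge 0$, and let $\mathcal{I}^{\sigma}$ be the Hermite potential operator on $\mathbb{R}^d$. (i) If $\sigma\ge d/2$, then $\mathcal{I}^{\sigma}$ maps boundedly $L^p(\mathbb{R}^d,\|x\|^{ap})$ into $L^q(\mathbb{R}^d,\|x\|^{-bq})$. (ii) If $\sigma<d/2$, then the same boundedness holds under the additional condition $$\frac1q\ge\frac1p-\frac{2\sigma-a-b}{d}.$$ Moreover, if either $\sigma\ge d/2$, or $\sigma<d/2$ and $\frac1q\ge\frac1p-\frac{2\sigma-a-b}{d}$ (so that $\mathcal{I}^{\sigma}$ is bounded from $L^p(\mathbb{R}^d,\|x\|^{ap})$ into $L^q(\mathbb{R}^d,\|x\|^{-bq})$), then for every $k\in\mathbb{N}^d$, $$\langle \mathcal{I}^{\sigma}f,h_k\rangle=(2|k|+d)^{-\sigma}\langle f,h_k\rangle,\qquad f\in L^p(\mathbb{R}^d,\|x\|^{ap}).$$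
   Context: $\mathbb{N}=\{0,1,\ldots\}$, $|k|=k_1+\ldots+k_d$ for $k\in\mathbb{N}^d$, $\|\cdot\|$ is the Euclidean norm, $1/p+1/p'=1$, $L^p(\mathbb{R}^d,w)$ is the Lebesgue space for the measure $w(x)\,dx$, and $\langle f,g\rangle=\int_{\mathbb{R}^d}f\overline{g}\,dx$ whenever the integral makes sense. The Hermite functions are $h_k(x)=\prod_{i=1}^d h_{k_i}(x_i)$ with $h_{m}(s)=(\pi^{1/2}2^{m}m!)^{-1/2}H_{m}(s)e^{-s^2/2}$, where $H_m$ is the (physicists') Hermite polynomial of degree $m$. They are eigenfunctions of the harmonic oscillator $\mathcal{H}=-\Delta+\|x\|^2$ with eigenvalues $2|k|+d$. The Hermite heat kernel is $$G_t(x,y)=\sum_{k\in\mathbb{N}^d}e^{-(2|k|+d)t}h_k(x)h_k(y)=(2\pi\sinh 2t)^{-d/2}\exp\Big(-\tfrac14\big[\tanh(t)\|x+y\|^2+\coth(t)\|x-y\|^2\big]\Big),$$ the potential kernel is $\mathcal{K}^{\sigma}(x,y)=\frac1{\Gamma(\sigma)}\int_0^\infty G_t(x,y)t^{\sigma-1}\,dt$, and the potential operator is $\mathcal{I}^{\sigma}f(x)=\int_{\mathbb{R}^d}\mathcal{K}^{\sigma}(x,y)f(y)\,dy$, defined on the natural domain of functions $f$ for which the integral converges for a.e. $x$. Boundedness from $X$ into $Y$ means that $X$ is contained in the natural domain of the operator and $\|\mathcal{I}^\sigma f\|_Y\le C\|f\|_X$ for all $f\in X$, with $C$ independent of $f$.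 *)

(* Defs.v *)
From HB Require Import structures.
From mathcomp Require Import all_boot all_order all_algebra.
From mathcomp Require Import complex.
From mathcomp Require Import all_classical all_reals all_analysis.
From mathcomp Require Import measurable_realfun.

Set Implicit Arguments.
Unset Strict Implicit.
Unset Printing Implicit Defensive.

Import Order.TTheory GRing.Theory Num.Theory.
Import numFieldNormedType.Exports.

Local Open Scope classical_set_scope.
Local Open Scope complex_scope.
Local Open Scope ring_scope.

Local Notation Re := complex.Re.
Local Notation Im := complex.Im.

(* Points of R^d are d-tuples; their sigma-algebra is the library's product
   sigma-algebra of the Borel sets of R, i.e. the Borel sigma-algebra of R^d. *)
Definition rspace (R : realType) (d : nat) := d.-tuple (measurableTypeR R).
HB.instance Definition _ (R : realType) (d : nat) := Measurable.on (rspace R d).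

Section LebesgueMeasureRd.
Context (R : realType).
Local Open Scope ereal_scope.

Definition consp d (z : measurableTypeR R * rspace R d) : rspace R d.+1 :=
  [the d.+1.-tuple (measurableTypeR R) of z.1 :: z.2].

Lemma measurable_consp d : measurable_fun [set: _] (@consp d).
Proof. exact: measurable_cons. Qed.

Section step.
Context d (m : {sigma_finite_measure set (rspace R d) -> \bar R}).

Definition leb_step : set (rspace R d.+1) -> \bar R :=
  pushforward (@lebesgue_measure R \x m) (@consp d).

Let leb_step0 : leb_step set0 = 0.
Proof. by rewrite /leb_step /pushforward preimage_set0 measure0. Qed.

Let leb_step_ge0 A : 0 <= leb_step A.
Proof. by rewrite /leb_step /pushforward; exact: measure_ge0. Qed.

Let leb_step_sigma_additive : semi_sigma_additive leb_step.
Proof.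
move=> F mF tF mUF; rewrite /leb_step /pushforward preimage_bigcup.
apply: measure_semi_sigma_additive.
- by move=> n; rewrite -[X in measurable X]setTI; exact: measurable_consp.
- apply/trivIsetP => /= i j _ _ ij; rewrite -preimage_setI.
  by move/trivIsetP : tF => /(_ _ _ _ _ ij) ->//; rewrite preimage_set0.
- by rewrite -preimage_bigcup -[X in measurable X]setTI; exact: measurable_consp.
Qed.

HB.instance Definition _ := isMeasure.Build _ _ _ leb_step
  leb_step0 leb_step_ge0 leb_step_sigma_additive.

Let leb_step_sigma_finite : sigma_finite setT leb_step.
Proof.
have /sigma_finiteP[F [TF ndF Foo]] := sigma_finiteT (@lebesgue_measure R).
have /sigma_finiteP[G [TG ndG Goo]] := sigma_finiteT m.
pose g (x : rspace R d.+1) : measurableTypeR R * rspace R d :=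
  (thead x, [tuple of behead x]).
have gK : cancel (@consp d) g.
  by case=> a t; congr pair; rewrite ?theadE//; exact: val_inj.
have mg : measurable_fun [set: _] g.
  apply: measurable_fun_pair; first exact: measurable_tnth.
  exact: measurable_behead.
exists (fun n => g @^-1` (F n `*` G n)).
  rewrite -preimage_bigcup; apply/esym; rewrite -subTset => x _ /=.
  have [n _ Fn] : (\bigcup_n F n) (g x).1 by rewrite -TF.
  have [k _ Gk] : (\bigcup_n G n) (g x).2 by rewrite -TG.
  exists (maxn n k) => //; split.
    by move: Fn; exact/subsetPset/ndF/leq_maxl.
  by move: Gk; exact/subsetPset/ndG/leq_maxr.
move=> n; have [? ?] := Foo n; have [? ?] := Goo n; split.
  by rewrite -[X in measurable X]setTI; apply: mg => //; exact: measurableX.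
rewrite /leb_step /pushforward -comp_preimage.
rewrite (_ : g \o @consp d = id); last by apply/funext => x; exact: gK.
by rewrite preimage_id product_measure1E// lte_mul_pinfty// ge0_fin_numE.
Qed.

HB.instance Definition _ := Measure_isSigmaFinite.Build _ _ _ leb_step
  leb_step_sigma_finite.

End step.

(* d-dimensional Lebesgue measure: the d-fold product of the
   one-dimensional one. *)
Fixpoint leb (d : nat) : {sigma_finite_measure set (rspace R d) -> \bar R} :=
  match d with
  | 0 => \d_([tuple] : rspace R 0)
  | n.+1 => leb_step (leb n)
  end.

End LebesgueMeasureRd.
Arguments leb {R} d.

Section EuclideanNorm.
Context (R : realType) (d : nat).

Definition enorm (x : rspace R d) : R := Num.sqrt (\sum_(i < d) tnth x i ^+ 2).

Lemma measurable_enorm : measurable_fun [set: rspace R d] enorm.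
Proof.
rewrite [X in measurable_fun _ X](_ : enorm = @Num.sqrt R \o
  (fun x : rspace R d => \sum_(i < d) tnth x i ^+ 2))//.
apply: measurableT_comp.
  by apply: continuous_measurable_fun; exact: sqrt_continuous.
apply: measurable_sum => i; apply: measurable_funX.
exact: (@measurable_tnth _ (measurableTypeR R) d i).
Qed.

(* The measure ||x||^c dx. *)
Definition wleb (c : R) : set (rspace R d) -> \bar R :=
  fun A => (\int[leb d]_(x in A) (enorm x `^ c)%:E)%E.

Let wleb0 c : wleb c set0 = 0%E.
Proof. exact: integral_set0. Qed.

Let wleb_ge0 c A : (0 <= wleb c A)%E.
Proof. by apply: integral_ge0 => x _; rewrite lee_fin powR_ge0. Qed.

Let wleb_sigma_additive c : semi_sigma_additive (wleb c).
Proof.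
apply: semi_sigma_additive_nng_induced => [|x]; last by rewrite lee_fin powR_ge0.
apply/measurable_EFinP/(@measurableT_comp _ _ _ _ _ _ (@powR R ^~ c)) => //.
exact: measurable_enorm.
Qed.

HB.instance Definition _ c := isMeasure.Build _ _ _ (wleb c)
  (wleb0 c) (wleb_ge0 c) (@wleb_sigma_additive c).

End EuclideanNorm.
Arguments wleb {R} d c.

Section ComplexFunctions.
Context (R : realType) (d : nat).
Implicit Types f g : rspace R d -> R[i].

Definition cmeasurable f :=
  measurable_fun setT (fun x => Re (f x)) /\
  measurable_fun setT (fun x => Im (f x)).

Definition cintegrable f :=
  (leb d).-integrable setT (fun x => (Re (f x))%:E) /\
  (leb d).-integrable setT (fun x => (Im (f x))%:E).

Definition cintegral f : R[i] :=
  (\int[leb d]_x Re (f x)) +i* (\int[leb d]_x Im (f x)).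

Definition cdot f g : R[i] := cintegral (fun x => f x * conjc (g x)).

(* The library's norm on R[i] is R[i]-valued. *)
Definition modulus (z : R[i]) : R := Re `|z|.

(* The norm of L^p(R^d, ||x||^c). *)
Definition wLnorm (c p : R) f : \bar R :=
  ('N[wleb d c]_p%:E[EFin \o (fun x => modulus (f x))])%E.

Definition in_wLp (c p : R) f := cmeasurable f /\ (wLnorm c p f < +oo)%E.

End ComplexFunctions.

Section Hermite.
Context (R : realType).

(* From Rodrigues' formula H_n(s) = (-1)^n e^(s^2) D^n e^(-s^2):
   H_(n+1) = 2 s H_n - H_n'. *)
Fixpoint hermite (n : nat) : {poly R} :=
  if n is m.+1 then 2%:P * 'X * hermite m - (hermite m)^`() else 1.

Definition hermite_fun1 (m : nat) (s : R) : R :=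
  (Num.sqrt (Num.sqrt pi * 2 ^+ m * (m`!)%:R))^-1 *
  (hermite m).[s] * expR (- (s ^+ 2 / 2)).

Context (d : nat).

Definition hermite_fun (k : d.-tuple nat) (x : rspace R d) : R :=
  \prod_(i < d) hermite_fun1 (tnth k i) (tnth x i).

Definition mlength (k : d.-tuple nat) : nat := (\sum_(i < d) tnth k i)%N.

(* The eigenvalue of -Delta + ||x||^2 on h_k. *)
Definition eigenval (k : d.-tuple nat) : R := (2 * mlength k + d)%N%:R.

(* The sum of an absolutely summable real family indexed by N^d, as the
   difference of the sums of the positive and negative parts. *)
Definition multisum (u : d.-tuple nat -> R) : R :=
  fine (\esum_(k in setT) (Num.max (u k) 0)%:E)%E -
  fine (\esum_(k in setT) (Num.max (- u k) 0)%:E)%E.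

Definition heat_kernel (t : R) (x y : rspace R d) : R :=
  multisum (fun k => expR (- (eigenval k * t)) * hermite_fun k x * hermite_fun k y).

End Hermite.

Section Potential.
Context (R : realType).

Definition Gammaf (s : R) : R :=
  \int[lebesgue_measure]_(t in `]0, +oo[) (t `^ (s - 1) * expR (- t)).

Context (d : nat) (sigma : R).

(* Extended-real valued: it is +oo on the diagonal when sigma <= d/2. *)
Definition potential_kernel (x y : rspace R d) : \bar R :=
  ((Gammaf sigma)^-1%:E *
   \int[lebesgue_measure]_(t in `]0%R, +oo[)
     (heat_kernel t x y * t `^ (sigma - 1))%:E)%E.

Definition potential_domain (f : rspace R d -> R[i]) : Prop :=
  cmeasurable f /\
  {ae leb d, forall x,
    (leb d).-integrable setT (fun y => potential_kernel x y * (Re (f y))%:E)%E /\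
    (leb d).-integrable setT (fun y => potential_kernel x y * (Im (f y))%:E)%E}.

Definition potential (f : rspace R d -> R[i]) (x : rspace R d) : R[i] :=
  fine (\int[leb d]_y (potential_kernel x y * (Re (f y))%:E))%E +i*
  fine (\int[leb d]_y (potential_kernel x y * (Im (f y))%:E))%E.

(* I^sigma is bounded from L^p(R^d, ||x||^c) into L^q(R^d, ||x||^e). *)
Definition potential_bounded (c p e q : R) : Prop :=
  (forall f : rspace R d -> R[i], in_wLp c p f ->
     potential_domain f /\ in_wLp e q (potential f)) /\
  exists C : R, forall f : rspace R d -> R[i], in_wLp c p f ->
    (wLnorm e q (potential f) <= C%:E * wLnorm c p f)%E.

End Potential.

(* Main.v *)
Require Import Defs.
From HB Require Import structures.
From mathcomp Require Import all_boot all_order all_algebra.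
From mathcomp Require Import complex ring lra.
From mathcomp Require Import all_classical all_reals all_analysis.
From mathcomp Require Import measurable_realfun.
Set Implicit Arguments.
Unset Strict Implicit.
Unset Printing Implicit Defensive.
Import Order.TTheory GRing.Theory Num.Theory.
Import numFieldNormedType.Exports.
Local Open Scope classical_set_scope.
Local Open Scope complex_scope.
Local Open Scope ring_scope.

(** The potential operator has the symmetric positive kernel
    K(x, y) = Gamma(sigma)^-1 int_0^oo G_t(x, y) t^(sigma - 1) dt. Mehler's formula
    bounds the heat kernel by t^(-d/2) e^(-dt/2) e^(-|x-y|^2 / 8t), hence
    K(x, y) <= C |x-y|^(2s-d) for all s <= sigma with s < d/2, and
    sup_x int K(x, y) dy < oo.

    By duality, boundedness means that the bilinear form with kernel
    |x|^-b K(x, y) |y|^-a is bounded on L^p x L^q'. Choose s by homogeneity,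
    2s = d (1/p - 1/q) + a + b; the hypotheses give s < d/2 and s <= sigma. For
    a, b >= 0 and s > 0 the estimate is the Stein-Weiss inequality, which
    follows from its one-dimensional case by tensorization; on the line one splits
    into |x| > 2|y| and |y| > 2|x|, where Hardy's inequality applies, and
    |x| ~ |y|, where the Hardy-Littlewood-Sobolev inequality (p < q) or Schur's test
    (p = q) does. For s = 0 one has a = b = 0 and p = q, and Schur's test applies to
    K itself. A negative a is removed by |y|^-a <= C (|x|^-a + |x-y|^-a), and a
    negative b by symmetry.

    The same estimate with |h_k| as test function justifies Fubini's theorem in
    <I f, h_k> = <f, I h_k>, and I h_k = (2|k|+d)^-sigma h_k follows from the
    orthonormality of the Hermite functions and the Gamma integral. *)

(** * Power integrals and truncated powers *)

(** Every estimate is stated for nonnegative densities u, v of mass at most 1, with the kernel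
    integrated against u(y)^P v(x)^Q. In this form a weighted arithmetic-geometric mean inequality
    bounds the integrand by u A + v B + c u v, where A has bounded integrals in x and B in y, so
    that neither interpolation nor rearrangement enters. The form also makes tensorization work:
    integrating one coordinate out of a density leaves a density, hence the bounds of two factors
    multiply. The passage to R^d rests on |x| >= |x_i|: a negative power of the norm is at most the
    product of the coordinate powers with the exponent divided by d. At the homogeneous index s the
    relation between the exponents in R^d becomes the one on the line after division by d. For
    growing weights the comparison goes the wrong way, and this is why they have to be removed
    beforehand. The strict inequalities a < d/p' and b < d/q leave room for truncated powers of
    positive exponent in Hardy's inequality. *)

Lemma ge0_integral_affine (R : realType) (c b : R) (f : R -> \bar R) :
  0 < c -> measurable_fun [set: R] f -> (forall x, (0 <= f x)%E) ->
  (\int[lebesgue_measure]_x f (c * x + b)%R = (c^-1)%:E * \int[lebesgue_measure]_x f x)%E.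
Proof.
move=> c0 mf f0.
pose phi : measurableTypeR R -> measurableTypeR R := fun x => c * x + b.
have mphi : measurable_fun setT phi.
  by apply: measurable_funD => //; exact: measurable_funM.
have ci0 : 0 <= c by exact: ltW.
pose m := mscale (NngNum ci0) (pushforward (@lebesgue_measure R) phi).
(* Lebesgue measure is [c] times its image under [phi]: by uniqueness it is enough to compare the
   two on half-open intervals. *)
have mE A : measurable A -> lebesgue_measure A = m mphi A.
  apply: lebesgue_measure_unique => _ [[u v]] _ <-.
  transitivity (c%:E * lebesgue_measure (phi @^-1` `]u, v]%classic))%E; last by [].
  have -> : phi @^-1` `]u, v]%classic = `](u - b) / c, (v - b) / c]%classic.
    apply/seteqP; split => x /=; rewrite !in_itv/= ltr_pdivrMr// ler_pdivlMr// /phi.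
      by rewrite ltrBlDr lerBrDr [x * c]mulrC.
    by rewrite ltrBlDr lerBrDr [x * c]mulrC.
  rewrite !lebesgue_measure_itv/= !lte_fin ltr_pM2r ?invr_gt0// ltrD2r.
  case: ifPn => _; last by rewrite mule0.
  by rewrite -!EFinB -EFinM; congr (_%:E); field; rewrite gt_eqF.
rewrite [in RHS](eq_measure_integral (m mphi))//; last first.
  by move=> A mA _; apply: mE.
rewrite ge0_integral_mscale//=.
rewrite muleA -EFinM mulVf ?gt_eqF// mul1e.
by rewrite ge0_integral_pushforward.
Qed.

Lemma ge0_integral_bigcup_le d (T : measurableType d) (R : realType)
    (mu : {measure set T -> \bar R}) (E : (set T)^nat) (f : T -> \bar R) (M : \bar R) :
  nondecreasing_seq E -> (forall n, measurable (E n)) ->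
  (forall n, measurable_fun (E n) f) -> (forall n x, E n x -> (0 <= f x)%E) ->
  (forall n, (\int[mu]_(x in E n) f x <= M)%E) ->
  (\int[mu]_(x in \bigcup_n E n) f x <= M)%E.
Proof.
move=> ndE mE mf f0 fM.
have cE := ge0_nondecreasing_set_cvg_integral (mu := mu) ndE mE mf f0.
rewrite -(cvg_lim _ cE)//.
by apply: lime_le; [exact: cvgP cE|exact: nearW].
Qed.

Lemma continuous_powR_gt0 (R : realType) (a x : R) : 0 < x ->
  {for x, continuous (@powR R ^~ a)}.
Proof.
move=> x0; apply: differentiable_continuous; apply/derivable1_diffP.
by apply: derivable_powR; rewrite in_itv/= x0.
Qed.

Lemma integral_powR_segment (R : realType) (e u v : R) : e != 0 -> 0 < u -> u < v ->
  (\int[lebesgue_measure]_(x in `[u, v]) (x `^ (e - 1))%:E = ((v `^ e - u `^ e) / e)%:E)%E.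
Proof.
move=> e0 u0 uv.
have v0 : 0 < v by exact: lt_trans uv.
pose F := fun x : R => e^-1 * x `^ e.
rewrite (@continuous_FTC2 _ _ F)//.
- by rewrite /F -EFinB -mulrBr mulrC.
- apply: derivable_within_continuous => x; rewrite in_itv/= => /andP[ux _].
  by apply: derivable_powR; rewrite in_itv/= (lt_le_trans u0).
- split => /=.
  + move=> x; rewrite in_itv/= => /andP[ux _]; rewrite /F.
    apply: derivableM => //; apply: derivable_powR; rewrite in_itv/=.
    by rewrite (lt_trans u0).
  + apply: cvg_at_right_filter; apply: cvgM; first exact: cvg_cst.
    exact: continuous_powR_gt0.
  + apply: cvg_at_left_filter; apply: cvgM; first exact: cvg_cst.
    exact: continuous_powR_gt0.
- move=> x; rewrite in_itv/= => /andP[ux _].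
  have x0 : 0 < x by exact: lt_trans ux.
  rewrite derive1E.
  have H : is_derive x 1 F (e^-1 *: (e * x `^ (e - 1))).
    exact: (is_deriveZ e^-1 (is_derive1_powR e x0)).
  by rewrite derive_val /GRing.scale/= mulrA mulVf// mul1r.
Qed.

Lemma integral_powR_near0 (R : realType) (e rho : R) : 0 < e -> 0 < rho ->
  (\int[lebesgue_measure]_(x in `]0%R, rho]) (x `^ (e - 1))%:E <= (rho `^ e / e)%:E)%E.
Proof.
move=> e0 rho0.
(* With [n.+2] the left endpoint is strictly below [rho] already for n = 0. *)
pose E (n : nat) : set R := `[rho / n.+2%:R, rho]%classic.
have -> : `]0, rho]%classic = \bigcup_n E n.
  apply/seteqP; split => x /=; last first.
    move=> [n _]; rewrite /E/= !in_itv/= => /andP[nx ->]; rewrite andbT.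
    by apply: lt_le_trans nx; rewrite divr_gt0.
  rewrite in_itv/= => /andP[x0 xr].
  exists (Num.truncn (rho / x)) => //; rewrite /E/= in_itv/= xr andbT.
  rewrite ler_pdivrMr// mulrC -ler_pdivrMr//.
  apply: ltW; apply: lt_le_trans (truncnS_gt _) _.
  by rewrite ler_nat.
have mf n : measurable_fun (E n) (fun x : R => (x `^ (e - 1))%:E).
  apply/measurable_EFinP; apply: (@measurable_funS _ _ _ _ setT) => //.
have ndE : nondecreasing_seq E.
  apply/nondecreasing_seqP => n; rewrite subsetEset => x; rewrite /E/= !in_itv/= => /andP[nx ->].
  by rewrite andbT (le_trans _ nx)// ler_pM2l// lef_pV2 ?posrE// ler_nat.
have mE n : measurable (E n) by exact: measurable_itv.
have f0 n x : E n x -> (0 <= (x `^ (e - 1))%:E)%E by rewrite lee_fin powR_ge0.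
apply: ge0_integral_bigcup_le => // n; rewrite integral_powR_segment ?gt_eqF// ?divr_gt0//; last first.
    by rewrite ltr_pdivrMr// ltr_pMr// ltr1n.
  rewrite lee_fin ler_pM2r ?invr_gt0// gerBl powR_ge0//.
Qed.

Lemma integral_powR_far (R : realType) (e rho : R) : 0 < e -> 0 < rho ->
  (\int[lebesgue_measure]_(x in `[rho, +oo[) (x `^ (- e - 1))%:E <= (rho `^ (- e) / e)%:E)%E.
Proof.
move=> e0 rho0.
pose E (n : nat) : set R := `[rho, rho + n.+1%:R]%classic.
have -> : `[rho, +oo[%classic = \bigcup_n E n.
  apply/seteqP; split => x /=; last first.
    by move=> [n _]; rewrite /E/= !in_itv/= => /andP[->].
  rewrite in_itv/= andbT => xr.
  exists (Num.truncn (x - rho)) => //; rewrite /E/= in_itv/= xr/=.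
  by rewrite addrC -lerBlDr ltW// truncnS_gt.
have mf n : measurable_fun (E n) (fun x : R => (x `^ (- e - 1))%:E).
  apply/measurable_EFinP; apply: (@measurable_funS _ _ _ _ setT) => //.
have ndE : nondecreasing_seq E.
  apply/nondecreasing_seqP => n; rewrite subsetEset => x; rewrite /E/= !in_itv/= => /andP[-> nx].
  by rewrite (le_trans nx)// lerD2l ler_nat.
have mE n : measurable (E n) by exact: measurable_itv.
have f0 n x : E n x -> (0 <= (x `^ (- e - 1))%:E)%E by rewrite lee_fin powR_ge0.
apply: ge0_integral_bigcup_le => // n; rewrite integral_powR_segment ?oppr_eq0 ?gt_eqF// ?divr_gt0//; last first.
    by rewrite ltrDl.
  rewrite lee_fin invrN mulrN -mulNr opprB ler_pM2r ?invr_gt0// gerBl powR_ge0//.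
Qed.

Lemma ge0_integral_comp_norm (R : realType) (f : R -> \bar R) :
  measurable_fun [set: R] f -> (forall x, (0 <= f x)%E) ->
  (\int[lebesgue_measure]_x f `|x|%R =
   2%:E * \int[lebesgue_measure]_(x in `]0%R, +oo[) f x)%E.
Proof.
move=> mf f0.
have mfn : measurable_fun [set: R] (fun x => f `|x|%R).
  by apply: measurableT_comp => //; exact: measurable_normr.
have half : (\int[lebesgue_measure]_(x in `]0%R, +oo[) f `|x|%R =
  \int[lebesgue_measure]_(x in `]0%R, +oo[) f x)%E.
  apply: eq_integral => x; rewrite inE/= in_itv/= andbT => x0.
  by rewrite gtr0_norm.
have -> : [set: R] = `]-oo, 0%R]%classic `|` `]0%R, +oo[%classic.
  apply/seteqP; split => x //= _; rewrite !in_itv/= andbT.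
  by case: (leP x 0); [left|right].
rewrite ge0_integral_setU//=; last 2 first.
- exact: measurable_funS mfn.
- rewrite /disj_set; apply/eqP/seteqP; split => x //=; rewrite !in_itv/= andbT => -[x0].
  by rewrite ltNge x0.
have := @ge0_integration_by_substitution0 R (fun x => f `|x|%R) mfn (fun x => f0 _).
under [in RHS]eq_integral do rewrite normrN.
move=> <-.
rewrite -integral_itv_obnd_cbnd//; last exact: measurable_funS mfn.
rewrite half.
by rewrite mule_natl mule2n.
Qed.

Section truncated_powers.
Context (R : realType).
Implicit Types e rho t : R.

(** Meant for [e > 0] and nonnegative [t]: this power is integrable at 0, and that of [far_pow] at
    infinity. *)
Definition near_pow e rho t : R := if t <= rho then t `^ (e - 1) else 0.

Definition far_pow e rho t : R := if rho <= t then t `^ (- e - 1) else 0.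

Lemma near_pow_ge0 e rho t : 0 <= near_pow e rho t.
Proof. by rewrite /near_pow; case: ifP => // _; exact: powR_ge0. Qed.

Lemma far_pow_ge0 e rho t : 0 <= far_pow e rho t.
Proof. by rewrite /far_pow; case: ifP => // _; exact: powR_ge0. Qed.

Lemma measurable_powR_comp d (T : measurableType d) (D : set T) (f : T -> R) a :
  measurable_fun D f -> measurable_fun D (fun x => f x `^ a).
Proof. by move=> mf; apply: (measurableT_comp (measurable_powR a)). Qed.

Lemma measurable_near_pow d (T : measurableType d) (f g : T -> R) e :
  measurable_fun setT f -> measurable_fun setT g ->
  measurable_fun setT (fun x => near_pow e (f x) (g x)).
Proof.
move=> mf mg; apply: measurable_fun_ifT => //; first exact: measurable_fun_ler.
exact: measurable_powR_comp.
Qed.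

Lemma measurable_far_pow d (T : measurableType d) (f g : T -> R) e :
  measurable_fun setT f -> measurable_fun setT g ->
  measurable_fun setT (fun x => far_pow e (f x) (g x)).
Proof.
move=> mf mg; apply: measurable_fun_ifT => //; first exact: measurable_fun_ler.
exact: measurable_powR_comp.
Qed.

Lemma ge0_integral_translate_norm (f : R -> \bar R) (c : R) :
  measurable_fun [set: R] f -> (forall x, (0 <= f x)%E) ->
  (\int[lebesgue_measure]_x f `|x - c|%R =
   2%:E * \int[lebesgue_measure]_(x in `]0%R, +oo[) f x)%E.
Proof.
move=> mf f0.
rewrite -[LHS](_ : (\int[lebesgue_measure]_x f `|1 * x + (- c)|%R)%E = _); last first.
  by under eq_integral do rewrite mul1r.
rewrite (@ge0_integral_affine _ 1 (- c) (fun x => f `|x|%R))//; last first.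
  by apply: measurableT_comp => //; exact: normr_measurable.
by rewrite invr1 mul1e ge0_integral_comp_norm.
Qed.

(** The factor rho^(-e) makes the bound scale invariant. Since it depends on neither [rho] nor [c],
    the truncation radius may later be a function of the other variable or of a density. *)
Lemma integral_near_pow e rho c : 0 < e -> 0 <= rho ->
  (\int[lebesgue_measure]_x (rho `^ (- e) * near_pow e rho `|x - c|)%:E <= (2 / e)%:E)%E.
Proof.
move=> e0; rewrite le_eqVlt => /predU1P[<-|rho0].
  (* At [rho = 0] the prefactor is 0, a nonzero power of 0. This covers the origin and, through the
     inverse of 0, the zeros of a density. *)
  under eq_integral do rewrite powR0 ?oppr_eq0 ?gt_eqF// mul0r.
  by rewrite integral0 lee_fin divr_ge0// ltW.
pose f (x : R) := (rho `^ (- e) * near_pow e rho x)%:E.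
have mn : measurable_fun [set: R] (near_pow e rho) by exact: measurable_near_pow.
have mf : measurable_fun [set: R] f.
  by apply/measurable_EFinP; apply: measurable_funM.
have f0 x : (0 <= f x)%E by rewrite /f lee_fin mulr_ge0 ?powR_ge0 ?near_pow_ge0.
rewrite (@ge0_integral_translate_norm f)// EFinM lee_pmul2l//.
under eq_integral do rewrite /f EFinM.
rewrite ge0_integralZl//; last 3 first.
- by apply/measurable_EFinP; exact: measurable_funS mn.
- by move=> x _; rewrite lee_fin near_pow_ge0.
- by rewrite lee_fin powR_ge0.
rewrite (_ : e^-1 = rho `^ (- e) * (rho `^ e / e)); last first.
  by rewrite powRN mulKf// gt_eqF// powR_gt0.
rewrite EFinM lee_wpmul2l// ?lee_fin ?powR_ge0//.
apply: le_trans (integral_powR_near0 e0 rho0).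
rewrite [leRHS](_ : _ = \int[lebesgue_measure]_(x in `]0%R, rho]) (near_pow e rho x)%:E)%E; last first.
  by apply: eq_integral => x; rewrite inE/= in_itv/= /near_pow => /andP[_ ->].
rewrite integral_mkcond [leRHS]integral_mkcond.
have mE : measurable_fun [set: R] (EFin \o near_pow e rho) by exact/measurable_EFinP.
apply: ge0_le_integral => //.
- by move=> x _; apply: erestrict_ge0 => ? _; rewrite lee_fin near_pow_ge0.
- by apply/(measurable_restrictT (EFin \o near_pow e rho)) => //; exact: measurable_funS mE.
- by apply/(measurable_restrictT (EFin \o near_pow e rho)) => //; exact: measurable_funS mE.
- move=> x _; rewrite /patch; case: ifPn => [|_]; last first.
    by case: ifPn => // _; rewrite lee_fin near_pow_ge0.
  rewrite inE/= in_itv/= andbT => x0; rewrite mem_setE in_itv/= x0/= /near_pow.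
  by case: ifPn.
Qed.

Lemma integral_far_pow e rho c : 0 < e -> 0 <= rho ->
  (\int[lebesgue_measure]_x (rho `^ e * far_pow e rho `|x - c|)%:E <= (2 / e)%:E)%E.
Proof.
move=> e0; rewrite le_eqVlt => /predU1P[<-|rho0].
  under eq_integral do rewrite powR0 ?gt_eqF// mul0r.
  by rewrite integral0 lee_fin divr_ge0// ltW.
pose f (x : R) := (rho `^ e * far_pow e rho x)%:E.
have mn : measurable_fun [set: R] (far_pow e rho) by exact: measurable_far_pow.
have mf : measurable_fun [set: R] f.
  by apply/measurable_EFinP; apply: measurable_funM.
have f0 x : (0 <= f x)%E by rewrite /f lee_fin mulr_ge0 ?powR_ge0 ?far_pow_ge0.
rewrite (@ge0_integral_translate_norm f)// EFinM lee_pmul2l//.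
under eq_integral do rewrite /f EFinM.
rewrite ge0_integralZl//; last 3 first.
- by apply/measurable_EFinP; exact: measurable_funS mn.
- by move=> x _; rewrite lee_fin far_pow_ge0.
- by rewrite lee_fin powR_ge0.
rewrite (_ : e^-1 = rho `^ e * (rho `^ (- e) / e)); last first.
  by rewrite powRN mulVKf// gt_eqF// powR_gt0.
rewrite EFinM lee_wpmul2l// ?lee_fin ?powR_ge0//.
apply: le_trans (integral_powR_far e0 rho0).
rewrite [leRHS](_ : _ = \int[lebesgue_measure]_(x in `[rho, +oo[) (far_pow e rho x)%:E)%E; last first.
  by apply: eq_integral => x; rewrite inE/= in_itv/= /far_pow andbT => ->.
rewrite integral_mkcond [leRHS]integral_mkcond.
have mE : measurable_fun [set: R] (EFin \o far_pow e rho) by exact/measurable_EFinP.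
apply: ge0_le_integral => //.
- by move=> x _; apply: erestrict_ge0 => ? _; rewrite lee_fin far_pow_ge0.
- by apply/(measurable_restrictT (EFin \o far_pow e rho)) => //; exact: measurable_funS mE.
- by apply/(measurable_restrictT (EFin \o far_pow e rho)) => //; exact: measurable_funS mE.
- move=> x _; rewrite /patch; case: ifPn => [|_]; last first.
    by case: ifPn => // _; rewrite lee_fin far_pow_ge0.
  rewrite inE/= in_itv/= andbT => x0; rewrite mem_setE in_itv/= andbT /far_pow.
  by case: ifPn.
Qed.

End truncated_powers.

(* In the application [P = 1 / p] and [Q = 1 - 1 / q], and the densities [u] and
   [v] are the [p]-th power of the function and the [q']-th power of the test
   function it is paired with. *)
Definition bilinear_bound (R : realType) d (T : measurableType d)
    (mu : {sigma_finite_measure set T -> \bar R}) (k : T * T -> R) (P Q C : R) :=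
  forall u v : T -> R, measurable_fun setT u -> measurable_fun setT v ->
    (forall x, 0 <= u x) -> (forall x, 0 <= v x) ->
    (\int[mu]_x (u x)%:E <= 1)%E -> (\int[mu]_x (v x)%:E <= 1)%E ->
    (\int[mu \x mu]_z (k z * u z.2 `^ P * v z.1 `^ Q)%:E <= C%:E)%E.

Lemma measurable_comp_fst (R : realType) d1 d2 d3 (T1 : measurableType d1) (T2 : measurableType d2)
   (T3 : measurableType d3) (f : T1 -> T3) : measurable_fun setT f ->
   measurable_fun [set: T1 * T2] (fun z => f z.1).
Proof. by move=> mf; apply: (measurableT_comp mf). Qed.

Lemma measurable_comp_snd (R : realType) d1 d2 d3 (T1 : measurableType d1) (T2 : measurableType d2)
   (T3 : measurableType d3) (f : T2 -> T3) : measurable_fun setT f ->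
   measurable_fun [set: T1 * T2] (fun z => f z.2).
Proof. by move=> mf; apply: (measurableT_comp mf). Qed.

Section bilinear_bound_majorant.
Context (R : realType) d (T : measurableType d).
Variable mu : {sigma_finite_measure set T -> \bar R}.
Local Open Scope ereal_scope.

(** By Tonelli the first term is integrated in x first, the second in y first, and the third splits
    into a product of masses. A bilinear bound is thereby reduced to a pointwise inequality and two
    one-variable integrals. *)
Lemma bilinear_majorant (w : T * T -> R) (u v : T -> R) (A B : T * T -> R) (C1 C2 c : R) :
  measurable_fun setT w -> (forall z, 0 <= w z)%R ->
  measurable_fun setT u -> measurable_fun setT v ->
  (forall x, 0 <= u x)%R -> (forall x, 0 <= v x)%R ->
  \int[mu]_x (u x)%:E <= 1 -> \int[mu]_x (v x)%:E <= 1 ->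
  measurable_fun setT A -> measurable_fun setT B ->
  (forall z, 0 <= A z)%R -> (forall z, 0 <= B z)%R -> (0 <= C1)%R -> (0 <= C2)%R -> (0 <= c)%R ->
  (forall y, \int[mu]_x (A (x, y))%:E <= C1%:E) ->
  (forall x, \int[mu]_y (B (x, y))%:E <= C2%:E) ->
  (forall z, w z <= u z.2 * A z + v z.1 * B z + c * (u z.2 * v z.1))%R ->
  \int[mu \x mu]_z (w z)%:E <= (C1 + C2 + c)%:E.
Proof.
move=> mw w0 mu_ mv u0 v0 u1 v1 mA mB A0 B0 C10 C20 c0 AC BC wle.
have mu2 : measurable_fun [set: T * T] (fun z => u z.2) by exact: measurable_comp_snd.
have mv1 : measurable_fun [set: T * T] (fun z => v z.1) by exact: measurable_comp_fst.
have muA : measurable_fun setT (fun z : T * T => u z.2 * A z)%R by exact: measurable_funM.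
have mvB : measurable_fun setT (fun z : T * T => v z.1 * B z)%R by exact: measurable_funM.
have muv : measurable_fun setT (fun z : T * T => u z.2 * v z.1)%R by exact: measurable_funM.
have mcuv : measurable_fun setT (fun z : T * T => c * (u z.2 * v z.1))%R.
  by apply: measurable_funM.
apply: (@le_trans _ _ (\int[mu \x mu]_z ((u z.2 * A z)%:E + (v z.1 * B z)%:E + (c * (u z.2 * v z.1))%:E))).
  apply: ge0_le_integral => //.
  - by move=> z _; rewrite lee_fin.
  - exact/measurable_EFinP.
  - by apply/measurable_EFinP; apply: measurable_funD => //; exact: measurable_funD.
  - by move=> z _; rewrite -!EFinD lee_fin.
rewrite ge0_integralD//=; last 4 first.
- by move=> z _; rewrite -EFinD lee_fin addr_ge0// mulr_ge0.
- by apply/measurable_EFinP; apply: measurable_funD.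
- by move=> z _; rewrite lee_fin !mulr_ge0.
- exact/measurable_EFinP.
rewrite ge0_integralD//=; last 4 first.
- by move=> z _; rewrite lee_fin !mulr_ge0.
- exact/measurable_EFinP.
- by move=> z _; rewrite lee_fin !mulr_ge0.
- exact/measurable_EFinP.
rewrite !EFinD; apply: leeD; first apply: leeD.
- rewrite fubini_tonelli2//=; last 2 first.
  + exact/measurable_EFinP.
  + by move=> z; rewrite lee_fin mulr_ge0.
  apply: (@le_trans _ _ (\int[mu]_y (C1%:E * (u y)%:E))).
    apply: ge0_le_integral => //.
    + by move=> y _; apply: integral_ge0 => x _; rewrite lee_fin mulr_ge0.
    + apply: measurable_fun_fubini_tonelli_G.
      * by exact/measurable_EFinP.
      * by move=> z; rewrite lee_fin mulr_ge0.
    + by apply/measurable_EFinP; apply: measurable_funM.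
    + move=> y _; rewrite /fubini_G/=.
      under eq_integral do rewrite EFinM.
      rewrite ge0_integralZl//; last 3 first.
      * by apply/measurable_EFinP; apply: measurableT_comp mA _; exact: measurable_pair2.
      * by move=> x _; rewrite lee_fin.
      * by rewrite lee_fin.
      by rewrite muleC lee_wpmul2r// lee_fin.
  rewrite ge0_integralZl//; [|exact/measurable_EFinP|by move=> x _; rewrite lee_fin].
  by rewrite -[leRHS]mule1 lee_wpmul2l// lee_fin.
- rewrite fubini_tonelli1//=; last 2 first.
  + exact/measurable_EFinP.
  + by move=> z; rewrite lee_fin mulr_ge0.
  apply: (@le_trans _ _ (\int[mu]_x (C2%:E * (v x)%:E))).
    apply: ge0_le_integral => //.
    + by move=> y _; apply: integral_ge0 => x _; rewrite lee_fin mulr_ge0.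
    + apply: measurable_fun_fubini_tonelli_F.
      * by exact/measurable_EFinP.
      * by move=> z; rewrite lee_fin mulr_ge0.
    + by apply/measurable_EFinP; apply: measurable_funM.
    + move=> x _; rewrite /fubini_F/=.
      under eq_integral do rewrite EFinM.
      rewrite ge0_integralZl//; last 3 first.
      * by apply/measurable_EFinP; apply: measurableT_comp mB _; exact: measurable_pair1.
      * by move=> y _; rewrite lee_fin.
      * by rewrite lee_fin.
      by rewrite muleC lee_wpmul2r// lee_fin.
  rewrite ge0_integralZl//; [|exact/measurable_EFinP|by move=> x _; rewrite lee_fin].
  by rewrite -[leRHS]mule1 lee_wpmul2l// lee_fin.
- under eq_integral do rewrite EFinM.
  rewrite ge0_integralZl//; last 2 first.
  + exact/measurable_EFinP.
  + by move=> x _; rewrite lee_fin mulr_ge0.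
  rewrite -[leRHS]mule1 lee_wpmul2l ?lee_fin//.
  rewrite fubini_tonelli2//=; last 2 first.
  + exact/measurable_EFinP.
  + by move=> z; rewrite lee_fin mulr_ge0.
  apply: le_trans u1; apply: ge0_le_integral => //.
  + by move=> y _; apply: integral_ge0 => x _; rewrite lee_fin mulr_ge0.
  + apply: measurable_fun_fubini_tonelli_G.
    * by exact/measurable_EFinP.
    * by move=> z; rewrite lee_fin mulr_ge0.
  + exact/measurable_EFinP.
  + move=> y _; rewrite /fubini_G/=.
    under eq_integral do rewrite EFinM.
    rewrite ge0_integralZl//; last 3 first.
    * exact/measurable_EFinP.
    * by move=> x _; rewrite lee_fin.
    * by rewrite lee_fin.
    by rewrite -[leRHS]mule1 lee_wpmul2l// lee_fin.
Qed.
End bilinear_bound_majorant.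

(** * Bilinear estimates on the line *)

(** A weighted arithmetic-geometric mean inequality without its sharp weights: each base is at most
    the sum, and the exponents add up to 1. *)
Lemma powR_mul3_le (R : realType) (a b c x y z : R) :
  0 <= a -> 0 <= b -> 0 <= c -> a + b + c = 1 -> 0 <= x -> 0 <= y -> 0 <= z ->
  x `^ a * y `^ b * z `^ c <= x + y + z.
Proof.
move=> a0 b0 c0 abc x0 y0 z0.
pose M := x + y + z.
have xM : x <= M by rewrite /M; lra.
have yM : y <= M by rewrite /M; lra.
have zM : z <= M by rewrite /M; lra.
have M0 : 0 <= M by exact: le_trans xM.
apply: (@le_trans _ _ (M `^ a * M `^ b * M `^ c)).
  by rewrite !ler_pM ?mulr_ge0 ?powR_ge0 ?ge0_ler_powR ?nnegrE.
have [M1|Mn] := eqVneq M 0; last first.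
  by rewrite -!powRD ?Mn ?implybT// abc powRr1.
rewrite M1.
have [a1|an] := eqVneq a 0; last by rewrite (powR0 an) !mul0r.
have [b1|bn] := eqVneq b 0; last by rewrite (powR0 bn) mulr0 mul0r.
have cn : c != 0 by move: abc; rewrite a1 b1 !add0r => ->; exact: oner_neq0.
by rewrite (powR0 cn) mulr0.
Qed.

Lemma powR_expR_ln (R : realType) (a x : R) : 0 < x -> x `^ a = expR (a * ln x).
Proof. by move=> x0; rewrite /powR gt_eqF. Qed.

(** * Hardy and Hardy-Littlewood-Sobolev inequalities on the line *)

Section hardy_hls.
Context (R : realType).
Local Notation L := (@lebesgue_measure R).
Local Notation T := (measurableTypeR R).

Lemma measurable_abs_fst : measurable_fun [set: T * T] (fun z => `|z.1 : R|).
Proof. by apply: measurableT_comp => //; exact: normr_measurable. Qed.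

Lemma measurable_abs_snd : measurable_fun [set: T * T] (fun z => `|z.2 : R|).
Proof. by apply: measurableT_comp => //; exact: normr_measurable. Qed.

Lemma measurable_abs_sub : measurable_fun [set: T * T] (fun z => `|(z.1 : R) - z.2|).
Proof.
by apply: measurableT_comp => //; exact: measurable_funB.
Qed.

(** In all kernels [z.1] is the variable of the potential, paired with [v], and [z.2] that of the
    function it is applied to, paired with [u]. *)
Definition hardy_kernel (a c : R) (z : T * T) : R :=
  if (0 < `|z.2|) && (`|z.2| <= `|z.1|) then `|z.2| `^ (- a) * `|z.1| `^ (- c) else 0.

Lemma measurable_hardy_kernel a c : measurable_fun setT (hardy_kernel a c).
Proof.
apply: measurable_fun_ifT => //.
- apply: measurable_and; first exact: measurable_fun_ltr measurable_abs_snd.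
  exact: measurable_fun_ler measurable_abs_snd measurable_abs_fst.
- by apply: measurable_funM; apply: measurable_powR_comp;
    [exact: measurable_abs_snd|exact: measurable_abs_fst].
Qed.

Lemma hardy_kernel_ge0 a c z : 0 <= hardy_kernel a c z.
Proof. by rewrite /hardy_kernel; case: ifP => // _; rewrite mulr_ge0 ?powR_ge0. Qed.

(** The three terms on the right enter with weights 1 - Q, 1 - P and P + Q - 1, which reproduce the
    powers s^P and t^Q; [e] then parametrizes the exponents of x and y compatible with
    homogeneity. *)
Lemma hardy_pointwise (P Q a c e s t x y : R) : P < 1 -> Q < 1 -> 1 <= P + Q ->
  a = 1 - P - e * (2 - P - Q) -> c = 1 - Q + e * (2 - P - Q) ->
  0 < x -> 0 < y -> 0 < s -> 0 < t ->
  y `^ (- a) * x `^ (- c) * s `^ P * t `^ Q <=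
  s * (y `^ e * x `^ (- e - 1)) + t * (x `^ (- e) * y `^ (e - 1)) + s * t.
Proof.
move=> P1 Q1 PQ -> -> x0 y0 s0 t0.
have [P1' Q1' PQ'] : [/\ 0 <= 1 - P, 0 <= 1 - Q & 0 <= P + Q - 1] by split; lra.
have S1 : 1 - Q + (1 - P) + (P + Q - 1) = 1 by ring.
apply: le_trans (powR_mul3_le Q1' P1' PQ' S1 _ _ _); last first.
  + by rewrite mulr_ge0 ?ltW.
  + by rewrite !mulr_ge0 ?powR_ge0 ?ltW.
  + by rewrite !mulr_ge0 ?powR_ge0 ?ltW.
(* All bases are positive; after taking logarithms the claim is a linear identity between
   exponents. *)
rewrite !powR_expR_ln ?mulr_gt0 ?expR_gt0// ?powR_expR_ln// !lnM ?posrE ?mulr_gt0 ?expR_gt0// !expRK.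
rewrite -!expRD ler_expR le_eqVlt; apply/orP; left; apply/eqP.
by ring.
Qed.

Lemma bilinear_hardy (P Q a c : R) : P < 1 -> Q < 1 -> 1 <= P + Q ->
  a < 1 - P -> a + c = 2 - P - Q ->
  exists C, bilinear_bound L (hardy_kernel a c) P Q C.
Proof.
move=> P1 Q1 PQ aP ac.
have P0 : 0 < P by lra.
have Q0 : 0 < Q by lra.
(* The relative distance of [a] from its critical value 1 - P. The hypothesis [a < 1 - P] says
   exactly that [e] is positive. *)
pose e := (1 - P - a) / (2 - P - Q).
have d0 : 0 < 2 - P - Q by lra.
have e0 : 0 < e by rewrite divr_gt0//; lra.
have eE : e * (2 - P - Q) = 1 - P - a by rewrite /e divfK// gt_eqF.
have aE : a = 1 - P - e * (2 - P - Q) by rewrite eE; lra.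
have cE : c = 1 - Q + e * (2 - P - Q) by rewrite eE; lra.
have e20 : 0 <= 2 / e by rewrite divr_ge0// ltW.
exists (2 / e + 2 / e + 1).
move=> u v mu mv u0 v0 u1 v1.
(* On the support |y| <= |x|: for fixed y the variable x is far, for fixed x the variable y is near.
   The subtraction of 0 matches the integrals of truncated powers centred at [c]. *)
pose A (z : T * T) : R := `|z.2| `^ e * far_pow e `|z.2| `|z.1 - 0|.
pose B (z : T * T) : R := `|z.1| `^ (- e) * near_pow e `|z.1| `|z.2 - 0|.
have m1 : measurable_fun [set: T * T] (fun z => `|(z.1 : R) - 0|).
  by under eq_fun do rewrite subr0; exact: measurable_abs_fst.
have m2 : measurable_fun [set: T * T] (fun z => `|(z.2 : R) - 0|).
  by under eq_fun do rewrite subr0; exact: measurable_abs_snd.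
apply: (@bilinear_majorant R _ T L _ u v A B) => //.
- apply: measurable_funM; first apply: measurable_funM.
  + exact: measurable_hardy_kernel.
  + by apply: measurable_powR_comp; exact: measurable_comp_snd.
  + by apply: measurable_powR_comp; exact: measurable_comp_fst.
- by move=> z; rewrite !mulr_ge0 ?hardy_kernel_ge0 ?powR_ge0.
- apply: measurable_funM; first exact: measurable_powR_comp measurable_abs_snd.
  by apply: measurable_far_pow => //; exact: measurable_abs_snd.
- apply: measurable_funM; first exact: measurable_powR_comp measurable_abs_fst.
  by apply: measurable_near_pow => //; exact: measurable_abs_fst.
- by move=> z; rewrite mulr_ge0 ?powR_ge0 ?far_pow_ge0.
- by move=> z; rewrite mulr_ge0 ?powR_ge0 ?near_pow_ge0.
- by move=> y; rewrite /A/=; exact: (integral_far_pow 0 e0 (normr_ge0 (y : R))).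
- by move=> x; rewrite /B/=; exact: (integral_near_pow 0 e0 (normr_ge0 (x : R))).
- move=> z; have AB0 : 0 <= u z.2 * A z + v z.1 * B z + 1 * (u z.2 * v z.1).
    by rewrite mul1r !addr_ge0 ?mulr_ge0 ?powR_ge0 ?far_pow_ge0 ?near_pow_ge0.
  move: AB0; rewrite /hardy_kernel /A /B !subr0 /far_pow /near_pow.
  have [/andP[y0 yx]|_] := boolP ((0 < `|z.2|) && (`|z.2| <= `|z.1|)); last by rewrite !mul0r.
  rewrite yx => AB0.
  have x0 : 0 < `|z.1| by exact: lt_le_trans yx.
  set x := `|z.1| in x0 yx AB0 *; set y := `|z.2| in y0 yx AB0 *.
  have [uz|un] := eqVneq (u z.2) 0.
    by rewrite [in leLHS]uz powR0 ?gt_eqF// mulr0 mul0r.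
  have [vz|vn] := eqVneq (v z.1) 0.
    by rewrite [in leLHS]vz [X in _ * X]powR0 ?gt_eqF// mulr0.
  have up : 0 < u z.2 by rewrite lt_def un u0.
  have vp : 0 < v z.1 by rewrite lt_def vn v0.
  by rewrite mul1r; exact: hardy_pointwise.
Qed.

Definition riesz_kernel (l : R) (z : T * T) : R :=
  if 0 < `|z.1 - z.2| then `|z.1 - z.2| `^ (- l) else 0.

Lemma measurable_riesz_kernel l : measurable_fun setT (riesz_kernel l).
Proof.
apply: measurable_fun_ifT => //; first exact: measurable_fun_ltr measurable_abs_sub.
by apply: measurable_powR_comp; exact: measurable_abs_sub.
Qed.

Lemma riesz_kernel_ge0 l z : 0 <= riesz_kernel l z.
Proof. by rewrite /riesz_kernel; case: ifP => // _; exact: powR_ge0. Qed.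

(* The pointwise estimate behind the Hardy-Littlewood-Sobolev inequality:
   compare the distance [D] with [1 / s], where [s] is the larger of the two
   densities; near the diagonal bound the smaller density by [s], far from it
   split off the factor [s * t]. *)
Lemma riesz_pointwise (P Q l s t D : R) : P < 1 -> 0 < Q -> Q < 1 -> l = 2 - P - Q ->
  0 < D -> 0 < t -> t <= s ->
  D `^ (- l) * s `^ P * t `^ Q <=
  s * (s^-1 `^ (- (1 - l)) * near_pow (1 - l) s^-1 D +
       s^-1 `^ ((1 - P) / (1 - Q)) * far_pow ((1 - P) / (1 - Q)) s^-1 D) + s * t.
Proof.
move=> P1 Q0 Q1 lE D0 t0 ts.
have s0 : 0 < s by exact: lt_le_trans ts.
have si0 : 0 < s^-1 by rewrite invr_gt0.
have [Ds|sD] := leP D s^-1.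
  apply: (@le_trans _ _ (s * (s^-1 `^ (- (1 - l)) * near_pow (1 - l) s^-1 D))); last first.
    rewrite mulrDr -addrA lerDl addr_ge0// !mulr_ge0 ?powR_ge0 ?far_pow_ge0 ?ltW//.
  rewrite /near_pow Ds.
  apply: (@le_trans _ _ (D `^ (- l) * s `^ P * s `^ Q)).
    by rewrite ler_wpM2l ?mulr_ge0 ?powR_ge0// ge0_ler_powR ?nnegrE// ltW.
  have sE : s = s `^ 1 by rewrite powRr1// ltW.
  rewrite [X in _ <= X * _]sE !powR_expR_ln// lnV ?posrE// -!expRD ler_expR.
  by rewrite le_eqVlt; apply/orP; left; apply/eqP; rewrite lE; ring.
apply: (@le_trans _ _ (s * (s^-1 `^ ((1 - P) / (1 - Q)) * far_pow ((1 - P) / (1 - Q)) s^-1 D) + s * t)); last first.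
  by rewrite lerD2r ler_pM2l// lerDr mulr_ge0 ?powR_ge0 ?near_pow_ge0.
rewrite /far_pow (ltW sD).
have Qn : 1 - Q != 0 by rewrite gt_eqF//; lra.
rewrite -[leRHS]addr0.
apply: le_trans (@powR_mul3_le _ (1 - Q) Q 0 _ _ 0 _ _ _ _ _ _ _); last first.
  + by [].
  + by rewrite mulr_ge0 ?ltW.
  + by rewrite !mulr_ge0 ?powR_ge0 ?ltW.
  + lra.
  + by [].
  + lra.
  + lra.
rewrite powRr0 mulr1.
rewrite !powR_expR_ln ?mulr_gt0 ?expR_gt0// ?powR_expR_ln// !lnM ?posrE ?mulr_gt0 ?expR_gt0// !expRK.
rewrite lnV ?posrE// -!expRD ler_expR le_eqVlt; apply/orP; left; apply/eqP.
by rewrite lE; field.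
Qed.

Lemma bilinear_riesz (P Q l : R) : P < 1 -> Q < 1 -> 1 < P + Q ->
  l = 2 - P - Q -> exists C, bilinear_bound L (riesz_kernel l) P Q C.
Proof.
move=> P1 Q1 PQ lE.
have P0 : 0 < P by lra.
have Q0 : 0 < Q by lra.
have l1 : 0 < 1 - l by lra.
(* The far exponents are forced: with weights 1 - Q and Q on the far term and on s t, the power of
   the distance must be -l. The case where [v] is the larger density has P and Q exchanged. *)
have eu0 : 0 < (1 - P) / (1 - Q) by rewrite divr_gt0//; lra.
have ev0 : 0 < (1 - Q) / (1 - P) by rewrite divr_gt0//; lra.
exists (2 / (1 - l) + 2 / ((1 - P) / (1 - Q)) + (2 / (1 - l) + 2 / ((1 - Q) / (1 - P))) + 1).
move=> u v mu mv u0 v0 u1 v1.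
pose M e (s D : R) := s^-1 `^ (- (1 - l)) * near_pow (1 - l) s^-1 D + s^-1 `^ e * far_pow e s^-1 D.
have M0 e s D : 0 <= M e s D.
  by rewrite addr_ge0 ?mulr_ge0 ?powR_ge0 ?near_pow_ge0 ?far_pow_ge0.
have mM e (w : T * T -> R) : measurable_fun setT w -> (forall z, 0 <= w z) -> measurable_fun [set: T * T]
   (fun z => M e (w z) `|z.1 - z.2|).
  move=> mw w0; have mwi : measurable_fun setT (fun z => (w z)^-1).
    by under eq_fun do rewrite -powR_inv1//; exact: measurable_powR_comp.
  apply: measurable_funD; apply: measurable_funM.
  - exact: measurable_powR_comp.
  - apply: measurable_near_pow => //; exact: measurable_abs_sub.
  - exact: measurable_powR_comp.
  - apply: measurable_far_pow => //; exact: measurable_abs_sub.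
(* At [s = 0] the inverse is 0 and both terms of [M] vanish, so that the bound also holds at the
   zeros of a density. *)
have iM e (s c : R) : 0 < e -> 0 <= s ->
    (\int[L]_x (M e s `|x - c|)%:E <= (2 / (1 - l) + 2 / e)%:E)%E.
  move=> e0 s0.
  have mn : measurable_fun [set: T] (fun x => `|(x : R) - c|).
    apply: measurableT_comp; first exact: normr_measurable.
    exact: measurable_funB.
  under eq_integral do rewrite EFinD.
  rewrite ge0_integralD//=; last 4 first.
  - by move=> x _; rewrite lee_fin mulr_ge0 ?powR_ge0 ?near_pow_ge0.
  - by apply/measurable_EFinP; apply: measurable_funM => //; exact: measurable_near_pow.
  - by move=> x _; rewrite lee_fin mulr_ge0 ?powR_ge0 ?far_pow_ge0.
  - by apply/measurable_EFinP; apply: measurable_funM => //; exact: measurable_far_pow.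
  rewrite EFinD; apply: leeD; first by apply: integral_near_pow => //; rewrite invr_ge0.
  by apply: integral_far_pow => //; rewrite invr_ge0.
pose A (z : T * T) : R := M ((1 - P) / (1 - Q)) (u z.2) `|z.1 - z.2|.
pose B (z : T * T) : R := M ((1 - Q) / (1 - P)) (v z.1) `|z.1 - z.2|.
apply: (@bilinear_majorant R _ T L _ u v A B) => //.
- apply: measurable_funM; first apply: measurable_funM.
  + exact: measurable_riesz_kernel.
  + by apply: measurable_powR_comp; exact: measurable_comp_snd.
  + by apply: measurable_powR_comp; exact: measurable_comp_fst.
- by move=> z; rewrite !mulr_ge0 ?riesz_kernel_ge0 ?powR_ge0.
- by apply: mM => //; exact: measurable_comp_snd.
- by apply: mM => //; exact: measurable_comp_fst.
- by move=> z; exact: M0.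
- by move=> z; exact: M0.
- by rewrite addr_ge0// divr_ge0// ltW.
- by rewrite addr_ge0// divr_ge0// ltW.
- by move=> y; rewrite /A/=; exact: (iM _ _ (y : R) eu0 (u0 y)).
- by move=> x; under eq_integral do rewrite /B/= distrC; exact: (iM _ _ (x : R) ev0 (v0 x)).
- move=> z; have AB0 : 0 <= u z.2 * A z + v z.1 * B z + 1 * (u z.2 * v z.1).
    by rewrite mul1r !addr_ge0 ?mulr_ge0 ?M0.
  rewrite /riesz_kernel; case: ifPn => [D0|_]; last by rewrite !mul0r.
  have [uz|un] := eqVneq (u z.2) 0.
    by rewrite [in leLHS]uz powR0 ?gt_eqF// mulr0 mul0r.
  have [vz|vn] := eqVneq (v z.1) 0.
    by rewrite [in leLHS]vz [X in _ * X]powR0 ?gt_eqF// mulr0.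
  have up : 0 < u z.2 by rewrite lt_def un u0.
  have vp : 0 < v z.1 by rewrite lt_def vn v0.
  (* The pointwise estimate is applied with the larger of the two densities in the role of [s]. *)
  rewrite mul1r; have [vu|uv] := leP (v z.1) (u z.2).
    apply: le_trans (riesz_pointwise P1 Q0 Q1 lE D0 vp vu) _.
    by rewrite -addrA lerD2l lerDr mulr_ge0// M0.
  have lE' : l = 2 - Q - P by lra.
  rewrite mulrAC; apply: le_trans (riesz_pointwise Q1 P0 P1 lE' D0 up (ltW uv)) _.
  by rewrite [v z.1 * u z.2]mulrC lerD2r lerDr mulr_ge0// M0.
Qed.

End hardy_hls.

Section bilinear_bound_theory.
Context (R : realType) d (T : measurableType d).
Variable mu : {sigma_finite_measure set T -> \bar R}.
Local Open Scope ereal_scope.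
Implicit Types (k : T * T -> R) (P Q C : R).

Let measurable_integrand k P Q (u v : T -> R) : measurable_fun setT k ->
  measurable_fun setT u -> measurable_fun setT v ->
  measurable_fun setT (fun z : T * T => k z * u z.2 `^ P * v z.1 `^ Q)%R.
Proof.
move=> mk mu_ mv; apply: measurable_funM; first apply: measurable_funM => //.
- by apply: measurable_powR_comp; exact: measurable_comp_snd.
- by apply: measurable_powR_comp; exact: measurable_comp_fst.
Qed.

Lemma measurable_EFin_integrand k P Q (u v : T -> R) : measurable_fun setT k ->
  measurable_fun setT u -> measurable_fun setT v ->
  measurable_fun setT (fun z : T * T => (k z * u z.2 `^ P * v z.1 `^ Q)%:E).
Proof. by move=> mk mu_ mv; apply/measurable_EFinP; exact: measurable_integrand. Qed.

Lemma bilinear_bound_le k k' P Q C : measurable_fun setT k -> measurable_fun setT k' ->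
  (forall z, 0 <= k z)%R -> (forall z, k z <= k' z)%R ->
  bilinear_bound mu k' P Q C -> bilinear_bound mu k P Q C.
Proof.
move=> mk mk' k0 kk' b u v mu_ mv u0 v0 u1 v1.
apply: le_trans (b u v mu_ mv u0 v0 u1 v1).
apply: ge0_le_integral => //.
- by move=> z _; rewrite lee_fin !mulr_ge0 ?powR_ge0.
- exact: measurable_EFin_integrand.
- exact: measurable_EFin_integrand.
- by move=> z _; rewrite lee_fin !ler_wpM2r ?powR_ge0.
Qed.

Lemma bilinear_boundD k k' P Q C C' : measurable_fun setT k -> measurable_fun setT k' ->
  (forall z, 0 <= k z)%R -> (forall z, 0 <= k' z)%R ->
  bilinear_bound mu k P Q C -> bilinear_bound mu k' P Q C' ->
  bilinear_bound mu (fun z => k z + k' z)%R P Q (C + C').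
Proof.
move=> mk mk' k0 k'0 b b' u v mu_ mv u0 v0 u1 v1.
under eq_integral do rewrite 2!mulrDl EFinD.
rewrite ge0_integralD//=; last 4 first.
- by move=> z _; rewrite lee_fin !mulr_ge0 ?powR_ge0.
- exact: measurable_EFin_integrand.
- by move=> z _; rewrite lee_fin !mulr_ge0 ?powR_ge0.
- exact: measurable_EFin_integrand.
by rewrite EFinD; apply: leeD; [exact: b|exact: b'].
Qed.

Lemma bilinear_boundZ c k P Q C : measurable_fun setT k ->
  (forall z, 0 <= k z)%R -> (0 <= c)%R ->
  bilinear_bound mu k P Q C -> bilinear_bound mu (fun z => c * k z)%R P Q (c * C).
Proof.
move=> mk k0 c0 b u v mu_ mv u0 v0 u1 v1.
under eq_integral do rewrite -2!mulrA EFinM.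
rewrite ge0_integralZl//=; last 2 first.
- by under eq_fun do rewrite mulrA; exact: measurable_EFin_integrand.
- by move=> z _; rewrite lee_fin !mulr_ge0 ?powR_ge0.
rewrite EFinM lee_wpmul2l ?lee_fin//.
by under eq_integral do rewrite mulrA; exact: b.
Qed.

Lemma bilinear_bound_swap k P Q C : measurable_fun setT k ->
  (forall z, 0 <= k z)%R ->
  bilinear_bound mu k P Q C -> bilinear_bound mu (fun z => k (z.2, z.1)) Q P C.
Proof.
move=> mk k0 b u v mu_ mv u0 v0 u1 v1.
have mks : measurable_fun [set: T * T] (fun z => k (z.2, z.1)).
  by apply: measurableT_comp mk _; exact: measurable_swap.
apply: le_trans (b v u mv mu_ v0 u0 v1 u1).
rewrite le_eqVlt; apply/orP; left; apply/eqP.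
clear b.
have mL := measurable_EFin_integrand Q P mks mu_ mv.
have mR := measurable_EFin_integrand P Q mk mv mu_.
rewrite [LHS]fubini_tonelli1; [|exact: mL|]; last first.
  by move=> z; rewrite lee_fin !mulr_ge0 ?powR_ge0.
transitivity (\int[mu]_y fubini_G mu (fun z : T * T => (k z * v z.2 `^ P * u z.1 `^ Q)%:E) y); last first.
  apply/esym/fubini_tonelli2; first exact: mR.
  by move=> z; rewrite lee_fin !mulr_ge0 ?powR_ge0.
apply: eq_integral => x _; apply: eq_integral => y _ /=.
by rewrite mulrAC.
Qed.

End bilinear_bound_theory.

(** * The Stein-Weiss inequality on the line *)

Section stein_weiss_line.
Context (R : realType).
Local Notation L := (@lebesgue_measure R).
Local Notation T := (measurableTypeR R).

(** A bound for |x|^(l - 1) |x - y|^(-l) in the region |y| <= 2|x|, where |x - y| <= 3|x|; its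
    integral in y is bounded uniformly in x. *)
Definition diagonal_weight (l : R) (z : T * T) : R :=
  (3 * `|z.1|) `^ (- (1 - l)) * near_pow (1 - l) (3 * `|z.1|) `|z.2 - z.1|.

Lemma diagonal_weight_ge0 l z : 0 <= diagonal_weight l z.
Proof. by rewrite mulr_ge0 ?powR_ge0 ?near_pow_ge0. Qed.

Lemma measurable_diagonal_weight l : measurable_fun setT (diagonal_weight l).
Proof.
have m3 : measurable_fun [set: T * T] (fun z => 3 * `|z.1 : R|).
  by apply: measurable_funM => //; exact: measurable_abs_fst.
apply: measurable_funM; first exact: measurable_powR_comp.
apply: measurable_near_pow => //.
by under eq_fun do rewrite distrC; exact: measurable_abs_sub.
Qed.

Definition diagonal_kernel (P Q l : R) (z : T * T) : R :=
  diagonal_weight l (z.2, z.1) `^ P * diagonal_weight l z `^ Q.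

Lemma diagonal_kernel_ge0 P Q l z : 0 <= diagonal_kernel P Q l z.
Proof. by rewrite mulr_ge0 ?powR_ge0. Qed.

Lemma measurable_diagonal_kernel P Q l : measurable_fun setT (diagonal_kernel P Q l).
Proof.
apply: measurable_funM; apply: measurable_powR_comp; last exact: measurable_diagonal_weight.
apply: measurableT_comp (measurable_diagonal_weight l) _; exact: measurable_swap.
Qed.

(** Schur's test: the integrand equals (u A)^P (v B)^Q, where A and B are the two transposed
    weights, and is at most u A + v B. *)
Lemma bilinear_diagonal (P Q l : R) : 0 < P -> 0 < Q -> P + Q = 1 -> l < 1 ->
  exists C, bilinear_bound L (diagonal_kernel P Q l) P Q C.
Proof.
move=> P0 Q0 PQ l1.
have el : 0 < 1 - l by lra.
exists (2 / (1 - l) + 2 / (1 - l) + 0).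
move=> u v mu mv u0 v0 u1 v1.
have ms : measurable_fun [set: T * T] (fun z => diagonal_weight l (z.2, z.1)).
  by apply: measurableT_comp (measurable_diagonal_weight l) _; exact: measurable_swap.
apply: (@bilinear_majorant R _ T L _ u v (fun z => diagonal_weight l (z.2, z.1)) (diagonal_weight l)) => //.
- apply: measurable_funM; first apply: measurable_funM.
  + exact: measurable_diagonal_kernel.
  + by apply: measurable_powR_comp; exact: measurable_comp_snd.
  + by apply: measurable_powR_comp; exact: measurable_comp_fst.
- by move=> z; rewrite !mulr_ge0 ?powR_ge0.
- exact: measurable_diagonal_weight.
- by move=> z; exact: diagonal_weight_ge0.
- by move=> z; exact: diagonal_weight_ge0.
- by rewrite divr_ge0// ltW.
- by rewrite divr_ge0// ltW.
- move=> y; have y3 : 0 <= 3 * `|y : R| by rewrite mulr_ge0.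
  exact: (integral_near_pow (y : R) el y3).
- move=> y; have y3 : 0 <= 3 * `|y : R| by rewrite mulr_ge0.
  exact: (integral_near_pow (y : R) el y3).
- move=> z; rewrite mul0r.
  set A := diagonal_weight l (z.2, z.1); set B := diagonal_weight l z.
  have A0 : 0 <= A by exact: diagonal_weight_ge0.
  have B0 : 0 <= B by exact: diagonal_weight_ge0.
  have S1 : P + Q + 0 = 1 by rewrite addr0.
  apply: le_trans (powR_mul3_le (ltW P0) (ltW Q0) (lexx 0) S1 _ _ (lexx 0)); last 2 first.
  + by rewrite mulr_ge0.
  + by rewrite mulr_ge0.
  rewrite powRr0 mulr1 (@powRM _ (u z.2) A)// (@powRM _ (v z.1) B)// /diagonal_kernel -/A -/B.
  by rewrite [u _ `^ _ * _]mulrC [v _ `^ _ * _]mulrC mulrACA mulrA.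
Qed.

Definition stein_weiss_kernel (a b l : R) (z : T * T) : R :=
  if [&& 0 < `|z.1|, 0 < `|z.2| & 0 < `|z.1 - z.2|] then
    `|z.2| `^ (- a) * `|z.1| `^ (- b) * `|z.1 - z.2| `^ (- l) else 0.

Lemma stein_weiss_kernel_ge0 a b l z : 0 <= stein_weiss_kernel a b l z.
Proof. by rewrite /stein_weiss_kernel; case: ifP => // _; rewrite !mulr_ge0 ?powR_ge0. Qed.

Lemma measurable_stein_weiss_kernel a b l : measurable_fun setT (stein_weiss_kernel a b l).
Proof.
apply: measurable_fun_ifT => //.
- apply: measurable_and.
    by apply: measurable_fun_ltr => //; exact: measurable_abs_fst.
  apply: measurable_and.
    by apply: measurable_fun_ltr => //; exact: measurable_abs_snd.
  by apply: measurable_fun_ltr => //; exact: measurable_abs_sub.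
- apply: measurable_funM; first apply: measurable_funM.
  + by apply: measurable_powR_comp; exact: measurable_abs_snd.
  + by apply: measurable_powR_comp; exact: measurable_abs_fst.
  + by apply: measurable_powR_comp; exact: measurable_abs_sub.
Qed.

Lemma lepowRN (a x y : R) : 0 <= a -> 0 < x -> x <= y -> y `^ (- a) <= x `^ (- a).
Proof.
move=> a0 x0 xy; rewrite !powRN lef_pV2 ?posrE ?powR_gt0 ?(lt_le_trans x0)//.
by rewrite ge0_ler_powR ?nnegrE ?(ltW x0)// ltW// (lt_le_trans x0).
Qed.

Lemma powR_quotient_le2 (k x y : R) : 0 < x -> 0 < y -> x <= 2 * y -> y <= 2 * x ->
  y `^ k * x `^ (- k) <= 2 `^ `|k|.
Proof.
move=> x0 y0 xy yx.
rewrite !powR_expR_ln// -expRD ler_expR mulNr -mulrBr.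
have h1 : ln y - ln x <= ln 2.
  by rewrite lerBlDr -lnM ?posrE// ler_ln ?posrE ?mulr_gt0.
have h2 : ln x - ln y <= ln 2.
  by rewrite lerBlDr -lnM ?posrE// ler_ln ?posrE ?mulr_gt0.
apply: le_trans (ler_norm _) _; rewrite normrM ler_wpM2l// ler_norml; apply/andP; split; lra.
Qed.

(** Here D >= x - y >= x / 2, so the distance is absorbed in the power of the larger variable and a
    Hardy kernel remains. *)
Lemma stein_weiss_far (a b l x y D : R) : 0 <= l -> 0 < y -> 2 * y <= x -> x - y <= D ->
  y `^ (- a) * x `^ (- b) * D `^ (- l) <= 2 `^ l * (y `^ (- a) * x `^ (- (l + b))).
Proof.
move=> l0 y0 yx xyD.
have x0 : 0 < x by lra.
have x2 : 0 < x / 2 by rewrite divr_gt0.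
have xD : x / 2 <= D by lra.
apply: (@le_trans _ _ (y `^ (- a) * x `^ (- b) * (x / 2) `^ (- l))).
  by rewrite ler_wpM2l ?mulr_ge0 ?powR_ge0//; exact: lepowRN.
rewrite !powR_expR_ln// ln_div ?posrE// -!expRD ler_expR.
by rewrite le_eqVlt; apply/orP; left; apply/eqP; ring.
Qed.

(** Both variables are at least D / 3, so nonnegative powers of 1/x and 1/y are absorbed in the
    distance and a Riesz kernel remains. *)
Lemma stein_weiss_near (a b l x y D : R) : 0 <= a -> 0 <= b ->
  0 < x -> 0 < y -> x <= 2 * y -> y <= 2 * x -> 0 < D -> D <= x + y ->
  y `^ (- a) * x `^ (- b) * D `^ (- l) <= 3 `^ (a + b) * D `^ (- (l + a + b)).
Proof.
move=> a0 b0 x0 y0 xy yx D0 Dxy.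
have D3 : 0 < D / 3 by rewrite divr_gt0.
have Dx : D / 3 <= x by lra.
have Dy : D / 3 <= y by lra.
apply: (@le_trans _ _ ((D / 3) `^ (- a) * (D / 3) `^ (- b) * D `^ (- l))).
  rewrite ler_wpM2r ?powR_ge0// ler_pM ?powR_ge0//; exact: lepowRN.
rewrite !powR_expR_ln// ln_div ?posrE// -!expRD ler_expR.
by rewrite le_eqVlt; apply/orP; left; apply/eqP; ring.
Qed.

(** For comparable x and y only the total exponent of the weights matters; it is redistributed in
    the proportion P to Q, at the cost of a power of y/x, which lies between 1/2 and 2. *)
Lemma stein_weiss_diagonal (P Q a b l x y D : R) : P + Q = 1 -> a + b + l = 1 ->
  0 < x -> 0 < y -> x <= 2 * y -> y <= 2 * x -> 0 < D ->
  y `^ (- a) * x `^ (- b) * D `^ (- l) <=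
  3 `^ (1 - l) * 2 `^ `|(1 - l) * P - a| *
  (((3 * y) `^ (- (1 - l)) * D `^ (1 - l - 1)) `^ P *
   ((3 * x) `^ (- (1 - l)) * D `^ (1 - l - 1)) `^ Q).
Proof.
move=> PQ abl x0 y0 xy yx D0.
have := powR_quotient_le2 ((1 - l) * P - a) x0 y0 xy yx.
set K := 2 `^ _ => HK.
apply: (@le_trans _ _ (3 `^ (1 - l) * (y `^ ((1 - l) * P - a) * x `^ (- ((1 - l) * P - a))) *
  (((3 * y) `^ (- (1 - l)) * D `^ (1 - l - 1)) `^ P *
   ((3 * x) `^ (- (1 - l)) * D `^ (1 - l - 1)) `^ Q))); last first.
  by rewrite ler_wpM2r ?mulr_ge0 ?powR_ge0// ler_wpM2l// powR_ge0.
rewrite !powR_expR_ln ?mulr_gt0// ?powR_expR_ln ?mulr_gt0 ?expR_gt0// !lnM ?posrE ?expR_gt0// !expRK.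
rewrite -!expRD ler_expR le_eqVlt; apply/orP; left; apply/eqP.
have -> : Q = 1 - P by rewrite -PQ; ring.
have -> : b = 1 - l - a by rewrite -abl; ring.
by ring.
Qed.

Lemma stein_weiss_line (P Q a b l : R) : P < 1 -> Q < 1 -> 1 <= P + Q ->
  0 <= a -> 0 <= b -> a < 1 - P -> b < 1 - Q -> l < 1 -> a + b + l = 2 - P - Q ->
  exists C, bilinear_bound L (stein_weiss_kernel a b l) P Q C.
Proof.
move=> P1 Q1 PQ a0 b0 aP bQ l1 abl.
have l0 : 0 <= l by lra.
have P0 : 0 < P by lra.
have Q0 : 0 < Q by lra.
have ac : a + (l + b) = 2 - P - Q by lra.
have bc : b + (l + a) = 2 - Q - P by lra.
have QP : 1 <= Q + P by lra.
have [C1 H1] := bilinear_hardy P1 Q1 PQ aP ac.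
(* For |y| > 2|x| the variables, the weights and the exponents P, Q exchange their roles. *)
have [C2 H2] := bilinear_hardy Q1 P1 QP bQ bc.
have {H2} := bilinear_bound_swap (measurable_hardy_kernel b (l + a)) (hardy_kernel_ge0 b (l + a)) H2.
set h2 := fun z : T * T => _ => H2.
have mh2 : measurable_fun setT h2.
  by apply: measurableT_comp (measurable_hardy_kernel b (l + a)) _; exact: measurable_swap.
have h20 z : 0 <= h2 z by exact: hardy_kernel_ge0.
(* Only the region of comparable variables distinguishes P + Q = 1 from P + Q > 1: at P + Q = 1,
   absorbing the weights in the distance would leave 1/|x - y|, which is not locally integrable. *)
have [k3 [mk3 k30 [C3 H3] kle]] : exists k3 : T * T -> R,
  [/\ measurable_fun setT k3, forall z, 0 <= k3 z,
   exists C, bilinear_bound L k3 P Q C &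
   forall z : T * T, 0 < `|z.1| -> 0 < `|z.2| -> 0 < `|z.1 - z.2| ->
     `|z.1| <= 2 * `|z.2| -> `|z.2| <= 2 * `|z.1| ->
     `|z.2| `^ (- a) * `|z.1| `^ (- b) * `|z.1 - z.2| `^ (- l) <= k3 z].
  move: PQ; rewrite le_eqVlt => /predU1P[PQ1|PQ1]; last first.
    exists (fun z => 3 `^ (a + b) * riesz_kernel (l + a + b) z); split.
    - by apply: measurable_funM => //; exact: measurable_riesz_kernel.
    - by move=> z; rewrite mulr_ge0 ?powR_ge0 ?riesz_kernel_ge0.
    - have lE : l + a + b = 2 - P - Q by lra.
      have [C H] := bilinear_riesz P1 Q1 PQ1 lE.
      exists (3 `^ (a + b) * C); apply: bilinear_boundZ H; last exact: powR_ge0.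
      + exact: measurable_riesz_kernel.
      + exact: riesz_kernel_ge0.
    - move=> z x0 y0 D0 xy yx; rewrite /riesz_kernel D0.
      by apply: stein_weiss_near => //; exact: ler_normB.
  pose c := 3 `^ (1 - l) * 2 `^ `|(1 - l) * P - a|.
  exists (fun z => c * diagonal_kernel P Q l z); split.
  - by apply: measurable_funM => //; exact: measurable_diagonal_kernel.
  - by move=> z; rewrite mulr_ge0 ?diagonal_kernel_ge0// mulr_ge0 ?powR_ge0.
  - have [C H] := bilinear_diagonal P0 Q0 (esym PQ1) l1.
    exists (c * C); apply: bilinear_boundZ H; last by rewrite mulr_ge0 ?powR_ge0.
    + exact: measurable_diagonal_kernel.
    + exact: diagonal_kernel_ge0.
  - move=> z x0 y0 D0 xy yx.
    have abl1 : a + b + l = 1 by lra.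
    have Dxy : `|z.1 - z.2| <= `|z.1| + `|z.2| by exact: ler_normB.
    apply: le_trans (stein_weiss_diagonal (esym PQ1) abl1 x0 y0 xy yx D0) _.
    rewrite /diagonal_kernel /diagonal_weight /near_pow/= [`|z.2 - z.1|]distrC.
    by rewrite !ifT//; lra.
pose k := fun z => 2 `^ l * hardy_kernel a (l + b) z + 2 `^ l * h2 z + k3 z.
have p2 : 0 <= 2 `^ l :> R by exact: powR_ge0.
have mh1 := measurable_hardy_kernel a (l + b).
have h10 := hardy_kernel_ge0 a (l + b).
have m1 : measurable_fun setT (fun z => 2 `^ l * hardy_kernel a (l + b) z) by exact: measurable_funM.
have m2 : measurable_fun setT (fun z => 2 `^ l * h2 z) by exact: measurable_funM.
exists (2 `^ l * C1 + 2 `^ l * C2 + C3).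
apply: (@bilinear_bound_le _ _ _ _ _ k).
- exact: measurable_stein_weiss_kernel.
- by apply: measurable_funD => //; exact: measurable_funD.
- exact: stein_weiss_kernel_ge0.
- move=> z; have kz0 : 0 <= k z by rewrite !addr_ge0// mulr_ge0.
  rewrite /stein_weiss_kernel; case: ifPn => [/and3P[x0 y0 D0]|//].
  have [yx|xy] := leP (2 * `|z.2|) `|z.1|.
    apply: (@le_trans _ _ (2 `^ l * hardy_kernel a (l + b) z)); last first.
      by rewrite /k -addrA lerDl addr_ge0// mulr_ge0.
    rewrite /hardy_kernel y0/= ifT; last by lra.
    by apply: stein_weiss_far => //; exact: lerB_dist.
  have [xy'|yx] := leP (2 * `|z.1|) `|z.2|.
    apply: (@le_trans _ _ (2 `^ l * h2 z)); last first.
      by rewrite /k addrAC lerDr addr_ge0// mulr_ge0.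
    rewrite /h2 /hardy_kernel/= x0/= ifT; last by lra.
    rewrite [X in X * _ <= _]mulrC.
    by apply: stein_weiss_far => //; rewrite distrC; exact: lerB_dist.
  apply: le_trans (kle _ _ _ _ _ _) _ => //; [lra|lra|].
  by rewrite /k lerDr addr_ge0// mulr_ge0.
- apply: bilinear_boundD => //.
  + exact: measurable_funD.
  + by move=> z; rewrite addr_ge0// mulr_ge0.
  + apply: bilinear_boundD => //.
    * by move=> z; rewrite mulr_ge0.
    * by move=> z; rewrite mulr_ge0.
    * exact: bilinear_boundZ.
    * exact: bilinear_boundZ.
Qed.

End stein_weiss_line.

(** * Tensorization *)

Lemma powRVl (R : realType) (x p : R) : 0 < x -> x^-1 `^ p = (x `^ p)^-1.
Proof. by move=> x0; rewrite -powR_inv1 ?(ltW x0)// -powRrM mulN1r powRN. Qed.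

Section bilinear_bound_homogeneous.
Context (R : realType) d (T : measurableType d).
Variable mu : {sigma_finite_measure set T -> \bar R}.
Local Open Scope ereal_scope.

(** Rescaling reduces densities of arbitrary mass to mass 1. In the tensorization this is applied to
    slices, whose masses are the values of the marginals. *)
Lemma bilinear_bound_homogeneous (k : T * T -> R) (P Q C a b : R) (u v : T -> R) :
  measurable_fun setT k -> (forall z, 0 <= k z)%R -> (0 < P)%R -> (0 < Q)%R -> (0 <= C)%R ->
  bilinear_bound mu k P Q C ->
  measurable_fun setT u -> measurable_fun setT v ->
  (forall x, 0 <= u x)%R -> (forall x, 0 <= v x)%R -> (0 <= a)%R -> (0 <= b)%R ->
  \int[mu]_x (u x)%:E <= a%:E -> \int[mu]_x (v x)%:E <= b%:E ->
  \int[mu \x mu]_z (k z * u z.2 `^ P * v z.1 `^ Q)%:E <= (C * a `^ P * b `^ Q)%:E.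
Proof.
move=> mk k0 P0 Q0 C0 bnd mu_ mv u0 v0 a0 b0 ua vb.
have mI : measurable_fun [set: T * T] (fun z => (k z * u z.2 `^ P * v z.1 `^ Q)%R).
  apply: measurable_funM; first apply: measurable_funM => //.
  - by apply: measurable_powR_comp; exact: measurable_comp_snd.
  - by apply: measurable_powR_comp; exact: measurable_comp_fst.
(* Dividing by the masses requires them to be positive. Zero masses are reached at the end, with a +
   1/(n+1) and b + 1/(n+1) as n grows. *)
have pos (a' b' : R) : ((0 < a')%R -> (0 < b')%R -> (a <= a')%R -> (b <= b')%R ->
  \int[mu \x mu]_z (k z * u z.2 `^ P * v z.1 `^ Q)%:E <= (C * a' `^ P * b' `^ Q)%:E).
  move=> a'0 b'0 aa' bb'.
  have := bnd (fun x => a'^-1 * u x)%R (fun x => b'^-1 * v x)%R.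
  have mu' : measurable_fun setT (fun x => a'^-1 * u x)%R by exact: measurable_funM.
  have mv' : measurable_fun setT (fun x => b'^-1 * v x)%R by exact: measurable_funM.
  move=> /(_ mu' mv') H.
  have {}H : \int[mu \x mu]_z (k z * (a'^-1 * u z.2) `^ P * (b'^-1 * v z.1) `^ Q)%:E <= C%:E.
    apply: H.
    - by move=> x; rewrite mulr_ge0 ?invr_ge0 ?(ltW a'0).
    - by move=> x; rewrite mulr_ge0 ?invr_ge0 ?(ltW b'0).
    - under eq_integral do rewrite EFinM.
      rewrite ge0_integralZl//; last 3 first.
      + exact/measurable_EFinP.
      + by move=> x _; rewrite lee_fin.
      + by rewrite lee_fin invr_ge0 ltW.
      rewrite muleC lee_pdivrMr// mul1e; apply: le_trans ua _.
      by rewrite lee_fin.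
    - under eq_integral do rewrite EFinM.
      rewrite ge0_integralZl//; last 3 first.
      + exact/measurable_EFinP.
      + by move=> x _; rewrite lee_fin.
      + by rewrite lee_fin invr_ge0 ltW.
      rewrite muleC lee_pdivrMr// mul1e; apply: le_trans vb _.
      by rewrite lee_fin.
  rewrite -mulrA [(C * _)%R]mulrC EFinM -lee_pdivrMl; last by rewrite mulr_gt0 ?powR_gt0.
  apply: le_trans H; rewrite -ge0_integralZl//; last 3 first.
  - exact/measurable_EFinP.
  - by move=> z _; rewrite lee_fin !mulr_ge0 ?powR_ge0.
  - by rewrite lee_fin invr_ge0 mulr_ge0 ?powR_ge0.
  rewrite le_eqVlt; apply/orP; left; apply/eqP; apply: eq_integral => z _.
  rewrite -EFinM; congr EFin; rewrite !powRM ?invr_ge0 ?(ltW a'0) ?(ltW b'0)//.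
  rewrite !powRVl// invfM.
  by ring.
have cvgf (c p : R) : (0 < p)%R -> (0 <= c)%R -> ((c + n.+1%:R^-1) `^ p)%R @[n --> \oo] --> (c `^ p)%R.
  move=> p0 c0.
  have cv : (c + n.+1%:R^-1)%R @[n --> \oo] --> c.
    rewrite -[X in _ --> X]addr0; apply: cvgD; first exact: cvg_cst.
    exact: cvg_harmonic.
  move: c0; rewrite le_eqVlt => /predU1P[c0|c0]; last first.
    by apply: (@continuous_cvg _ _ _ _ _ (fun n => c + n.+1%:R^-1)%R (@powR R ^~ p)) => //; exact: continuous_powR_gt0.
  rewrite -c0 powR0 ?gt_eqF//.
  apply/cvgrPdist_lt => e e0.
  have ep : (0 < e `^ p^-1)%R by rewrite powR_gt0.
  near=> n.
  rewrite sub0r normrN ger0_norm ?powR_ge0// add0r.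
  have eE : (e = (e `^ p^-1) `^ p)%R by rewrite -powRrM mulVf ?gt_eqF// powRr1// ltW.
  rewrite [ltRHS]eE.
  rewrite gt0_ltr_powR ?nnegrE ?(ltW ep)//.
  near: n; exact: near_infty_natSinv_lt (PosNum ep).
have cvgC : (C * (a + n.+1%:R^-1) `^ P * (b + n.+1%:R^-1) `^ Q)%:E @[n --> \oo] -->
   (C * a `^ P * b `^ Q)%:E.
  apply: cvg_EFin; first exact: nearW.
  by apply: cvgM; [apply: cvgM; [exact: cvg_cst|exact: cvgf]|exact: cvgf].
rewrite -(cvg_lim _ cvgC)//; apply: lime_ge; first exact: cvgP cvgC.
apply: nearW => n; have n0 : (0 < n.+1%:R^-1 :> R)%R by rewrite invr_gt0.
by apply: pos; rewrite ?ltr_wpDl// ler_wpDr// ltW.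
Unshelve. all: end_near. Qed.

End bilinear_bound_homogeneous.

Section bilinear_bound_tensor.
Context (R : realType) d d1 d2 (T : measurableType d)
  (T1 : measurableType d1) (T2 : measurableType d2).
Variable mu : {sigma_finite_measure set T -> \bar R}.
Variable m1 : {sigma_finite_measure set T1 -> \bar R}.
Variable m2 : {sigma_finite_measure set T2 -> \bar R}.
Variable phi : T1 * T2 -> T.
Local Open Scope ereal_scope.
Hypothesis mphi : measurable_fun setT phi.
Hypothesis integral_phi : forall f : T -> \bar R, measurable_fun setT f ->
  (forall x, 0 <= f x) -> \int[mu]_x f x = \int[m1 \x m2]_z f (phi z).

(** A marginal can be infinite on a null set, where [fine] replaces it by 0; hence the almost
    everywhere clause in [marginalP]. *)
Let marginal (u : T -> R) y2 := fine (\int[m1]_y1 (u (phi (y1, y2)))%:E).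

Lemma marginalP (u : T -> R) : measurable_fun setT u ->
  (forall z, 0 <= u z)%R -> \int[mu]_z (u z)%:E <= 1 ->
  [/\ measurable_fun setT (marginal u),
      \int[m2]_y2 (marginal u y2)%:E <= 1 &
      {ae m2, forall y2, \int[m1]_y1 (u (phi (y1, y2)))%:E = (marginal u y2)%:E}].
Proof.
move=> mu_ u0 u1.
pose f := EFin \o u \o phi.
have mE : measurable_fun setT f.
  by apply: measurableT_comp mphi; exact/measurable_EFinP.
have E0 z : 0 <= f z by rewrite lee_fin.
have mG : measurable_fun setT (fubini_G m1 f) by exact: measurable_fun_fubini_tonelli_G.
have G0 y : 0 <= fubini_G m1 f y by exact: integral_ge0.
have G1 : \int[m2]_y fubini_G m1 f y <= 1.
  rewrite -fubini_tonelli2//; apply: le_trans u1.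
  by rewrite [leRHS]integral_phi//; exact/measurable_EFinP.
have mf : measurable_fun setT (marginal u).
  by apply: measurableT_comp mG; exact: fine_measurable.
split => //.
- apply: le_trans G1; apply: ge0_le_integral => //.
  + by move=> y _; rewrite lee_fin fine_ge0// G0.
  + exact/measurable_EFinP.
  + move=> y _; rewrite /marginal -[leRHS]/(\int[m1]_y1 (u (phi (y1, y)))%:E).
    have : 0 <= \int[m1]_y1 (u (phi (y1, y)))%:E by apply: integral_ge0 => ? _; rewrite lee_fin.
    by case: (\int[m1]_y1 _) => [r| |]//= _; rewrite leey.
- have : m2.-integrable setT (fubini_G m1 f).
    apply/integrableP; split => //.
    under eq_integral do rewrite gee0_abs//.
    by apply: le_lt_trans G1 _; rewrite ltry.
  move=> /(integrable_ae measurableT); apply: filterS => y /(_ I) yfin.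
  by rewrite /marginal fineK.
Qed.

(** For fixed second coordinates the bound on the first factor applies to the slices of u and v and
    yields C1 U^P V^Q with the marginals U, V. These are again densities of mass at most 1, to which
    the bound on the second factor applies. The map [phi] is there because a tuple is not literally
    a pair. *)
Lemma bilinear_bound_tensor (k : T * T -> R) (k1 : T1 * T1 -> R) (k2 : T2 * T2 -> R) (P Q C1 C2 : R) :
  measurable_fun setT k -> measurable_fun setT k1 -> measurable_fun setT k2 ->
  (forall z, 0 <= k1 z)%R -> (forall z, 0 <= k2 z)%R -> (forall z, 0 <= k z)%R ->
  (forall x y, k (phi x, phi y) = k1 (x.1, y.1) * k2 (x.2, y.2))%R ->
  (0 < P)%R -> (0 < Q)%R -> (0 <= C1)%R ->
  bilinear_bound m1 k1 P Q C1 -> bilinear_bound m2 k2 P Q C2 ->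
  bilinear_bound mu k P Q (C1 * C2).
Proof.
move=> mk mk1 mk2 k10 k20 k0 kE P0 Q0 C10 b1 b2 u v mu_ mv u0 v0 u1 v1.
have [mU U1 Uae] := marginalP mu_ u0 u1.
have [mV V1 Vae] := marginalP mv v0 v1.
set U := marginal u in mU U1 Uae.
set V := marginal v in mV V1 Vae.
have U0 y : (0 <= U y)%R by rewrite fine_ge0// integral_ge0// => ? _; rewrite lee_fin.
have V0 y : (0 <= V y)%R by rewrite fine_ge0// integral_ge0// => ? _; rewrite lee_fin.
pose F (z : T * T) : \bar R := (k z * u z.2 `^ P * v z.1 `^ Q)%:E.
have mF : measurable_fun setT F.
  apply/measurable_EFinP; apply: measurable_funM; first apply: measurable_funM => //.
  - by apply: measurable_powR_comp; exact: measurable_comp_snd.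
  - by apply: measurable_powR_comp; exact: measurable_comp_fst.
have F0 z : 0 <= F z by rewrite lee_fin !mulr_ge0 ?powR_ge0.
have mFF d' (T' : measurableType d') (a b : T' -> T1 * T2) : measurable_fun setT a -> measurable_fun setT b ->
    measurable_fun setT (fun w => F (phi (a w), phi (b w))).
  move=> ma mb; apply: (measurableT_comp mF); apply: measurable_fun_pair => /=.
  - exact: measurableT_comp mphi ma.
  - exact: measurableT_comp mphi mb.
pose G := fubini_F mu F.
have mG : measurable_fun setT G by exact: measurable_fun_fubini_tonelli_F.
have G0 z : 0 <= G z by exact: integral_ge0.
have mGphi : measurable_fun setT (G \o phi) by exact: measurableT_comp.
rewrite -[leLHS]/(\int[mu \x mu]_z F z) fubini_tonelli1//.
rewrite -/G integral_phi//.
rewrite (fubini_tonelli2 (G \o phi))//; last by move=> z; exact: G0.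
(* The bilinear form of the first factor on the slices at x2 and y2. *)
pose J (x2 y2 : T2) := \int[m1]_x1 \int[m1]_y1 F (phi (x1, x2), phi (y1, y2)).
have J0 x2 y2 : 0 <= J x2 y2 by apply: integral_ge0 => ? _; exact: integral_ge0.
have mJ0 x2 : measurable_fun [set: (T1 * T2) * T1] (fun w => F (phi (w.1.1, x2), phi (w.2, w.1.2))).
  apply: mFF; apply: measurable_fun_pair => //=.
  - exact: (measurableT_comp measurable_fst measurable_fst).
  - exact: (measurableT_comp measurable_snd measurable_fst).
(* The integral over y1 alone, as a function of (x1, y2), so that Tonelli can exchange these two
   variables. *)
pose H x2 := fubini_F m1 (fun w : (T1 * T2) * T1 => F (phi (w.1.1, x2), phi (w.2, w.1.2))).
have mH x2 : measurable_fun setT (H x2) by exact: measurable_fun_fubini_tonelli_F.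
have H0 x2 z : 0 <= H x2 z by exact: integral_ge0.
have mJ x2 : measurable_fun setT (J x2) by exact: (measurable_fun_fubini_tonelli_G (H x2)).
have GJ x2 : fubini_G m1 (G \o phi) x2 = \int[m2]_y2 J x2 y2.
  rewrite /fubini_G/=.
  transitivity (\int[m1]_x1 \int[m2]_y2 H x2 (x1, y2)); last exact: fubini_tonelli.
  apply: eq_integral => x1 _; rewrite /G /fubini_F integral_phi//; last first.
    by apply: (measurableT_comp mF); exact: measurable_pair1.
  by rewrite (fubini_tonelli2 (fun z => F (phi (x1, x2), phi z)))//; apply: mFF.
under eq_integral do rewrite GJ.
apply: (@le_trans _ _ (\int[m2]_x2 \int[m2]_y2 (C1 * (k2 (x2, y2) * U y2 `^ P * V x2 `^ Q))%:E)).
  have mK : measurable_fun [set: T2 * T2] (fun z => (C1 * (k2 z * U z.2 `^ P * V z.1 `^ Q))%:E).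
    apply/measurable_EFinP; apply: measurable_funM => //; apply: measurable_funM; first apply: measurable_funM => //.
    - by apply: measurable_powR_comp; exact: measurable_comp_snd.
    - by apply: measurable_powR_comp; exact: measurable_comp_fst.
  have K0 z : 0 <= (C1 * (k2 z * U z.2 `^ P * V z.1 `^ Q))%:E by rewrite lee_fin !mulr_ge0 ?powR_ge0.
  apply: ae_ge0_le_integral => //.
  - by move=> x2 _; exact: integral_ge0.
  - rewrite (_ : (fun _ => _) = fubini_G m1 (G \o phi)); last by apply/funext => x2; rewrite GJ.
    by apply: (measurable_fun_fubini_tonelli_G (G \o phi)) => // z; exact: G0.
  - by move=> x2 _; apply: integral_ge0 => y2 _; exact: (K0 (x2, y2)).
  - exact: (measurable_fun_fubini_tonelli_F (fun z => (C1 * (k2 z * U z.2 `^ P * V z.1 `^ Q))%:E)).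
  apply: filterS Vae => x2 Vx2 _.
  apply: ae_ge0_le_integral => //.
    exact: (measurableT_comp mK (measurable_pair1 x2)).
  apply: filterS Uae => y2 Uy2 _.
  rewrite /J.
  pose u' y1 := u (phi (y1, y2)); pose v' x1 := v (phi (x1, x2)).
  have mu' : measurable_fun setT u'.
    by apply: (measurableT_comp mu_); apply: (measurableT_comp mphi); exact: measurable_pair2.
  have mv' : measurable_fun setT v'.
    by apply: (measurableT_comp mv); apply: (measurableT_comp mphi); exact: measurable_pair2.
  have mI : measurable_fun [set: T1 * T1] (fun z => (k1 z * u' z.2 `^ P * v' z.1 `^ Q)%R).
    apply: measurable_funM; first apply: measurable_funM => //.
    - by apply: measurable_powR_comp; exact: measurable_comp_snd.
    - by apply: measurable_powR_comp; exact: measurable_comp_fst.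
  apply: (@le_trans _ _ ((k2 (x2, y2))%:E *
     \int[m1 \x m1]_z (k1 z * u' z.2 `^ P * v' z.1 `^ Q)%:E)).
    rewrite -ge0_integralZl//; last 3 first.
    - exact/measurable_EFinP.
    - by move=> z _; rewrite lee_fin !mulr_ge0 ?powR_ge0.
    - by rewrite lee_fin.
    rewrite fubini_tonelli1; last 2 first.
    - by apply/measurable_EFinP; apply: measurable_funM.
    - by move=> z; rewrite -EFinM lee_fin !mulr_ge0 ?powR_ge0.
    rewrite le_eqVlt; apply/orP; left; apply/eqP.
    apply: eq_integral => x1 _; apply: eq_integral => y1 _ /=.
    rewrite /F kE/= -EFinM; congr EFin; rewrite /u' /v'/=.
    by rewrite [(k1 _ * k2 _)%R]mulrC !mulrA.
  have bb := bilinear_bound_homogeneous mk1 k10 P0 Q0 C10 b1 mu' mv'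
    (fun _ => u0 _) (fun _ => v0 _) (U0 y2) (V0 x2).
  apply: (@le_trans _ _ ((k2 (x2, y2))%:E * (C1 * U y2 `^ P * V x2 `^ Q)%:E)).
    by rewrite lee_wpmul2l ?lee_fin//; apply: bb; [rewrite Uy2|rewrite Vx2].
  rewrite -EFinM lee_fin le_eqVlt; apply/orP; left; apply/eqP.
  by rewrite !mulrA [(k2 _ * C1)%R]mulrC.
have mK2 : measurable_fun [set: T2 * T2] (fun z => (k2 z * U z.2 `^ P * V z.1 `^ Q)%:E).
  apply/measurable_EFinP; apply: measurable_funM; first apply: measurable_funM => //.
  - by apply: measurable_powR_comp; exact: measurable_comp_snd.
  - by apply: measurable_powR_comp; exact: measurable_comp_fst.
apply: (@le_trans _ _ (C1%:E * \int[m2 \x m2]_z (k2 z * U z.2 `^ P * V z.1 `^ Q)%:E)).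
  have K20 z : [set: T2 * T2] z -> 0 <= (k2 z * U z.2 `^ P * V z.1 `^ Q)%:E.
    by rewrite lee_fin !mulr_ge0 ?powR_ge0.
  have C1E : 0 <= C1%:E by rewrite lee_fin.
  rewrite -(ge0_integralZl _ measurableT mK2 K20 C1E).
  rewrite fubini_tonelli1//.
  - exact: emeasurable_funM.
  - by move=> z; rewrite -EFinM lee_fin !mulr_ge0 ?powR_ge0.
by rewrite EFinM lee_wpmul2l ?lee_fin//; exact: b2.
Qed.

End bilinear_bound_tensor.

Section leb_cons.
Context (R : realType).
Local Notation T d := (rspace R d).
Local Open Scope ereal_scope.

Lemma ge0_integral_leb_cons d (f : T d.+1 -> \bar R) : measurable_fun setT f ->
  (forall x, 0 <= f x) ->
  \int[leb d.+1]_x f x = \int[@lebesgue_measure R \x leb d]_z f (consp z).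
Proof.
move=> mf f0.
have := ge0_integral_pushforward (@measurable_consp R d) (@lebesgue_measure R \x leb d)%E measurableT mf (fun x _ => f0 x).
by rewrite preimage_setT.
Qed.

Lemma ge0_integral_leb0 (f : T 0 -> \bar R) : measurable_fun setT f ->
  \int[leb 0]_x f x = f [tuple].
Proof. by move=> mf; rewrite /= integral_dirac// diracT mul1e. Qed.

Lemma tnth_consp0 d (z : measurableTypeR R * T d) : tnth (consp z) ord0 = z.1.
Proof. by []. Qed.

Lemma tnth_conspS d (z : measurableTypeR R * T d) i : tnth (consp z) (lift ord0 i) = tnth z.2 i.
Proof. by rewrite (tnth_nth (0 : R)%R) [RHS](tnth_nth (0 : R)%R). Qed.

Lemma measurable_tnth_fst d i : measurable_fun [set: T d * T d] (fun z => tnth z.1 i).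
Proof. exact: (measurableT_comp (measurable_tnth i) measurable_fst). Qed.

Lemma measurable_tnth_snd d i : measurable_fun [set: T d * T d] (fun z => tnth z.2 i).
Proof. exact: (measurableT_comp (measurable_tnth i) measurable_snd). Qed.

Definition prod_kernel d (k1 : measurableTypeR R * measurableTypeR R -> R) (z : T d * T d) : R :=
  (\prod_(i < d) k1 (tnth z.1 i, tnth z.2 i))%R.

Lemma prod_kernel_ge0 d (k1 : measurableTypeR R * measurableTypeR R -> R) z : (forall z, 0 <= k1 z)%R -> (0 <= @prod_kernel d k1 z)%R.
Proof. by move=> k10; apply: prodr_ge0. Qed.

Lemma measurable_prod_kernel d (k1 : measurableTypeR R * measurableTypeR R -> R) : measurable_fun setT k1 ->
  measurable_fun setT (@prod_kernel d k1).
Proof.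
move=> mk1; apply: measurable_prod => i _; apply: (measurableT_comp mk1).
by apply: measurable_fun_pair => /=; [exact: measurable_tnth_fst|exact: measurable_tnth_snd].
Qed.

Lemma bilinear_bound_prod d (k1 : measurableTypeR R * measurableTypeR R -> R) (P Q C : R) : measurable_fun setT k1 ->
  (forall z, 0 <= k1 z)%R -> (0 < P)%R -> (0 < Q)%R -> (0 <= C)%R ->
  bilinear_bound (@lebesgue_measure R) k1 P Q C ->
  bilinear_bound (leb d) (@prod_kernel d k1) P Q (C ^+ d).
Proof.
move=> mk1 k10 P0 Q0 C0 b1; elim: d => [|d IH].
  (* In dimension 0 the measure is a unit mass, the densities are numbers at most 1, and the
     constant is C^0 = 1. *)
  move=> u v mu mv u0 v0.
  rewrite !ge0_integral_leb0; [|exact/measurable_EFinP|exact/measurable_EFinP].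
  move=> u1 v1.
  have mI : measurable_fun setT (fun z => (@prod_kernel 0 k1 z * u z.2 `^ P * v z.1 `^ Q)%:E).
    apply/measurable_EFinP; apply: measurable_funM; first apply: measurable_funM.
    - exact: measurable_prod_kernel.
    - by apply: measurable_powR_comp; exact: measurable_comp_snd.
    - by apply: measurable_powR_comp; exact: measurable_comp_fst.
  rewrite fubini_tonelli1//; last first.
    by move=> z; rewrite lee_fin !mulr_ge0 ?powR_ge0 ?prod_kernel_ge0.
  rewrite ge0_integral_leb0; last first.
    apply: measurable_fun_fubini_tonelli_F => //.
    by move=> z; rewrite lee_fin !mulr_ge0 ?powR_ge0 ?prod_kernel_ge0.
  rewrite /fubini_F ge0_integral_leb0; last first.
    exact: (measurableT_comp mI (measurable_pair1 _)).
  rewrite /prod_kernel big_ord0 expr0 mul1r lee_fin -[leRHS]mulr1.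
  rewrite !lee_fin in u1 v1.
  have one r : (1 `^ r = 1 :> R)%R by rewrite powR1.
  rewrite ler_pM ?powR_ge0//.
    by rewrite -[leRHS](one P) ge0_ler_powR ?nnegrE// ltW.
  by rewrite -[leRHS](one Q) ge0_ler_powR ?nnegrE// ltW.
rewrite exprS.
apply: (@bilinear_bound_tensor R _ _ _ (T d.+1) _ (T d) (leb d.+1) (@lebesgue_measure R) (leb d) (@consp R d) _ _
   (prod_kernel k1) k1 (prod_kernel k1)) => //.
- exact: measurable_consp.
- exact: ge0_integral_leb_cons.
- exact: measurable_prod_kernel.
- exact: measurable_prod_kernel.
- by move=> z; exact: prod_kernel_ge0.
- by move=> z; exact: prod_kernel_ge0.
- move=> x y; rewrite /prod_kernel big_ord_recl/= !tnth_consp0.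
  by congr (_ * _)%R; apply: eq_bigr => i _; rewrite !tnth_conspS.
Qed.

End leb_cons.

(** * Mehler's formula *)

Section hermite_polynomials.
Context (R : realType).

Lemma deriv_hermiteS n : (hermite R n.+1)^`() = (2 * n.+1%:R) *: hermite R n.
Proof.
have d2 : (2%:P * 'X : {poly R})^`() = 2%:P.
  by rewrite derivM derivC mul0r add0r derivX mulr1.
elim: n => [|n IH].
  have -> : hermite R 1 = 2%:P * 'X by rewrite /= (_ : 1 = 1%:P)// derivC subr0 mulr1.
  by rewrite d2 mulr1 -mul_polyC mulr1.
have -> : (hermite R n.+2)^`() =
    2%:P * hermite R n.+1 + 2%:P * 'X * (hermite R n.+1)^`() - (hermite R n.+1)^`()^`().
  by rewrite [hermite R n.+2]/(2%:P * 'X * hermite R n.+1 - (hermite R n.+1)^`()) derivB derivM d2.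
rewrite IH derivZ -scalerAr -addrA -scalerBr.
rewrite -[X in _ + _ *: X]/(hermite R n.+1) mul_polyC -scalerDl.
by congr (_ *: _); rewrite -[n.+2]addn1 natrD mulrDr mulr1 addrC.
Qed.

Lemma horner_hermite0 (x : R) : (hermite R 0).[x] = 1.
Proof. by rewrite hornerC. Qed.

Lemma horner_hermite1 (x : R) : (hermite R 1).[x] = 2 * x.
Proof. by rewrite /= (_ : 1 = 1%:P)// derivC subr0 mulr1 !hornerE. Qed.

Lemma horner_hermiteSS n (x : R) : (hermite R n.+2).[x] =
  2 * x * (hermite R n.+1).[x] - 2 * n.+1%:R * (hermite R n).[x].
Proof.
rewrite [hermite R n.+2]/(2%:P * 'X * hermite R n.+1 - (hermite R n.+1)^`()).
by rewrite deriv_hermiteS !hornerE.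
Qed.

(** The squared normalizing constant of [hermite_fun1], without its factor pi^(-1/2). *)
Definition hermite_weight n : R := (2 ^+ n * n`!%:R)^-1.

Lemma hermite_weight_gt0 n : 0 < hermite_weight n.
Proof. by rewrite invr_gt0 mulr_gt0 ?exprn_gt0// ltr0n fact_gt0. Qed.

Lemma hermite_weightS n : 2 * n.+1%:R * hermite_weight n.+1 = hermite_weight n.
Proof.
rewrite /hermite_weight factS natrM exprS; field.
by apply/and3P; split; rewrite ?expf_neq0// ?nat1r pnatr_eq0// -lt0n fact_gt0.
Qed.

End hermite_polynomials.

(** * Power series with coefficients of subexponential growth *)

Section subexponential_sequences.
Context (R : realType).
Implicit Types (c f g : nat -> R) (r : R).

(** The radius of convergence is at least 1, in a form visibly stable under sums, index shifts and
    multiplication by n. *)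
Definition subexponential c :=
  forall rho : R, 1 < rho -> exists C, forall n, `|c n| <= C * rho ^+ n.

Lemma subexponential_le f g : (forall n, `|f n| <= `|g n|) ->
  subexponential g -> subexponential f.
Proof.
by move=> fg sg rho /sg[C gC]; exists C => n; exact: le_trans (fg n) (gC n).
Qed.

Lemma subexponentialD f g : subexponential f -> subexponential g ->
  subexponential (fun n => f n + g n).
Proof.
move=> sf sg rho rho1; have [C fC] := sf rho rho1; have [D gD] := sg rho rho1.
by exists (C + D) => n; rewrite mulrDl; apply: le_trans (ler_normD _ _) (lerD _ _).
Qed.

Lemma subexponentialZ k f : subexponential f -> subexponential (fun n => k * f n).
Proof.
move=> sf rho /sf[C fC]; exists (`|k| * C) => n.
by rewrite normrM -mulrA ler_wpM2l.
Qed.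

Lemma subexponential_shift f : subexponential f -> subexponential (fun n => f n.+1).
Proof.
move=> sf rho /sf[C fC]; exists (C * rho) => n.
by rewrite -mulrA -exprS.
Qed.

Lemma subexponential_natmul f : subexponential f -> subexponential (fun n => n.+1%:R * f n).
Proof.
move=> sf rho rho1.
have s1 : 1 < Num.sqrt rho by rewrite -[ltLHS]sqrtr1 ltr_sqrt ?(lt_trans ltr01).
have [C fC] := sf _ s1.
pose d := Num.sqrt rho - 1.
have d0 : 0 < d by rewrite subr_gt0.
have C0 : 0 <= C by have := le_trans (normr_ge0 _) (fC 0%N); rewrite expr0 mulr1.
exists ((1 + d^-1) * C) => n.
rewrite normrM ger0_norm//.
(* One factor sqrt(rho)^n absorbs n + 1, by Bernoulli's inequality with [d]; the other one bounds
   f. *)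
have b : n.+1%:R <= (1 + d^-1) * Num.sqrt rho ^+ n.
  have : 1 + n%:R * d <= Num.sqrt rho ^+ n.
    have -> : Num.sqrt rho = 1 + d by rewrite /d addrC subrK.
    elim: n => [|n IH]; first by rewrite mul0r addr0 expr0.
    rewrite exprS; apply: le_trans (ler_wpM2l _ IH); last by rewrite addr_ge0// ltW.
    rewrite -subr_ge0 -natr1 (_ : _ - _ = n%:R * d * d); last by ring.
    by rewrite !mulr_ge0// ltW.
  move=> H; apply: le_trans (ler_wpM2l _ H); last by rewrite addr_ge0// invr_ge0 ltW.
  rewrite -subr_ge0 -natr1 (_ : _ - _ = n%:R * d + d^-1); last by field; rewrite gt_eqF.
  by rewrite addr_ge0 ?mulr_ge0 ?invr_ge0// ltW.
apply: le_trans (ler_pM _ _ b (fC n)) _ => //.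
by rewrite mulrACA -exprMn -expr2 sqr_sqrtr// ltW// (lt_trans ltr01).
Qed.

Lemma subexponential_cvg c r : subexponential c -> `|r| < 1 -> cvgn (pseries c r).
Proof.
(* This value exceeds 1 while |r| rho stays below 1. *)
move=> sc r1; pose rho := 2 / (1 + `|r|).
have d0 : 0 < 1 + `|r| by rewrite ltr_pwDl.
have rho1 : 1 < rho by rewrite ltr_pdivlMr// mul1r; lra.
have [C cC] := sc rho rho1.
have rr1 : `|r| * rho < 1 by rewrite /rho mulrA ltr_pdivrMr//; lra.
have rr0 : 0 <= `|r| * rho by rewrite mulr_ge0// ltW// (lt_trans ltr01).
have C0 : 0 <= C by have := le_trans (normr_ge0 _) (cC 0%N); rewrite expr0 mulr1.
apply: normed_cvg; rewrite /normed_series_of/=.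
apply: (@series_le_cvg _ _ (geometric C (`|r| * rho))) => //.
- by move=> n; rewrite /geometric/= mulr_ge0 ?exprn_ge0.
- move=> n; rewrite /geometric/= normrM normrX exprMn mulrA mulrAC.
  by rewrite ler_wpM2r ?exprn_ge0.
- by apply: is_cvg_geometric_series; rewrite ger0_norm.
Qed.

Definition psum c r := limn (pseries c r).

Lemma psumD f g r : subexponential f -> subexponential g -> `|r| < 1 ->
  psum (fun n => f n + g n) r = psum f r + psum g r.
Proof.
move=> sf sg r1; rewrite /psum /pseries.
rewrite -lim_seriesD; [|exact: subexponential_cvg|exact: subexponential_cvg].
by congr (limn (series _)); apply/funext => n /=; rewrite mulrDl.
Qed.

Lemma psumZ k f r : subexponential f -> `|r| < 1 ->
  psum (fun n => k * f n) r = k * psum f r.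
Proof.
move=> sf r1; rewrite /psum /pseries.
rewrite -[RHS]lim_seriesZ; last exact: subexponential_cvg.
by congr (limn (series _)); apply/funext => n /=; rewrite -mulrA.
Qed.

Lemma psum_shift f r : subexponential f -> `|r| < 1 ->
  psum f r = f 0%N + r * psum (fun n => f n.+1) r.
Proof.
move=> sf r1; have cS := subexponential_cvg (subexponential_shift sf) r1.
have cf := subexponential_cvg sf r1.
apply/cvg_lim => //; rewrite -cvg_shiftS.
have -> : [sequence pseries f r n.+1]_n =
   (fun n => f 0%N + r * pseries (fun n => f n.+1) r n).
  apply/funext => n /=; rewrite /pseries /series /=.
  rewrite big_nat_recl//= expr0 mulr1; congr (_ + _).
  by rewrite mulr_sumr; apply: eq_bigr => i _; rewrite exprS; ring.
by apply: cvgD; [exact: cvg_cst|apply: cvgMl_tmp].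
Qed.

Lemma is_derive_psum f r : subexponential f -> `|r| < 1 ->
  is_derive r 1 (psum f) (psum (fun n => n.+1%:R * f n.+1) r).
Proof.
(* The midpoint of |r| and 1: termwise differentiation needs convergence at a point strictly beyond
   |r|. *)
move=> sf r1; pose K := (1 + `|r|) / 2.
have K0 : 0 < K by rewrite divr_gt0// ltr_pwDl.
have rK : `|r| < `|K| by rewrite (gtr0_norm K0) ltr_pdivlMr//; lra.
have K1 : `|K| < 1 by rewrite (gtr0_norm K0) ltr_pdivrMr//; lra.
have sd g : subexponential g -> subexponential (pseries_diffs g).
  move=> sg; apply: (subexponential_le _ (subexponential_natmul (subexponential_shift sg))).
  by move=> n.
apply: (@pseries_snd_diffs _ f K r) rK.
- exact: subexponential_cvg.
- by apply: subexponential_cvg => //; exact: sd.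
- by apply: subexponential_cvg => //; exact: (sd _ (sd _ sf)).
Qed.

End subexponential_sequences.

Section hermite_growth.
Context (R : realType).

(* For [1 < rho] the step [e_(n+1) <= d e_n + (1 + d) e_(n-1)] with
   [d = rho - 1], valid for large [n], preserves the bound [C rho^n] because
   [d rho + 1 + d = rho^2]. *)
Lemma subexponential_hermite_sqr (x : R) :
  subexponential (fun n => (hermite R n).[x] ^+ 2 * hermite_weight R n).
Proof.
move=> rho rho1.
pose e n : R := (hermite R n).[x] ^+ 2 * hermite_weight R n.
have e0 n : 0 <= e n by rewrite mulr_ge0 ?sqr_ge0// ltW// hermite_weight_gt0.
pose d := rho - 1.
have d0 : 0 < d by rewrite subr_gt0.
(* Young's inequality with parameter [d] splits the squared recursion. The coefficient of e_(n+1) is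
   then (1 + 1/d) 2 x^2 / (n + 2), which is at most [d] as soon as n + 2 >= K. *)
pose K := (1 + d^-1) * (2 * x ^+ 2) / d.
pose N := (Num.truncn K).+1.
have step n : (N <= n)%N -> e n.+2 <= d * e n.+1 + (1 + d) * e n.
  move=> Nn.
  have Kn : K <= n.+2%:R.
    apply: ltW; apply: lt_le_trans (truncnS_gt _) _.
    by rewrite ler_nat (leq_trans Nn)// -addn2 leq_addr.
  have w0 := hermite_weight_gt0 R n.+2.
  set w := hermite_weight R n.+2 in w0.
  have w1 : hermite_weight R n.+1 = 2 * n.+2%:R * w by rewrite hermite_weightS.
  have w2 : hermite_weight R n = 2 * n.+1%:R * (2 * n.+2%:R * w) by rewrite !hermite_weightS.
  rewrite /e horner_hermiteSS w1 w2 -/w.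
  set A := (hermite R n.+1).[x]; set B := (hermite R n).[x].
  have AB : (2 * x * A - 2 * n.+1%:R * B) ^+ 2 <=
      (1 + d^-1) * (2 * x * A) ^+ 2 + (1 + d) * (2 * n.+1%:R * B) ^+ 2.
    set u := 2 * x * A; set v := 2 * n.+1%:R * B.
    rewrite -subr_ge0 (_ : _ - _ = d^-1 * (u + d * v) ^+ 2); last by field; rewrite gt_eqF.
    by rewrite mulr_ge0 ?invr_ge0 ?sqr_ge0// ltW.
  apply: (@le_trans _ _ (((1 + d^-1) * (2 * x * A) ^+ 2 + (1 + d) * (2 * n.+1%:R * B) ^+ 2) * w)).
    by rewrite ler_wpM2r// ltW.
  rewrite mulrDl; apply: lerD.
    have -> : (1 + d^-1) * (2 * x * A) ^+ 2 * w = (K * d) * (2 * A ^+ 2 * w).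
      by rewrite /K; field; rewrite gt_eqF.
    have -> : d * (A ^+ 2 * (2 * n.+2%:R * w)) = (n.+2%:R * d) * (2 * A ^+ 2 * w) by ring.
    have Aw : 0 <= 2 * A ^+ 2 * w by rewrite (mulr_ge0 (mulr_ge0 _ (sqr_ge0 A)) (ltW w0)).
    by rewrite (ler_wpM2r Aw)// ler_wpM2r// ltW.
  have -> : (1 + d) * (2 * n.+1%:R * B) ^+ 2 * w = ((1 + d) * B ^+ 2 * w * 4 * n.+1%:R) * n.+1%:R.
    by ring.
  have -> : (1 + d) * (B ^+ 2 * (2 * n.+1%:R * (2 * n.+2%:R * w))) =
      ((1 + d) * B ^+ 2 * w * 4 * n.+1%:R) * n.+2%:R by ring.
  have d1 : 0 <= 1 + d by rewrite addr_ge0// ltW.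
  have Bw : 0 <= (1 + d) * B ^+ 2 * w * 4 by rewrite (mulr_ge0 (mulr_ge0 (mulr_ge0 d1 (sqr_ge0 B)) (ltW w0))).
  by rewrite ler_wpM2l ?ler_nat// mulr_ge0.
pose C := \sum_(i < N.+2) e i.
have C0 : 0 <= C by apply: sumr_ge0.
have rX n : 1 <= rho ^+ n by rewrite exprn_ege1// ltW.
have small n : (n < N.+2)%N -> e n <= C * rho ^+ n.
  move=> nN; apply: (@le_trans _ _ C); last by rewrite ler_peMr.
  by rewrite /C (bigD1 (Ordinal nN))//= lerDl sumr_ge0.
exists C => n; rewrite ger0_norm; last exact: e0.
suff : e n <= C * rho ^+ n /\ e n.+1 <= C * rho ^+ n.+1 by case.
elim: n => [|n [IH1 IH2]]; first by split; exact: small.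
split=> //; have [Nn|nN] := leqP N n; last by apply: small.
apply: le_trans (step n Nn) _.
apply: (@le_trans _ _ (d * (C * rho ^+ n.+1) + (1 + d) * (C * rho ^+ n))).
  have d1 : 0 <= 1 + d by rewrite addr_ge0// ltW.
  exact: lerD (ler_wpM2l (ltW d0) IH2) (ler_wpM2l d1 IH1).
rewrite le_eqVlt; apply/orP; left; apply/eqP.
by rewrite !exprS /d; ring.
Qed.

(** The booleans encode an index shift by 0 or 1. A shift costs a factor 2(n + 1), by the recursion
    of the weights, and a product is at most the sum of the squares. *)
Lemma subexponential_hermite_prod (x y : R) (i j : bool) :
  subexponential (fun n => (hermite R (i + n)).[x] * (hermite R (j + n)).[y] * hermite_weight R n).
Proof.
have sq (z : R) (k : bool) : subexponential (fun n => (hermite R (k + n)).[z] ^+ 2 * hermite_weight R n).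
  case: k; last exact: subexponential_hermite_sqr.
  have /subexponential_shift/subexponential_natmul/(subexponentialZ 2) := subexponential_hermite_sqr z.
  apply: subexponential_le => n.
  rewrite -(hermite_weightS R n) add1n.
  by rewrite le_eqVlt; apply/orP; left; apply/eqP; congr (`|_|); ring.
apply: subexponential_le (subexponentialD (sq x i) (sq y j)) => n.
have w0 := ltW (hermite_weight_gt0 R n).
set A := (hermite R (i + n)).[x]; set B := (hermite R (j + n)).[y].
rewrite -mulrDl !normrM ler_wpM2r// [leRHS]ger0_norm ?addr_ge0 ?sqr_ge0//.
rewrite -normrM ler_norml; apply/andP; split.
  by have := sqr_ge0 (A + B); have := sqr_ge0 A; have := sqr_ge0 B; rewrite sqrrD; lra.
by have := sqr_ge0 (A - B); have := sqr_ge0 A; have := sqr_ge0 B; rewrite sqrrB; lra.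
Qed.

End hermite_growth.

(** * The generating function of products of Hermite polynomials *)

Section mehler.
Context (R : realType) (x y : R).
Local Notation p n := (hermite R n).[x].
Local Notation q n := (hermite R n).[y].
Local Notation w := (hermite_weight R).

Definition mehler_coef n : R := p n * q n * w n.

(** With the weight kept at n, the three-term recursion closes up into a linear system for the
    generating functions of [A], [B], [D] and [mehler_coef]. *)
Let A n : R := p n.+1 * q n * w n.
Let B n : R := p n * q n.+1 * w n.
Let D n : R := p n.+1 * q n.+1 * w n.

Lemma subexponential_mehler_coef : subexponential mehler_coef.
Proof. exact: (subexponential_hermite_prod x y false false). Qed.

Let sA : subexponential A. Proof. exact: (subexponential_hermite_prod x y true false). Qed.

Let sB : subexponential B. Proof. exact: (subexponential_hermite_prod x y false true). Qed.

Let sD : subexponential D. Proof. exact: (subexponential_hermite_prod x y true true). Qed.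

Let sc := subexponential_mehler_coef.
Let sAS := subexponential_shift sA.
Let scS := subexponential_shift sc.
Let sd : subexponential (fun n => n.+1%:R * mehler_coef n.+1).
Proof. exact: subexponential_natmul. Qed.

Lemma mehler_psumA r : `|r| < 1 -> psum A r = 2 * x * psum mehler_coef r - r * psum B r.
Proof.
move=> r1; rewrite (psum_shift sA)// (psum_shift sc)//.
have -> : (fun n => A n.+1) = (fun n => 2 * x * mehler_coef n.+1 + -1 * B n).
  apply/funext => n; rewrite /A /B /mehler_coef horner_hermiteSS -(hermite_weightS R n).
  by ring.
rewrite psumD ?psumZ//; [|exact: subexponentialZ|exact: subexponentialZ].
by rewrite /A /mehler_coef horner_hermite1 !horner_hermite0; ring.
Qed.

Lemma mehler_psumB r : `|r| < 1 -> psum B r = 2 * y * psum mehler_coef r - r * psum A r.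
Proof.
move=> r1; rewrite (psum_shift sB)// (psum_shift sc)//.
have -> : (fun n => B n.+1) = (fun n => 2 * y * mehler_coef n.+1 + -1 * A n).
  apply/funext => n; rewrite /A /B /mehler_coef horner_hermiteSS -(hermite_weightS R n).
  by ring.
rewrite psumD ?psumZ//; [|exact: subexponentialZ|exact: subexponentialZ].
by rewrite /B /mehler_coef horner_hermite1 !horner_hermite0; ring.
Qed.

Lemma mehler_psum_succ r : `|r| < 1 -> psum (fun n => n.+1%:R * mehler_coef n) r =
  psum mehler_coef r + r * psum (fun n => n.+1%:R * mehler_coef n.+1) r.
Proof.
move=> r1; rewrite psum_shift//; last exact: subexponential_natmul.
rewrite (psum_shift sc)// mul1r -addrA -mulrDr; congr (_ + _ * _).
rewrite -psumD//; congr (psum _ r); apply/funext => n.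
by rewrite -natr1; ring.
Qed.

Lemma mehler_psumD r : `|r| < 1 -> psum D r = 2 * y * psum A r -
  r * (2 * x * psum A r - 2 * (psum mehler_coef r + r * psum (fun n => n.+1%:R * mehler_coef n.+1) r)).
Proof.
move=> r1; rewrite -mehler_psum_succ//.
have sn : subexponential (fun n => n.+1%:R * mehler_coef n) by exact: subexponential_natmul.
have sAx : subexponential (fun n => - (2 * x) * A n) by exact: subexponentialZ.
have sAy : subexponential (fun n => 2 * y * A n.+1) by exact: (subexponentialZ (2 * y) sAS).
have sn2 : subexponential (fun n => 2 * (n.+1%:R * mehler_coef n)) by exact: subexponentialZ.
rewrite (psum_shift sD)//.
have -> : (fun n => D n.+1) = (fun n => 2 * y * A n.+1 + ((- (2 * x)) * A n + 2 * (n.+1%:R * mehler_coef n))).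
  apply/funext => n; rewrite /D /A /mehler_coef (@horner_hermiteSS _ _ y) -(hermite_weightS R n).
  by rewrite (@horner_hermiteSS _ _ x); ring.
rewrite psumD//; last exact: subexponentialD.
rewrite psumD// !psumZ// [X in 2 * y * X - _](psum_shift sA)//.
by rewrite /D /A !horner_hermite1 !horner_hermite0; ring.
Qed.

(** The relations for [A] and [B] determine the sum of [A] in terms of the sum S of [mehler_coef].
    The sum of [D] is 2 S' by the recursion of the weights and is computed again from the Hermite
    recursion in y; equating the two values gives the differential equation. *)
Lemma mehler_psum_deriv r : `|r| < 1 ->
  psum (fun n => n.+1%:R * mehler_coef n.+1) r =
  ((y - x * r) * (2 * x - 2 * y * r) / (1 - r ^+ 2) + r) / (1 - r ^+ 2) * psum mehler_coef r.
Proof.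
move=> r1.
have r21 : 1 - r ^+ 2 != 0.
  by rewrite gt_eqF// subr_gt0 -real_normK ?num_real// expr_lt1.
have DE : psum D r = 2 * psum (fun n => n.+1%:R * mehler_coef n.+1) r.
  rewrite -psumZ//; congr (psum _ r); apply/funext => n.
  by rewrite /D /mehler_coef -(hermite_weightS R n); ring.
have := mehler_psumD r1; rewrite DE.
have := mehler_psumA r1; rewrite mehler_psumB//.
set S := psum mehler_coef r; set S' := psum (fun n => n.+1%:R * mehler_coef n.+1) r.
set a := psum A r => aE.
have {}aE : a = (2 * x - 2 * y * r) / (1 - r ^+ 2) * S.
  apply: (mulfI r21); rewrite mulrA [_ * (_ / _)]mulrC divfK//.
  by rewrite mulrBl mul1r {1}aE; ring.
move=> S'E; apply: (mulfI r21).
rewrite mulrA [_ * (_ / _)]mulrC divfK// [RHS]mulrDl.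
have -> : (y - x * r) * (2 * x - 2 * y * r) / (1 - r ^+ 2) * S = (y - x * r) * a.
  by rewrite aE; ring.
have : 2 * ((1 - r ^+ 2) * S') = 2 * ((y - x * r) * a + r * S).
  have -> : 2 * ((1 - r ^+ 2) * S') = 2 * S' - 2 * r ^+ 2 * S' by ring.
  by rewrite S'E; ring.
by move/mulfI; apply.
Qed.

(** Minus the logarithm of Mehler's function (1 - r^2)^(-1/2) exp((2xyr - (x^2 + y^2) r^2) / (1 -
    r^2)). *)
Definition mehler_exponent (r : R) : R :=
  2^-1 * ln (1 - r ^+ 2) - (2 * x * y * r - (x ^+ 2 + y ^+ 2) * r ^+ 2) / (1 - r ^+ 2).

Lemma mehler_psum0 : psum mehler_coef 0 = 1.
Proof.
rewrite psum_shift ?normr0// mul0r addr0 /mehler_coef !horner_hermite0.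
by rewrite /hermite_weight expr0 fact0 !mul1r invr1.
Qed.

Lemma is_derive_mehler_exponent (s : R) : `|s| < 1 ->
  is_derive s (1 : R) mehler_exponent
    (- (((y - x * s) * (2 * x - 2 * y * s) / (1 - s ^+ 2) + s) / (1 - s ^+ 2))).
Proof.
move=> s1.
have s20 : 0 < 1 - s ^+ 2 by rewrite subr_gt0 -real_normK ?num_real// expr_lt1.
have s2n : 1 - s ^+ 2 != 0 by rewrite gt_eqF.
have d1 : is_derive s (1 : R) (fun s : R => 1 - s ^+ 2) (- (2 * s)).
  have : is_derive s (1 : R) (cst (1 : R) - (@id R) ^+ 2) (0 - (2%:R * s ^+ 1) *: 1).
    exact: is_deriveB.
  by move/is_derive_eq; apply; rewrite /GRing.scale/= mulr1 expr1 sub0r.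
have d2 : is_derive s (1 : R) (fun s : R => ln (1 - s ^+ 2)) ((1 - s ^+ 2)^-1 * (- (2 * s))).
  by apply: (@is_derive1_comp _ (@ln R) (fun s : R => 1 - s ^+ 2)); exact: is_derive1_ln.
have d3 : is_derive s (1 : R) (fun s : R => (1 - s ^+ 2)^-1) (2 * s / (1 - s ^+ 2) ^+ 2).
  have := @is_deriveV _ (fun s : R => 1 - s ^+ 2) s _ _ s2n d1.
  move/is_derive_eq; apply; rewrite /GRing.scale/=.
  by field.
have d4 : is_derive s (1 : R) (fun s : R => 2 * x * y * s - (x ^+ 2 + y ^+ 2) * s ^+ 2)
    (2 * x * y - (x ^+ 2 + y ^+ 2) * (2 * s)).
  have : is_derive s (1 : R) ((2 * x * y) *: (@id R) - (x ^+ 2 + y ^+ 2) *: ((@id R) ^+ 2))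
     ((2 * x * y) *: (1 : R) - (x ^+ 2 + y ^+ 2) *: ((2%:R * s ^+ 1) *: (1 : R))).
    exact: is_deriveB.
  by move/is_derive_eq; apply; rewrite /GRing.scale/= !mulr1 expr1.
have := is_deriveB (is_deriveZ 2^-1 d2) (is_deriveM d4 d3).
move/is_derive_eq; apply; rewrite /GRing.scale/=.
by field.
Qed.

(* As a function of [r], the series solves the linear differential equation of
   [expR (- mehler_exponent r)] (lemma [mehler_psum_deriv]), so that their
   quotient is constant. *)
Lemma mehler_sum r : 0 <= r -> r < 1 -> psum mehler_coef r = expR (- mehler_exponent r).
Proof.
move=> r0 r1.
pose F (s : R) : R := psum mehler_coef s * expR (mehler_exponent s).
have dF (s : R) : `|s| < 1 -> is_derive s (1 : R) F 0.
  move=> s1.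
  have dS := is_derive_psum sc s1; rewrite mehler_psum_deriv// in dS.
  have dE := is_derive_mehler_exponent s1.
  have dX : is_derive s (1 : R) (expR \o mehler_exponent) _ := is_derive1_comp (is_derive_expR _) dE.
  have := is_deriveM dS dX.
  move/is_derive_eq; apply; rewrite /GRing.scale/=.
  by ring.
have F0 : F 0 = 1.
  rewrite /F mehler_psum0 mul1r /mehler_exponent expr0n/= !mulr0 !subr0 mul0r subr0 ln1 mulr0.
  by rewrite expR0.
have : F r = F 0.
  apply/eqP; rewrite -subr_eq0; apply/eqP.
  have sub (s : R) : 0 <= s -> s <= r -> `|s| < 1 by move=> s0 sr; rewrite ger0_norm// (le_lt_trans sr).
  have [||c _ ->] := @MVT_segment R F (fun=> 0) 0 r r0; last by rewrite mul0r.
    by move=> s; rewrite in_itv/= => /andP[s0 sr]; apply: dF; apply: sub; exact: ltW.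
  apply: derivable_within_continuous => s; rewrite in_itv/= => /andP[s0 sr].
  by have [] := dF s (sub _ s0 sr).
rewrite F0 /F => FE.
by rewrite expRN -[RHS]mul1r -FE mulfK// gt_eqF// expR_gt0.
Qed.

End mehler.

(** * The heat kernel on the line: closed form and Gaussian bound *)

Section heat_kernel_line.
Context (R : realType).
Implicit Types (t x y : R) (n : nat).

Definition heat_term t x y n : R :=
  expR (- ((2 * n + 1)%:R * t)) * hermite_fun1 n x * hermite_fun1 n y.

(** The one-dimensional G_t, in the variable r = e^(-2t) in which Mehler's formula delivers it
    rather than with hyperbolic functions. *)
Definition heat_kernel1 t x y : R :=
  expR (- t) / Num.sqrt pi * expR (- (x ^+ 2 + y ^+ 2) / 2) *
  expR (- mehler_exponent x y (expR (- (2 * t)))).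

Lemma heat_kernel1_gt0 t x y : 0 < heat_kernel1 t x y.
Proof. by rewrite !mulr_gt0 ?expR_gt0// invr_gt0 sqrtr_gt0 pi_gt0. Qed.

Lemma hermite_fun1M n x y : hermite_fun1 n x * hermite_fun1 n y =
  (Num.sqrt pi)^-1 * expR (- (x ^+ 2 + y ^+ 2) / 2) * mehler_coef x y n.
Proof.
rewrite /hermite_fun1 /mehler_coef /hermite_weight.
set s := Num.sqrt (Num.sqrt pi * 2 ^+ n * n`!%:R).
have sp : 0 < Num.sqrt (pi : R) by rewrite sqrtr_gt0 pi_gt0.
have f0 : 0 < n`!%:R :> R by rewrite ltr0n fact_gt0.
have s0 : 0 < s by rewrite sqrtr_gt0 !mulr_gt0 ?exprn_gt0.
have sE : (Num.sqrt pi)^-1 * (2 ^+ n * n`!%:R)^-1 = s^-1 * s^-1.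
  by rewrite -!invfM mulrA -expr2 sqr_sqrtr// ltW// !mulr_gt0 ?exprn_gt0.
have -> : expR (- (x ^+ 2 + y ^+ 2) / 2) = expR (- (x ^+ 2 / 2)) * expR (- (y ^+ 2 / 2)).
  by rewrite -expRD; congr expR; field.
transitivity ((s^-1 * s^-1) * ((hermite R n).[x] * (hermite R n).[y] * (expR (- (x ^+ 2 / 2)) * expR (- (y ^+ 2 / 2))))).
  by ring.
by rewrite -sE; ring.
Qed.

Lemma heat_termE t x y n : heat_term t x y n =
  (expR (- t) / Num.sqrt pi * expR (- (x ^+ 2 + y ^+ 2) / 2)) *
  (mehler_coef x y n * expR (- (2 * t)) ^+ n).
Proof.
rewrite /heat_term -mulrA hermite_fun1M -expRM_natl.
have -> : expR (- ((2 * n + 1)%:R * t)) = expR (- t) * expR (n%:R * - (2 * t)).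
  by rewrite -expRD natrD natrM; congr expR; ring.
by ring.
Qed.

Lemma expRN2_itv t : 0 < t -> 0 < expR (- (2 * t)) < 1.
Proof. by move=> t0; rewrite expR_gt0/= expR_lt1 oppr_lt0 mulr_gt0. Qed.

Lemma heat_term_cvg t x y : 0 < t -> cvgn [normed series (heat_term t x y)].
Proof.
move=> t0; have /andP[r0 r1] := expRN2_itv t0.
set r := expR _ in r0 r1.
have cA : cvgn (pseries (fun n => `|mehler_coef x y n|) r).
  apply: subexponential_cvg; last by rewrite ger0_norm// ltW.
  apply: (subexponential_le _ (subexponential_mehler_coef x y)) => n.
  by rewrite normr_id.
rewrite /normed_series_of/=.
pose k := expR (- t) / Num.sqrt pi * expR (- (x ^+ 2 + y ^+ 2) / 2).
have k0 : 0 <= k by rewrite !mulr_ge0 ?expR_ge0// invr_ge0 sqrtr_ge0.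
rewrite (_ : [series _]_n = series (k *: (fun n => `|mehler_coef x y n| * r ^+ n))).
  by apply: is_cvg_seriesZ.
congr series; apply/funext => n /=; rewrite heat_termE -/k -/r normrM ger0_norm//.
by rewrite normrM [`|r ^+ n|]ger0_norm// exprn_ge0// ltW.
Qed.

Lemma heat_term_sum t x y : 0 < t -> limn (series (heat_term t x y)) = heat_kernel1 t x y.
Proof.
move=> t0; have /andP[r0 r1] := expRN2_itv t0.
rewrite /heat_kernel1 -mehler_sum ?ltW//.
rewrite /psum /pseries -[RHS]lim_seriesZ; last first.
  by apply: subexponential_cvg; [exact: subexponential_mehler_coef|rewrite ger0_norm// ltW].
by congr (limn (series _)); apply/funext => n /=; rewrite heat_termE.
Qed.

Lemma heat_kernel1_le t x y : 0 < t ->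
  heat_kernel1 t x y <= t `^ (- 2^-1) * expR (- (t / 2)) * expR (- ((x - y) ^+ 2 / (8 * t))).
Proof.
move=> t0; have /andP[r0 r1] := expRN2_itv t0.
rewrite /heat_kernel1 /mehler_exponent; set r := expR _ in r0 r1 *.
have r2 : 0 < 1 - r ^+ 2 by rewrite subr_gt0 expr_lt1// ltW.
have r1' : 0 < 1 - r by rewrite subr_gt0.
have rp : 0 < 1 + r by rewrite addr_gt0.
have sp : 1 <= Num.sqrt (pi : R).
  by rewrite -[leLHS]sqrtr1 ler_sqrt ?pi_gt0// (le_trans _ (pi_ge2 _))// ler1n.
have tr : 1 - r <= 2 * t.
  by have := expR_ge1Dx (- (2 * t)); rewrite -/r; lra.
(* The left-hand side is -(tanh(t) (x + y)^2 + coth(t) (x - y)^2) / 4. The first square is dropped,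
   and coth(t) = (1 + r) / (1 - r) is at least 1 / (2t). *)
have quad : - (x ^+ 2 + y ^+ 2) / 2 + (2 * x * y * r - (x ^+ 2 + y ^+ 2) * r ^+ 2) / (1 - r ^+ 2)
    <= - ((x - y) ^+ 2 / (8 * t)).
  have -> : - (x ^+ 2 + y ^+ 2) / 2 + (2 * x * y * r - (x ^+ 2 + y ^+ 2) * r ^+ 2) / (1 - r ^+ 2) =
     - ((1 - r) / (1 + r) * (x + y) ^+ 2 / 4) - (1 + r) / (1 - r) * (x - y) ^+ 2 / 4.
    by field; rewrite !gt_eqF.
  apply: (@le_trans _ _ (- ((1 + r) / (1 - r) * (x - y) ^+ 2 / 4))).
    by rewrite gerDr oppr_le0 (mulr_ge0 (mulr_ge0 (divr_ge0 (ltW r1') (ltW rp)) (sqr_ge0 _))).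
  rewrite lerN2.
  have -> : (x - y) ^+ 2 / (8 * t) = (2 * t)^-1 * (x - y) ^+ 2 / 4 by field; rewrite gt_eqF.
  rewrite ler_pM2r// ler_wpM2r ?sqr_ge0//.
  rewrite ler_pdivlMr// mulrC ler_pdivrMr ?mulr_gt0//.
  have := mulr_gt0 r0 t0; lra.
(* From 1 - e^(-4t) >= t e^(-t), that is, (1 - r^2)^(-1/2) <= t^(-1/2) e^(t/2). Half of the decay
   e^(-t) is spent here, which leaves e^(-t/2). *)
have lnb : - (2^-1 * ln (1 - r ^+ 2)) <= t / 2 - 2^-1 * ln t.
  have h : ln t - t <= ln (1 - r ^+ 2).
    rewrite -[X in _ - X](expRK t) -ln_div ?posrE ?expR_gt0// ler_ln ?posrE ?divr_gt0 ?expR_gt0//.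
    have rE : r ^+ 2 = (expR (4 * t))^-1 by rewrite /r -expRM_natl -expRN; congr expR; ring.
    have e4 : 1 + 4 * t <= expR (4 * t) by exact: expR_ge1Dx.
    have e1 : 1 + t <= expR t by exact: expR_ge1Dx.
    have t4 : 0 < 1 + 4 * t by lra.
    apply: (@le_trans _ _ (1 - (1 + 4 * t)^-1)); last first.
      by rewrite rE lerD2l lerN2 lef_pV2 ?posrE ?expR_gt0.
    have -> : 1 - (1 + 4 * t)^-1 = 4 * t / (1 + 4 * t) by field; rewrite gt_eqF.
    rewrite ler_pdivlMr// mulrAC ler_pdivrMr ?expR_gt0// [leRHS]mulrAC [leRHS]mulrC mulrA.
    by rewrite -mulrA ler_pM2l//; lra.
  lra.
apply: (@le_trans _ _ (expR (- t) * expR (- (x ^+ 2 + y ^+ 2) / 2) *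
  expR (- (2^-1 * ln (1 - r ^+ 2) - (2 * x * y * r - (x ^+ 2 + y ^+ 2) * r ^+ 2) / (1 - r ^+ 2))))).
  rewrite ler_wpM2r ?expR_ge0// ler_wpM2r ?expR_ge0//.
  by rewrite ler_pdivrMr ?(lt_le_trans ltr01)// ler_peMr ?expR_ge0.
rewrite powR_expR_ln// -!expRD ler_expR; lra.
Qed.

End heat_kernel_line.

(** * Absolutely summable families over multi-indices *)

Section multisum_product.
Context (R : realType).
Implicit Types (c : R) (a b w : nat -> R).
Local Open Scope ereal_scope.

Definition pos_part (x : R) : R := Num.max x 0%R.
Definition neg_part (x : R) : R := Num.max (- x)%R 0%R.

Lemma pos_part_ge0 x : (0 <= pos_part x)%R. Proof. by rewrite /pos_part le_max lexx orbT. Qed.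

Lemma neg_part_ge0 x : (0 <= neg_part x)%R. Proof. by rewrite /neg_part le_max lexx orbT. Qed.

Lemma pos_partE x : (pos_part x = (`|x| + x) / 2)%R.
Proof.
rewrite /pos_part; have [x0|x0] := boolP (0 <= x)%R.
  by rewrite max_l// ger0_norm//; field.
rewrite -real_ltNge ?num_real// in x0.
by rewrite max_r ?ltW// ltr0_norm// addNr mul0r.
Qed.

Lemma neg_partE x : (neg_part x = (`|x| - x) / 2)%R.
Proof. by rewrite -[LHS]/(pos_part (- x)) pos_partE normrN. Qed.

Lemma pos_partM x y : (pos_part (x * y) = pos_part x * pos_part y + neg_part x * neg_part y)%R.
Proof. by rewrite !pos_partE !neg_partE normrM; field. Qed.

Lemma neg_partM x y : (neg_part (x * y) = pos_part x * neg_part y + neg_part x * pos_part y)%R.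
Proof. by rewrite !pos_partE !neg_partE normrM; field. Qed.

Lemma pos_neg_part x : (pos_part x - neg_part x = x)%R.
Proof. by rewrite pos_partE neg_partE; field. Qed.

Lemma pos_part_le_norm x : (pos_part x <= `|x|)%R.
Proof. by rewrite /pos_part ge_max ler_norm normr_ge0. Qed.

Lemma neg_part_le_norm x : (neg_part x <= `|x|)%R.
Proof. by rewrite /neg_part ge_max -normrN ler_norm normr_ge0. Qed.

(** One inequality holds for every nonnegative factor; for c > 0 the other one is the same
    inequality with the factor 1/c. *)
Lemma ge0_esumZl (T : choiceType) c (f : T -> \bar R) : (0 <= c)%R ->
  (forall i, 0 <= f i) ->
  \esum_(i in setT) (c%:E * f i) = c%:E * \esum_(i in setT) f i.
Proof.
move=> c0 f0.
have le (k : R) (g : T -> \bar R) : (0 <= k)%R -> (forall i, 0 <= g i) ->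
    \esum_(i in setT) (k%:E * g i) <= k%:E * \esum_(i in setT) g i.
  move=> k0 g0; apply: ge_ereal_sup => _ [A [finA AT] <-].
  rewrite -ge0_mule_fsumr//; apply: lee_wpmul2l; first by rewrite lee_fin.
  by apply: ereal_sup_ubound; exists A.
apply/eqP; rewrite eq_le le//=.
have [->|cn] := eqVneq c 0%R.
  by rewrite mul0e; apply: esum_ge0 => i _; rewrite mul0e.
have {cn}c0 : (0 < c)%R by rewrite lt_def cn.
rewrite -lee_pdivlMl//.
have -> : \esum_(i in setT) f i = \esum_(i in setT) (c^-1%:E * (c%:E * f i)).
  by apply: eq_esum => i _; rewrite muleA -EFinM mulVf ?gt_eqF// mul1e.
apply: le; first by rewrite invr_ge0 ltW.
by move=> i; rewrite mule_ge0// lee_fin ltW.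
Qed.

Lemma esum_nat w : (forall n, 0 <= w n)%R -> cvgn (series w) ->
  \esum_(n in setT) (w n)%:E = (limn (series w))%:E.
Proof.
move=> w0 cw; rewrite -nneseries_esumT//.
rewrite -EFin_lim//; congr (limn _); apply/funext => n.
by rewrite /series/= sumEFin.
Qed.

Lemma abs_cvg_parts w : cvgn [normed series w] ->
  [/\ cvgn (series w), cvgn (series (pos_part \o w)), cvgn (series (neg_part \o w)) &
    limn (series w) = (limn (series (pos_part \o w)) - limn (series (neg_part \o w)))%R].
Proof.
move=> cw; have cs := normed_cvg cw.
have cp : cvgn (series (pos_part \o w)).
  apply: (series_le_cvg _ _ _ cw) => n //=; first exact: pos_part_ge0.
  exact: pos_part_le_norm.
have cn : cvgn (series (neg_part \o w)).
  apply: (series_le_cvg _ _ _ cw) => n //=; first exact: neg_part_ge0.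
  exact: neg_part_le_norm.
split => //; rewrite -lim_seriesB//.
by congr (limn (series _)); apply/funext => n; rewrite /= -[LHS]pos_neg_part.
Qed.

(** The relational form of [multisum]: it records that the sums of both parts are finite, which
    [fine] would hide, and makes sense over any index type. *)
Definition is_multisum (T : choiceType) (u : T -> R) (s : R) :=
  exists P N : R, [/\ \esum_(k in setT) (pos_part (u k))%:E = P%:E,
    \esum_(k in setT) (neg_part (u k))%:E = N%:E & s = (P - N)%R].

Lemma is_multisum_nat w : cvgn [normed series w] -> is_multisum w (limn (series w)).
Proof.
move=> /abs_cvg_parts[_ cp cn E].
exists (limn (series (pos_part \o w))), (limn (series (neg_part \o w))); split => //.
  by rewrite -esum_nat// => n; exact: pos_part_ge0.
by rewrite -esum_nat// => n; exact: neg_part_ge0.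
Qed.

Lemma esum_pair_mul (S T : choiceType) (f : S -> R) (g : T -> R) (F G : R) :
  (forall i, 0 <= f i)%R -> (forall j, 0 <= g j)%R ->
  \esum_(i in setT) (f i)%:E = F%:E -> \esum_(j in setT) (g j)%:E = G%:E ->
  \esum_(z in [set: S * T]) (f z.1 * g z.2)%:E = (F * G)%:E.
Proof.
move=> f0 g0 fF gG.
have G0 : (0 <= G)%R by rewrite -lee_fin -gG; apply: esum_ge0 => i _; rewrite lee_fin.
have := @esum_esum R S T setT (fun=> setT) (fun i j => (f i * g j)%:E).
rewrite (_ : [set: S] `*`` _ = setT); last by apply/seteqP; split.
move=> <-; last by move=> i j; rewrite lee_fin mulr_ge0.
have -> : \esum_(i in setT) \esum_(j in setT) (f i * g j)%:E = \esum_(i in setT) (G%:E * (f i)%:E).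
  apply: eq_esum => i _; rewrite -gG muleC.
  by rewrite -ge0_esumZl.
rewrite ge0_esumZl//.
by rewrite fF -EFinM mulrC.
Qed.

Lemma is_multisum_pair (S T : choiceType) (u : S -> R) (v : T -> R) s t :
  is_multisum u s -> is_multisum v t ->
  is_multisum (fun z : S * T => u z.1 * v z.2)%R (s * t)%R.
Proof.
move=> [P [N [uP uN ->]]] [P' [N' [vP vN ->]]].
exists (P * P' + N * N')%R, (P * N' + N * P')%R; split; last by ring.
- under eq_esum do rewrite pos_partM EFinD.
  rewrite esumD ?EFinD; [|by move=> i _; rewrite lee_fin mulr_ge0 ?pos_part_ge0 ?neg_part_ge0..].
  by congr (_ + _); [apply: (esum_pair_mul _ _ uP vP)|apply: (esum_pair_mul _ _ uN vN)] => i;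
    rewrite ?pos_part_ge0 ?neg_part_ge0.
- under eq_esum do rewrite neg_partM EFinD.
  rewrite esumD ?EFinD; [|by move=> i _; rewrite lee_fin mulr_ge0 ?pos_part_ge0 ?neg_part_ge0..].
  by congr (_ + _); [apply: (esum_pair_mul _ _ uP vN)|apply: (esum_pair_mul _ _ uN vP)] => i;
    rewrite ?pos_part_ge0 ?neg_part_ge0.
Qed.

Lemma is_multisum_tuple d (w : 'I_d -> nat -> R) :
  (forall i, cvgn [normed series (w i)]) ->
  is_multisum (fun k : d.-tuple nat => \prod_(i < d) w i (tnth k i))%R
    (\prod_(i < d) limn (series (w i)))%R.
Proof.
elim: d w => [|d IH] w cw.
  have T0 : [set: 0.-tuple nat] = [set [tuple]].
    apply/seteqP; split => // k _; apply: val_inj.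
    by apply: size0nil; rewrite size_tuple.
  exists 1%R, 0%R; rewrite big_ord0 subr0 T0; split => //.
  - by rewrite esum_set1 ?lee_fin ?pos_part_ge0// big_ord0 /pos_part max_l.
  - by rewrite esum_set1 ?lee_fin ?neg_part_ge0// big_ord0 /neg_part max_r ?oppr_le0.
pose phi (z : nat * d.-tuple nat) : d.+1.-tuple nat := [tuple of z.1 :: z.2].
have bphi : set_bij [set: nat * d.-tuple nat] setT phi.
  split => //.
  - move=> [a k] [a' k'] _ _ /(congr1 val)/= [-> kk'].
    by congr pair; exact: val_inj.
  - move=> k _ /=; exists (thead k, [tuple of behead k]) => //.
    by rewrite /phi/= -tuple_eta.
have [P [N [zP zN sE]]] := is_multisum_pair (is_multisum_nat (cw ord0)) (IH (fun i => w (lift ord0 i)) (fun i => cw _)).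
have phiE z : (\prod_(i < d.+1) w i (tnth (phi z) i) =
   w ord0 z.1 * \prod_(i < d) w (lift ord0 i) (tnth z.2 i))%R.
  by rewrite big_ord_recl; congr (_ * _)%R; apply: eq_bigr => i _; rewrite tnthS.
exists P, N; split; last by rewrite big_ord_recl.
- rewrite (reindex_esum setT setT phi)//.
  by rewrite -zP; apply: eq_esum => z _; rewrite phiE.
- rewrite (reindex_esum setT setT phi)//.
  by rewrite -zN; apply: eq_esum => z _; rewrite phiE.
Qed.

Lemma multisumE d (u : d.-tuple nat -> R) s : is_multisum u s -> multisum u = s.
Proof. by move=> [P [N [uP uN ->]]]; rewrite /multisum uP uN. Qed.

(** The eigenvalue 2|k| + d is the sum of the 2 k_i + 1, so every term of the series over N^d
    factors into one-dimensional terms. *)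
Lemma heat_kernelE d (t : R) (x y : rspace R d) : (0 < t)%R ->
  heat_kernel t x y = (\prod_(i < d) heat_kernel1 t (tnth x i) (tnth y i))%R.
Proof.
move=> t0.
have := is_multisum_tuple (fun i : 'I_d => @heat_term_cvg R t (tnth x i) (tnth y i) t0).
under [X in is_multisum _ X]eq_bigr do rewrite heat_term_sum//.
move=> /multisumE <-; congr multisum; apply/funext => k.
rewrite /hermite_fun /heat_term !big_split/=; congr (_ * _ * _)%R.
rewrite /eigenval /mlength -expR_sum; congr expR.
rewrite sumrN -mulr_suml; congr (- (_ * _))%R.
by rewrite -natr_sum; congr (_%:R)%R; rewrite big_split/= sum1_card card_ord big_distrr.
Qed.

End multisum_product.

(** * Orthonormality of the Hermite functions and eigenfunctions of the heat kernel *)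

Section integrable_decay.
Context (R : realType).
Local Notation L := (@lebesgue_measure R).

Lemma integrable_decay (f : R -> R) (e C : R) : 0 < e -> measurable_fun setT f ->
  (forall s, `|s| <= 1 -> `|f s| <= C * `|s| `^ (e - 1)) ->
  (forall s, 1 <= `|s| -> `|f s| <= C / s ^+ 2) ->
  L.-integrable setT (EFin \o f).
Proof.
move=> e0 mf near far.
have mE : measurable_fun setT (EFin \o f) by exact/measurable_EFinP.
have C0 : 0 <= C.
  have := near 1; rewrite normr1 powR1 mulr1 => /(_ (lexx _)).
  by apply: le_trans.
apply/integrableP; split => //.
have mn : measurable_fun [set: measurableTypeR R] (fun s => near_pow e 1 `|(s : R) - 0|).
  apply: measurable_near_pow => //; apply: measurableT_comp; first exact: normr_measurable.
  exact: measurable_funB.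
have mr : measurable_fun [set: measurableTypeR R] (fun s => far_pow 1 1 `|(s : R) - 0|).
  apply: measurable_far_pow => //; apply: measurableT_comp; first exact: normr_measurable.
  exact: measurable_funB.
apply: (@le_lt_trans _ _ (\int[L]_s ((C * near_pow e 1 `|s - 0|)%:E + (C * far_pow 1 1 `|s - 0|)%:E))%E).
  apply: ge0_le_integral => //.
  - exact: measurableT_comp.
  - by apply: emeasurable_funD; apply/measurable_EFinP; apply: measurable_funM.
  - move=> s _; rewrite /= -EFinD lee_fin subr0 /near_pow /far_pow.
    have [s1|s1] := leP `|s| 1.
      apply: le_trans (near s s1) _; rewrite lerDl mulr_ge0//.
      by case: ifP => // _; exact: powR_ge0.
    rewrite (ltW s1) mulr0 add0r.
    apply: le_trans (far s (ltW s1)) _; rewrite ler_wpM2l//.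
    rewrite -opprD -[1 + 1]/(2%:R) powRN powR_mulrn// real_normK ?num_real//.
rewrite ge0_integralD//=; last 4 first.
- by move=> s _; rewrite lee_fin mulr_ge0// near_pow_ge0.
- by apply/measurable_EFinP; apply: measurable_funM.
- by move=> s _; rewrite lee_fin mulr_ge0// far_pow_ge0.
- by apply/measurable_EFinP; apply: measurable_funM.
have one r : 1 `^ r = 1 :> R by rewrite powR1.
under eq_integral do rewrite EFinM.
under [X in (_ + X)%E]eq_integral do rewrite EFinM.
have C0E : (0 <= C%:E)%E by rewrite lee_fin.
rewrite !ge0_integralZl//; last 4 first.
- exact/measurable_EFinP.
- by move=> s _; rewrite lee_fin far_pow_ge0.
- exact/measurable_EFinP.
- by move=> s _; rewrite lee_fin near_pow_ge0.
have h1 := integral_near_pow 0 e0 (ler01 : 0 <= 1 :> R).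
have h2 := integral_far_pow 0 (ltr01 : 0 < 1 :> R) (ler01 : 0 <= 1 :> R).
rewrite !one in h1 h2.
have {}h1 : (\int[L]_s (near_pow e 1 `|s - 0|)%:E <= (2 / e)%:E)%E.
  by move: h1; under eq_integral do rewrite mul1r.
have {}h2 : (\int[L]_s (far_pow 1 1 `|s - 0|)%:E <= (2 / 1)%:E)%E.
  by move: h2; under eq_integral do rewrite mul1r.
apply: (@le_lt_trans _ _ (C%:E * (2 / e)%:E + C%:E * (2 / 1)%:E)%E).
  by apply: leeD; rewrite lee_wpmul2l.
by rewrite -!EFinM -EFinD ltry.
Qed.

(** Induction on p = p_1 X + a: one half of the Gaussian absorbs the factor X and the other half is
    left for p_1. Hence the induction must cover all rates [c]. *)
Lemma poly_gauss_bound (p : {poly R}) (c : R) : 0 < c ->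
  exists2 C, 0 <= C & forall s, `|p.[s]| * expR (- (c * s ^+ 2)) <= C.
Proof.
elim/poly_ind: p c => [|p a IH] c c0.
  by exists 0 => // s; rewrite horner0 normr0 mul0r.
have c2 : 0 < c / 2 by rewrite divr_gt0.
have [C C0 pC] := IH _ c2.
have e1 (s : R) : expR (- (c * s ^+ 2)) <= 1.
  by rewrite expR_le1 oppr_le0 mulr_ge0 ?sqr_ge0// ltW.
have sb (s : R) : `|s| * expR (- (c / 2 * s ^+ 2)) <= 1 + (c / 2)^-1.
  rewrite expRN -ler_pdivlMr ?invr_gt0 ?expR_gt0// invrK.
  have h : 1 + c / 2 * s ^+ 2 <= expR (c / 2 * s ^+ 2) by exact: expR_ge1Dx.
  apply: (@le_trans _ _ ((1 + (c / 2)^-1) * (1 + c / 2 * s ^+ 2))); last first.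
    by rewrite ler_wpM2l// addr_ge0 ?invr_ge0// ltW.
  have -> : (1 + (c / 2)^-1) * (1 + c / 2 * s ^+ 2) = 1 + s ^+ 2 + (c / 2)^-1 + c / 2 * s ^+ 2.
    by field; rewrite gt_eqF.
  have a1 := mulr_ge0 (ltW c2) (sqr_ge0 s).
  have a2 : 0 <= (c / 2)^-1 by rewrite invr_ge0 ltW.
  have a3 := sqr_ge0 (`|s| - 1); rewrite sqrrB real_normK ?num_real// in a3.
  have a4 := sqr_ge0 s; lra.
exists (C * (1 + (c / 2)^-1) + `|a|).
  by rewrite addr_ge0 ?mulr_ge0 ?addr_ge0 ?invr_ge0// ltW.
move=> s; rewrite hornerMXaddC.
apply: le_trans (ler_wpM2r (expR_ge0 _) (ler_normD _ _)) _.
rewrite mulrDl; apply: lerD; last by rewrite ler_piMr.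
rewrite normrM (_ : expR _ = expR (- (c / 2 * s ^+ 2)) * expR (- (c / 2 * s ^+ 2))); last first.
  by rewrite -expRD; congr expR; field.
by rewrite mulrACA ler_pM// mulr_ge0 ?expR_ge0.
Qed.

Lemma measurable_horner (p : {poly R}) : measurable_fun setT (fun s : R => p.[s]).
Proof. by apply: continuous_measurable_fun; exact: continuous_horner. Qed.

Lemma measurable_gauss (c : R) : measurable_fun setT (fun s : R => expR (- (c * s ^+ 2))).
Proof.
apply: measurableT_comp; first exact: measurable_expR.
by apply: measurable_funN; apply: measurable_funM.
Qed.

Lemma integrable_poly_gauss (p : {poly R}) (c : R) : 0 < c ->
  L.-integrable setT (fun s => (p.[s] * expR (- (c * s ^+ 2)))%:E).
Proof.
move=> c0.
have [C C0 pC] := poly_gauss_bound p c0.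
(* The bound for X^2 p supplies the decay 1/s^2 at infinity. *)
have [D D0 pD] := poly_gauss_bound ('X^2 * p) c0.
apply: (@integrable_decay _ 1 (C + D)) => //.
- by apply: measurable_funM; [exact: measurable_horner|exact: measurable_gauss].
- move=> s _; rewrite subrr powRr0 mulr1 normrM [`|expR _|]ger0_norm ?expR_ge0//.
  by apply: le_trans (pC s) _; rewrite lerDl.
- move=> s s1; have s0 : s != 0 by rewrite -normr_gt0 (lt_le_trans ltr01).
  rewrite ler_pdivlMr ?exprn_even_gt0//.
  rewrite normrM [`|expR _|]ger0_norm ?expR_ge0// mulrAC.
  have := pD s; rewrite hornerM hornerXn normrM [`|s ^+ 2|]ger0_norm ?sqr_ge0// [s ^+ 2 * _]mulrC.
  by move=> h; apply: le_trans h _; rewrite lerDr.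
Qed.

End integrable_decay.

Section hermite_orthogonality.
Context (R : realType).
Local Notation L := (@lebesgue_measure R).
Implicit Types (p q : {poly R}).

Lemma gauss1E (s : R) : expR (- (1 * s ^+ 2)) = gauss_fun s.
Proof. by rewrite mul1r. Qed.

Lemma integrable_gauss_poly p : L.-integrable setT (fun s => (p.[s] * gauss_fun s)%:E).
Proof.
by apply: eq_integrable (integrable_poly_gauss p ltr01) => // s _; rewrite gauss1E.
Qed.

Definition gauss_moment p : R := \int[L]_s (p.[s] * gauss_fun s).

Lemma gauss_momentD p q : gauss_moment (p + q) = gauss_moment p + gauss_moment q.
Proof.
rewrite /gauss_moment -RintegralD//; [|exact: integrable_gauss_poly|exact: integrable_gauss_poly].
by apply: eq_Rintegral => s _; rewrite hornerD mulrDl.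
Qed.

Lemma gauss_momentZ c p : gauss_moment (c *: p) = c * gauss_moment p.
Proof.
rewrite /gauss_moment -RintegralZl//; last exact: integrable_gauss_poly.
by apply: eq_Rintegral => s _; rewrite hornerZ mulrA.
Qed.

Lemma is_derive_poly_gauss p (s : R) :
  is_derive s (1 : R) (fun s => p.[s] * gauss_fun s) ((p^`() - 2%:P * 'X * p).[s] * gauss_fun s).
Proof.
have d2 : is_derive s (1 : R) (fun s : R => - s ^+ 2) (- (2 * s)).
  have : is_derive s (1 : R) (- ((@id R) ^+ 2)) (- ((2%:R * s ^+ 1) *: (1 : R))) by exact: is_deriveN.
  by move/is_derive_eq; apply; rewrite /GRing.scale/= mulr1 expr1.
have dX : is_derive s (1 : R) (expR \o (fun s : R => - s ^+ 2)) _ := is_derive1_comp (is_derive_expR _) d2.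
have := is_deriveM (is_derive_poly p s) dX.
have E : (p^`() - 2%:P * 'X * p).[s] = p^`().[s] - 2 * s * p.[s] by rewrite !hornerE.
move/is_derive_eq; apply; rewrite /GRing.scale/= E /gauss_fun.
by ring.
Qed.

(** The integrand is the derivative of p(s) e^(-s^2). Its integral over [-n-1, n+1] is a difference
    of boundary terms, which tend to 0. *)
Lemma gauss_moment_ibp p : gauss_moment (p^`() - 2%:P * 'X * p) = 0.
Proof.
pose q := p^`() - 2%:P * 'X * p.
pose f (s : R) := q.[s] * gauss_fun s.
pose F (s : R) := p.[s] * gauss_fun s.
have fi : L.-integrable setT (EFin \o f) by exact: integrable_gauss_poly.
have mf : measurable_fun setT (EFin \o f) by exact: measurable_int fi.
pose E (n : nat) : set R := `[- n.+1%:R, n.+1%:R]%classic.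
have FE n : (\int[L]_(s in E n) (f s)%:E = (F n.+1%:R - F (- n.+1%:R))%:E)%E.
  have ln : - n.+1%:R < n.+1%:R :> R by rewrite gtrN// ltr0n.
  have dF s : derivable F s 1 by have [] := is_derive_poly_gauss p s.
  rewrite (@continuous_FTC2 R f F _ _ ln)//.
  - apply: continuous_subspaceT => s; apply: differentiable_continuous.
    by apply/derivable1_diffP; have [] := is_derive_poly_gauss q s.
  - split => //.
    + by apply: cvg_at_right_filter; apply: differentiable_continuous; apply/derivable1_diffP.
    + by apply: cvg_at_left_filter; apply: differentiable_continuous; apply/derivable1_diffP.
  - by move=> s _; rewrite derive1E; have := is_derive_poly_gauss p s => [[_ ->]].
have c1 : (\int[L]_(s in E n) (f s)%:E)%E @[n --> \oo] --> (\int[L]_s (f s)%:E)%E.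
  have -> : (fun n => \int[L]_(s in E n) (f s)%:E)%E = (fun n => \int[L]_s ((EFin \o f) \_ (E n)) s)%E.
    by apply/funext => n; rewrite integral_mkcond.
  have [] := @dominated_convergence _ _ _ L setT measurableT (fun n => (EFin \o f) \_ (E n))
    (EFin \o f) (abse \o (EFin \o f)).
  - move=> n; apply/(measurable_restrictT (EFin \o f)) => //; first exact: measurable_itv.
    exact: measurable_funS mf.
  - exact: mf.
  - apply: aeW => s _; apply: cvg_near_cst.
    near=> n; rewrite /patch ifT// inE /E/= in_itv/= -ler_norml.
    apply: ltW; apply: (lt_le_trans (truncnS_gt `|s|)).
    rewrite ler_nat ltnS; near: n; exact: nbhs_infty_ge.
  - exact: integrable_abse.
  - by apply: aeW => s n _; rewrite /patch; case: ifP => // _; rewrite abse0 abse_ge0.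
  - by move=> _ _ h; exact: h.
(* Boundedness of X p times the Gaussian makes the boundary terms O(1/n). *)
have [C C0 pC] := poly_gauss_bound ('X * p) ltr01.
have Fb (s : R) : `|F s| * `|s| <= C.
  have := pC s; rewrite hornerM hornerX gauss1E normrM /F normrM [`|gauss_fun s|]ger0_norm ?expR_ge0//.
  by move=> h; rewrite mulrC mulrA.
have c2 : (F n.+1%:R - F (- n.+1%:R)) @[n --> \oo] --> (0 : R).
  have b n : `|F n.+1%:R - F (- n.+1%:R)| <= 2 * C * n.+1%:R^-1.
    have n0 : 0 < n.+1%:R :> R by rewrite ltr0n.
    apply: le_trans (ler_normB _ _) _.
    have := Fb n.+1%:R; have := Fb (- n.+1%:R); rewrite normrN (gtr0_norm n0).
    by rewrite -!ler_pdivlMr// => h1 h2; rewrite -mulrA mulrDl !mul1r; exact: lerD.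
  have cb : (2 * C * n.+1%:R^-1) @[n --> \oo] --> (0 : R).
    rewrite -[X in _ --> X](mulr0 (2 * C)); apply: cvgM; first exact: cvg_cst.
    exact: cvg_harmonic.
  apply/norm_cvg0P; apply: (squeeze_cvgr _ (cvg_cst 0) cb).
  by apply: nearW => n; rewrite normr_ge0 b.
have c3 : (\int[L]_(s in E n) (f s)%:E)%E @[n --> \oo] --> 0%E.
  under eq_fun do rewrite FE.
  by apply: cvg_EFin c2; exact: nearW.
have := cvg_unique (@ereal_hausdorff R) c1 c3.
by rewrite /gauss_moment /Rintegral => ->.
Unshelve. all: end_near. Qed.

(** By Rodrigues, H_(n+1) e^(-s^2) is minus the derivative of H_n e^(-s^2); one integration by parts
    moves it to p. Iterating gives orthogonality. *)
Lemma gauss_moment_hermiteS n p :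
  gauss_moment (hermite R n.+1 * p) = gauss_moment (hermite R n * p^`()).
Proof.
have := gauss_moment_ibp (hermite R n * p); rewrite derivM.
have -> : (hermite R n)^`() * p + hermite R n * p^`() - 2%:P * 'X * (hermite R n * p) =
  hermite R n * p^`() + (-1) *: (hermite R n.+1 * p).
  have hS : hermite R n.+1 = 2%:P * 'X * hermite R n - (hermite R n)^`() by [].
  rewrite scaleN1r hS.
  by move: (2%:P * 'X) (hermite R n) (deriv (hermite R n)) => a h h'; ring.
by rewrite gauss_momentD gauss_momentZ mulN1r => /eqP; rewrite subr_eq0 => /eqP.
Qed.

Lemma gauss_moment1 : gauss_moment 1 = Num.sqrt pi.
Proof.
rewrite /gauss_moment /Rintegral; under eq_integral do rewrite hornerC mul1r.
by rewrite integralT_gauss.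
Qed.

Lemma gauss_moment_hermite m n : gauss_moment (hermite R m * hermite R n) =
  if m == n then Num.sqrt pi * (2 ^+ n * n`!%:R) else 0.
Proof.
elim: m n => [|m IH] [|n].
- by rewrite eqxx mulr1 gauss_moment1 expr0 fact0 !mulr1.
- rewrite [hermite R 0 * _]mulrC gauss_moment_hermiteS.
  rewrite (_ : hermite R 0 = 1%:P)// derivC mulr0 -(scale0r 0) gauss_momentZ mul0r//.
- rewrite gauss_moment_hermiteS (_ : hermite R 0 = 1%:P)// derivC mulr0.
  by rewrite -(scale0r 0) gauss_momentZ mul0r.
- rewrite gauss_moment_hermiteS deriv_hermiteS -scalerAr gauss_momentZ IH eqSS.
  case: eqP => _; last by rewrite mulr0.
  by rewrite factS natrM exprS; ring.
Qed.

Lemma hermite_fun1M_gauss m n (s : R) : hermite_fun1 m s * hermite_fun1 n s =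
  (Num.sqrt (Num.sqrt pi * 2 ^+ m * (m`!)%:R))^-1 * (Num.sqrt (Num.sqrt pi * 2 ^+ n * (n`!)%:R))^-1 *
  ((hermite R m * hermite R n).[s] * gauss_fun s).
Proof.
rewrite /hermite_fun1 /gauss_fun hornerM.
have -> : expR (- s ^+ 2) = expR (- (s ^+ 2 / 2)) * expR (- (s ^+ 2 / 2)).
  by rewrite -expRD; congr expR; field.
by ring.
Qed.

Lemma integrable_hermite_fun1M m n :
  L.-integrable setT (fun s => (hermite_fun1 m s * hermite_fun1 n s)%:E).
Proof.
under eq_fun do rewrite hermite_fun1M_gauss EFinM.
by apply: integrableZl => //; exact: integrable_gauss_poly.
Qed.

Lemma hermite_fun1_orthonormal m n :
  (\int[L]_s (hermite_fun1 m s * hermite_fun1 n s)%:E = (m == n)%:R%:E)%E.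
Proof.
have fin := integrable_hermite_fun1M m n.
rewrite -[LHS]fineK; last exact: integrable_fin_num.
congr EFin; rewrite -[LHS]/(\int[L]_s (hermite_fun1 m s * hermite_fun1 n s)).
under eq_Rintegral do rewrite hermite_fun1M_gauss.
rewrite RintegralZl//; last exact: integrable_gauss_poly.
rewrite -[X in _ * X]/(gauss_moment _) gauss_moment_hermite.
case: eqP => [->|_]; last by rewrite mulr0.
have a0 : 0 < Num.sqrt pi * 2 ^+ n * n`!%:R :> R.
  by rewrite !mulr_gt0 ?sqrtr_gt0 ?pi_gt0 ?exprn_gt0// ltr0n fact_gt0.
by rewrite -invfM -expr2 sqr_sqrtr ?ltW// mulrA mulVf// gt_eqF.
Qed.

End hermite_orthogonality.

(** * Integrals over R^d of products of one-variable functions *)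

Section product_integral.
Context (R : realType).
Local Notation L := (@lebesgue_measure R).
Local Open Scope ereal_scope.

Definition prod_fun d (phi : 'I_d -> R -> R) (x : rspace R d) : R :=
  (\prod_(i < d) phi i (tnth x i))%R.

Lemma prod_fun_consp d (phi : 'I_d.+1 -> R -> R) z :
  prod_fun phi (consp z) = (phi ord0 z.1 * prod_fun (fun i => phi (lift ord0 i)) z.2)%R.
Proof.
rewrite /prod_fun big_ord_recl tnth_consp0; congr (_ * _)%R.
by apply: eq_bigr => i _; rewrite tnth_conspS.
Qed.

Lemma measurable_prod_fun d (phi : 'I_d -> R -> R) :
  (forall i, measurable_fun setT (phi i)) -> measurable_fun setT (prod_fun phi).
Proof.
move=> mphi; apply: measurable_prod => i _.
exact: (measurableT_comp (mphi i) (@measurable_tnth _ (measurableTypeR R) d i)).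
Qed.

Lemma ge0_integral_prod d (phi : 'I_d -> R -> R) (c : 'I_d -> R) :
  (forall i, measurable_fun setT (phi i)) -> (forall i s, 0 <= phi i s)%R ->
  (forall i, \int[L]_s (phi i s)%:E = (c i)%:E) ->
  \int[leb d]_x (prod_fun phi x)%:E = (\prod_(i < d) c i)%:E.
Proof.
elim: d phi c => [|d IH] phi c mphi phi0 phic.
  rewrite ge0_integral_leb0; last by apply/measurable_EFinP; exact: measurable_prod_fun.
  by rewrite /prod_fun !big_ord0.
have pf0 e (psi : 'I_e -> R -> R) y : (forall i s, 0 <= psi i s)%R -> (0 <= prod_fun psi y)%R.
  by move=> psi0; apply: prodr_ge0 => i _.
rewrite ge0_integral_leb_cons; last 2 first.
- by apply/measurable_EFinP; exact: measurable_prod_fun.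
- by move=> x; rewrite lee_fin pf0.
have mF : measurable_fun setT (fun z : measurableTypeR R * rspace R d => (prod_fun phi (consp z))%:E).
  apply/measurable_EFinP; apply: measurableT_comp; last exact: measurable_consp.
  exact: measurable_prod_fun.
rewrite fubini_tonelli1; [|exact: mF|by move=> z; rewrite lee_fin pf0].
under eq_integral => s _.
  rewrite /fubini_F; under eq_integral do rewrite prod_fun_consp EFinM/=.
  rewrite ge0_integralZl//; last 3 first.
  - by apply/measurable_EFinP; exact: measurable_prod_fun.
  - by move=> y _; rewrite lee_fin pf0.
  - by rewrite lee_fin.
  rewrite (IH _ (fun i => c (lift ord0 i)))// muleC; over.
rewrite ge0_integralZl//=; last 3 first.
- by apply/measurable_EFinP; exact: mphi.
- by move=> y _; rewrite lee_fin.
- by rewrite lee_fin; apply: prodr_ge0 => i _; rewrite -lee_fin -phic; apply: integral_ge0 => s _; rewrite lee_fin.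
by rewrite phic big_ord_recl -EFinM mulrC.
Qed.

Lemma integral_prod d (phi : 'I_d -> R -> R) (c : 'I_d -> R) :
  (forall i, L.-integrable setT (EFin \o phi i)) ->
  (forall i, \int[L]_s (phi i s)%:E = (c i)%:E) ->
  (leb d).-integrable setT (EFin \o prod_fun phi) /\
  \int[leb d]_x (prod_fun phi x)%:E = (\prod_(i < d) c i)%:E.
Proof.
move=> iphi phic.
have mphi i : measurable_fun setT (phi i) by apply/measurable_EFinP; exact: measurable_int (iphi i).
have ip e (psi : 'I_e -> R -> R) : (forall i, L.-integrable setT (EFin \o psi i)) ->
    (leb e).-integrable setT (EFin \o prod_fun psi).
  move=> ipsi; have mpsi i : measurable_fun setT (psi i) by apply/measurable_EFinP; exact: measurable_int (ipsi i).
  apply/integrableP; split; first by apply/measurable_EFinP; exact: measurable_prod_fun.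
  rewrite (_ : (fun x => _) = fun x => (prod_fun (fun i s => `|psi i s|) x)%:E)%R; last first.
    by apply/funext => x /=; rewrite /prod_fun normr_prod.
  rewrite (ge0_integral_prod (c := fun i => fine (\int[L]_s `|(psi i s)%:E|))) ?ltry//.
    by move=> i; apply: measurableT_comp.
  move=> i; rewrite fineK//; have /integrableP[_ h] := ipsi i.
  by rewrite ge0_fin_numE//; exact: integral_ge0.
split; first exact: ip.
elim: d phi c iphi phic mphi => [|d IH] phi c iphi phic mphi.
  rewrite ge0_integral_leb0; last by apply/measurable_EFinP; exact: measurable_prod_fun.
  by rewrite /prod_fun !big_ord0.
have mP : measurable_fun setT (EFin \o prod_fun phi) by apply/measurable_EFinP; exact: measurable_prod_fun.
have iP := ip _ _ iphi.
have iF : (L \x leb d).-integrable setT ((EFin \o prod_fun phi) \o @consp R d).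
  apply/integrableP; split.
    exact: (measurableT_comp mP (@measurable_consp R d)).
  have /integrableP[_] := iP.
  rewrite ge0_integral_leb_cons//.
  exact: measurableT_comp.
rewrite (_ : \int[leb d.+1]_x _ = \int[L \x leb d]_z ((EFin \o prod_fun phi) \o @consp R d) z); last first.
  have := integral_pushforward (@measurable_consp R d) (mu := (L \x leb d)%E) (D := setT) mP.
  by rewrite preimage_setT; apply.
rewrite -integral12_prod_meas1//.
transitivity (\int[L]_s ((phi ord0 s)%:E * (\prod_(i < d) c (lift ord0 i))%:E)).
  apply: eq_integral => s _; rewrite /fubini_F.
  under eq_integral do rewrite /comp prod_fun_consp EFinM/=.
  rewrite integralZl//; last by apply: ip => i; exact: iphi.
  by rewrite (IH _ (fun i => c (lift ord0 i))).
by rewrite (integralZr measurableT (iphi ord0)) phic big_ord_recl -EFinM.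
Qed.

End product_integral.

Section heat_eigen_line.
Context (R : realType).
Local Notation L := (@lebesgue_measure R).
Local Open Scope ereal_scope.

Lemma measurable_hermite_fun1 n : measurable_fun setT (@hermite_fun1 R n).
Proof.
rewrite /hermite_fun1; apply: measurable_funM.
  by apply: measurable_funM => //; exact: measurable_horner.
apply: measurableT_comp => //; apply: measurableT_comp => //.
apply: measurable_funM => //; exact: measurable_funX.
Qed.

Lemma integral_abs_hermite_fun1M m n :
  \int[L]_s (`|hermite_fun1 m s * hermite_fun1 n s|)%:E <= 1.
Proof.
have mm : forall i j, measurable_fun setT (fun s : R => hermite_fun1 i s * hermite_fun1 j s)%R.
  by move=> i j; apply: measurable_funM; exact: measurable_hermite_fun1.
pose F i (s : R) := (2^-1 * (hermite_fun1 i s * hermite_fun1 i s))%:E.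
have mF i : measurable_fun setT (F i) by apply/measurable_EFinP; apply: measurable_funM => //; exact: mm.
have F0 i s : 0 <= F i s by rewrite lee_fin mulr_ge0 ?invr_ge0// -expr2 sqr_ge0.
have FE i : \int[L]_s F i s = 2^-1%:E.
  rewrite /F; under eq_integral do rewrite EFinM.
  rewrite ge0_integralZl_EFin ?invr_ge0//; last 2 first.
  - by move=> s _; rewrite lee_fin -expr2 sqr_ge0.
  - by apply/measurable_EFinP; exact: mm.
  by rewrite hermite_fun1_orthonormal eqxx mule1.
have -> : 1 = \int[L]_s (F m s + F n s).
  rewrite ge0_integralD//= ?(FE m) ?(FE n).
  - by rewrite -EFinD; congr EFin; lra.
  - exact: mF.
  - exact: mF.
apply: ge0_le_integral => //.
- by apply/measurable_EFinP; apply: measurableT_comp => //; exact: mm.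
- by apply: emeasurable_funD; exact: mF.
move=> s _; rewrite -EFinD lee_fin.
move: (hermite_fun1 m s) (hermite_fun1 n s) => x y.
by rewrite ler_norml; apply/andP; split; have := sqr_ge0 (x + y)%R; have := sqr_ge0 (x - y)%R; rewrite !expr2; lra.
Qed.

(** As |h_j(v)| <= 1 + h_j(v)^2, the series is dominated by a geometric one plus the heat series on
    the diagonal at (v, v). *)
Lemma heat_term_norm_sum_lty (t v : R) : (0 < t)%R ->
  \sum_(j <oo) (expR (- ((2 * j + 1)%:R * t)) * `|hermite_fun1 j v|)%:E < +oo.
Proof.
move=> t0; have /andP[r0 r1] := expRN2_itv t0.
pose e j : R := expR (- ((2 * j + 1)%:R * t)).
pose w j := (e j + `|heat_term t v v j|)%R.
have cw : cvgn (series w).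
  rewrite (_ : series w = series e + [normed series (heat_term t v v)])%R; last first.
    by apply/funext => n; rewrite /series/= big_split.
  apply: is_cvgD; last exact: heat_term_cvg.
  rewrite (_ : e = geometric (expR (- t)) (expR (- (2 * t)))).
    by apply: is_cvg_geometric_series; rewrite ger0_norm// ltW.
  apply/funext => j; rewrite /geometric/= -expRM_natl -expRD /e natrD natrM.
  by congr expR; ring.
apply: (@le_lt_trans _ _ (\sum_(j <oo) (w j)%:E)).
  apply: lee_nneseries => j _; first by move=> _; rewrite lee_fin mulr_ge0 ?expR_ge0.
  have E : `|heat_term t v v j|%R = (e j * (`|hermite_fun1 j v| * `|hermite_fun1 j v|))%R.
    by rewrite /heat_term -mulrA !normrM ger0_norm ?expR_ge0.
  rewrite lee_fin -/(e j) /w E -[X in (X + _)%R]mulr1 -mulrDr ler_wpM2l ?expR_ge0//.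
  by have := sqr_ge0 (`|hermite_fun1 j v| - 1)%R; have := normr_ge0 (hermite_fun1 j v); rewrite expr2; nra.
have w0 j : (0 <= w j)%R by rewrite addr_ge0 ?expR_ge0.
by rewrite nneseries_esumT//= esum_nat// ltry.
Qed.

(** Dominated convergence for the partial sums of the heat series. The majorant is integrable
    because the functions |h_j h_k| have integrals at most 1 and the coefficients are summable. *)
Lemma heat_kernel1_eigen (t v : R) k : (0 < t)%R ->
  L.-integrable setT (fun u => (heat_kernel1 t u v * hermite_fun1 k u)%:E) /\
  \int[L]_u (heat_kernel1 t u v * hermite_fun1 k u)%:E =
    (expR (- ((2 * k + 1)%:R * t)) * hermite_fun1 k v)%:E.
Proof.
move=> t0.
pose e j : R := expR (- ((2 * j + 1)%:R * t)).
pose f_ (n : nat) u : \bar R := (series (heat_term t ^~ v u) n * hermite_fun1 k u)%:E.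
pose g_ (j : nat) u : \bar R := ((e j * `|hermite_fun1 j v|) * `|hermite_fun1 j u * hermite_fun1 k u|)%:E.
pose g u := \sum_(j <oo) g_ j u.
have fE n : f_ n = fun u => \sum_(0 <= j < n) ((e j * hermite_fun1 j v) * (hermite_fun1 j u * hermite_fun1 k u))%:E.
  apply/funext => u; rewrite /f_ /series/= mulr_suml sumEFin.
  by congr EFin; apply: eq_bigr => j _; rewrite /heat_term -/(e j); ring.
have e0 j : (0 <= e j)%R by exact: expR_ge0.
have ec0 j : (0 <= e j * `|hermite_fun1 j v|)%R by rewrite mulr_ge0.
have mhh j : measurable_fun setT (fun u : R => hermite_fun1 j u * hermite_fun1 k u)%R.
  by apply: measurable_funM; exact: measurable_hermite_fun1.
have mg j : measurable_fun setT (g_ j).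
  by apply/measurable_EFinP; apply: measurable_funM => //; apply: measurableT_comp.
have g0 j u : 0 <= g_ j u by rewrite lee_fin mulr_ge0.
have mf n : measurable_fun setT (f_ n).
  rewrite fE; apply: emeasurable_sum => j; apply/measurable_EFinP.
  by apply: measurable_funM.
have lim_f u : f_ n u @[n --> \oo] --> (heat_kernel1 t u v * hermite_fun1 k u)%:E.
  apply: cvg_EFin; first exact: nearW.
  apply: cvgMl; rewrite -heat_term_sum//.
  by apply: normed_cvg; exact: heat_term_cvg.
have ig : L.-integrable setT g.
  apply/integrableP; split; first by apply: (@ge0_emeasurable_sum _ _ _ _ g_ xpredT).
  under eq_integral do rewrite gee0_abs ?nneseries_ge0//.
  rewrite integral_nneseries//.
  apply: le_lt_trans (heat_term_norm_sum_lty v t0).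
  apply: lee_nneseries => j _; first by move=> _; exact: integral_ge0.
  rewrite /g_; under eq_integral do rewrite EFinM.
  rewrite ge0_integralZl_EFin//=.
    rewrite -[leRHS]mule1; apply: lee_wpmul2l; first by rewrite lee_fin ec0.
    exact: (integral_abs_hermite_fun1M j k).
  by apply/measurable_EFinP; apply: measurableT_comp => //; exact: mhh.
have fg u n : `|f_ n u| <= g u.
  rewrite fE sumEFin/=; apply: (@le_trans _ _ (\sum_(0 <= j < n) g_ j u)).
    rewrite sumEFin lee_fin; apply: le_trans (ler_norm_sum _ _ _) _.
    by apply: ler_sum => j _; rewrite normrM normrM (ger0_norm (e0 j)).
  exact: nneseries_lim_ge.
have [] := @dominated_convergence _ _ _ L setT measurableT f_ (fun u => (heat_kernel1 t u v * hermite_fun1 k u)%:E) g.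
- exact: mf.
- exact: (emeasurable_fun_cvg f_).
- exact: aeW.
- exact: ig.
- by apply: aeW => u n _; exact: fg.
move=> ih _ cv; split => //.
apply: (cvg_unique _ cv) => //.
(* By orthonormality the integrals of the partial sums are constant from n = k + 1 on. *)
apply: cvg_near_cst; near=> n.
rewrite -[LHS]/(\int[L]_x f_ n x) fE integral_sum//=; last first.
  by move=> j; under eq_fun do rewrite EFinM; apply: integrableZl => //; exact: integrable_hermite_fun1M.
under eq_bigr => j _.
  under eq_integral do rewrite EFinM.
  rewrite integralZl//; last exact: integrable_hermite_fun1M.
  rewrite hermite_fun1_orthonormal -EFinM; over.
rewrite sumEFin big_mkord.
have kn : (k < n)%N by near: n; exact: nbhs_infty_gt.
rewrite (bigD1 (Ordinal kn))//= eqxx mulr1 big1 ?addr0// => j.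
by rewrite -val_eqE/= => /negPf ->; rewrite mulr0.
Unshelve. all: by end_near. Qed.

End heat_eigen_line.

(** * The Gamma integral and the potential kernel *)

Lemma heat_kernel_eigen (R : realType) d (t : R) (y : rspace R d) (k : d.-tuple nat) : 0 < t ->
  (leb d).-integrable setT (fun x => (heat_kernel t x y * hermite_fun k x)%:E) /\
  (\int[leb d]_x (heat_kernel t x y * hermite_fun k x)%:E =
    (expR (- (eigenval R k * t)) * hermite_fun k y)%:E)%E.
Proof.
move=> t0.
pose phi (i : 'I_d) u := heat_kernel1 t u (tnth y i) * hermite_fun1 (tnth k i) u.
have E x : heat_kernel t x y * hermite_fun k x = prod_fun phi x.
  by rewrite heat_kernelE// /hermite_fun -big_split.
have := @integral_prod R d phi (fun i => expR (- ((2 * tnth k i + 1)%:R * t)) * hermite_fun1 (tnth k i) (tnth y i)).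
case => [i|i|h1 h2]; [|exact: (heat_kernel1_eigen _ _ t0).2|].
  exact: (heat_kernel1_eigen (tnth y i) (tnth k i) t0).1.
split; first by apply: eq_integrable h1 => // x _ /=; rewrite E.
under eq_integral do rewrite E.
rewrite h2 big_split/= -/(hermite_fun k y) -expR_sum; congr (expR _ * _)%:E.
rewrite /eigenval /mlength sumrN -mulr_suml -natr_sum big_split/= -big_distrr/=.
by rewrite sum1_card card_ord.
Qed.

Section gamma.
Context (R : realType).
Local Notation L := (@lebesgue_measure R).

Lemma measurable_invr d (T : measurableType d) (D : set T) (f : T -> R) :
  measurable_fun D f -> measurable_fun D (fun x => (f x)^-1).
Proof.
(* A real power inverts only nonnegative numbers, hence the square; where f vanishes both sides are
   0. *)
move=> mf; rewrite (_ : (fun x => _) = fun x => f x * (f x ^+ 2) `^ (- 1)); last first.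
  apply/funext => x; rewrite powR_inv1 ?sqr_ge0//.
  have [->|f0] := eqVneq (f x) 0; first by rewrite invr0 mul0r.
  by field.
by apply: measurable_funM => //; apply: measurable_powR_comp; exact: measurable_funX.
Qed.

Lemma powR_expR_bound (N c : R) : 0 <= N -> 0 < c ->
  exists2 C, 0 <= C & forall x, 0 < x -> x `^ N * expR (- (c * x)) <= C.
Proof.
rewrite le_eqVlt => /predU1P[<-|N0] c0.
  by exists 1 => // x x0; rewrite powRr0 mul1r -expR0 ler_expR oppr_le0 mulr_ge0// ltW.
(* This is (N/c)^N, which comes from ln y < y at y = c x / N. *)
exists (expR (- (N * ln (c / N)))) => [|x x0]; first exact: expR_ge0.
have cN : 0 < c / N by exact: divr_gt0.
rewrite powR_expR_ln// -expRD ler_expR.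
have := ln_sublinear (mulr_gt0 cN x0); rewrite [ln (c / N * x)]lnM ?posrE// => h.
have {}h : N * (ln (c / N) + ln x) < N * (c / N * x) by rewrite ltr_pM2l.
have E : N * (c / N * x) = c * x by field; rewrite gt_eqF.
by rewrite E mulrDr in h; lra.
Qed.

(** The integrand of the Gamma integral with rate [c], extended by 0 to the whole line so that the
    affine substitution applies. *)
Definition gamma_fun (s c t : R) : R := if 0 < t then t `^ (s - 1) * expR (- (c * t)) else 0.

Lemma gamma_fun_ge0 s c t : 0 <= gamma_fun s c t.
Proof. by rewrite /gamma_fun; case: ifP => // _; rewrite mulr_ge0 ?powR_ge0 ?expR_ge0. Qed.

Lemma measurable_gamma_fun s c : measurable_fun [set: measurableTypeR R] (gamma_fun s c).
Proof.
apply: measurable_fun_ifT => //; first exact: measurable_fun_ltr.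
apply: measurable_funM; first exact: measurable_powR_comp.
by apply: measurableT_comp => //; apply: measurableT_comp => //; exact: measurable_funM.
Qed.

Lemma integral_pos_line (f g : R -> R) : (forall t, 0 < t -> f t = g t) -> (forall t, t <= 0 -> g t = 0) ->
  (\int[lebesgue_measure]_(t in `]0%R, +oo[) (f t)%:E = \int[L]_t (g t)%:E)%E.
Proof.
move=> fg g0; rewrite integral_mkcond; apply: eq_integral => t _; rewrite /patch mem_setE/=.
rewrite in_itv/= andbT; case: ltP => [t0|t0]; first by rewrite fg.
by rewrite g0.
Qed.

Lemma integrable_gamma_fun (s : R) : 0 < s -> L.-integrable setT (EFin \o gamma_fun s 1).
Proof.
move=> s0.
have [C C0 Cle] := @powR_expR_bound (`|s + 1|) 1 (normr_ge0 _) ltr01.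
apply: (@integrable_decay _ _ s (Num.max 1 C) s0); first exact: measurable_gamma_fun.
  move=> t _; rewrite ger0_norm ?gamma_fun_ge0// /gamma_fun.
  case: ifPn => [t0|_]; last by rewrite mulr_ge0 ?powR_ge0// le_max ler01.
  rewrite gtr0_norm// mulrC ler_wpM2r ?powR_ge0// le_max -[X in _ <= X]expR0 ler_expR mul1r oppr_le0 (ltW t0)//.
move=> t t1; rewrite ger0_norm ?gamma_fun_ge0// /gamma_fun.
case: ifPn => [t0|_]; last by rewrite divr_ge0 ?sqr_ge0// le_max ler01.
rewrite ler_pdivlMr ?exprn_gt0// le_max; apply/orP; right.
apply: le_trans (Cle t t0); rewrite mulrAC ler_wpM2r ?expR_ge0//.
rewrite gtr0_norm ?addr_gt0// -[t ^+ 2](powR_mulrn _ (ltW t0)) -powRD; last by rewrite (gt_eqF t0) implybT.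
have -> : s - 1 + 2 = s + 1 by ring.
exact: lexx.
Qed.

Lemma GammafE (s : R) : 0 < s -> (\int[L]_t (gamma_fun s 1 t)%:E = (Gammaf s)%:E)%E.
Proof.
move=> s0; rewrite /Gammaf /Rintegral (@integral_pos_line _ (gamma_fun s 1)).
- by rewrite fineK//; apply: integrable_fin_num => //; exact: integrable_gamma_fun.
- by move=> t t0; rewrite /gamma_fun t0 mul1r.
- by move=> t t0; rewrite /gamma_fun ltNge t0.
Qed.

Lemma Gammaf_gt0 (s : R) : 0 < s -> 0 < Gammaf s.
Proof.
move=> s0; rewrite -lte_fin -GammafE//.
(* A lower bound of the integrand on [1, 2], where 0 <= ln t <= 2 and t <= 2. *)
pose m := expR (- ((`|s - 1| + 1) * 2)).
apply: (@lt_le_trans _ _ (\int[L]_(t in `[1%R, 2%R]) (m%:E : \bar R))%E).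
  rewrite integral_cst//= lebesgue_measure_itv/= lte_fin ltr1n -EFinB -EFinM lte_fin.
  by rewrite mulr_gt0 ?expR_gt0//; lra.
rewrite integral_mkcond; apply: ge0_le_integral => //.
- by move=> t _; rewrite /patch; case: ifP => // _; rewrite lee_fin expR_ge0.
- apply/(measurable_restrictT (cst m%:E)) => //.
- by apply/measurable_EFinP; exact: measurable_gamma_fun.
move=> t _; rewrite /patch; case: ifPn => [|_]; last by rewrite lee_fin gamma_fun_ge0.
rewrite inE/= in_itv/= => /andP[t1 t2]; have t0 : 0 < t by lra.
rewrite lee_fin /gamma_fun t0 powR_expR_ln// -expRD ler_expR mul1r.
have l1 : ln t <= 2 by have := ln_sublinear t0; lra.
have l0 : 0 <= ln t by exact: ln_ge0.
have h : `|(s - 1) * ln t| <= `|s - 1| * 2 by rewrite normrM (ger0_norm l0) ler_wpM2l.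
by have := ler_norm (- ((s - 1) * ln t)); rewrite normrN; lra.
Qed.

Lemma integral_gamma_fun (s c : R) : 0 < s -> 0 < c ->
  (\int[L]_t (gamma_fun s c t)%:E = (c `^ (- s) * Gammaf s)%:E)%E.
Proof.
move=> s0 c0.
have mg := measurable_gamma_fun s 1.
have g0 := gamma_fun_ge0 s 1.
have A := @ge0_integral_affine R c 0 (fun t => (gamma_fun s 1 t)%:E) c0.
have {}A := A (proj2 (measurable_EFinP _ _) mg) (fun t => g0 t).
transitivity (\int[L]_t ((c `^ (1 - s))%:E * (gamma_fun s 1 (c * t + 0))%:E))%E.
  apply: eq_integral => t _; rewrite -EFinM addr0; congr EFin; rewrite /gamma_fun pmulr_rgt0//.
  case: ifPn => t0; last by rewrite mulr0.
  rewrite mul1r powRM ?ltW// 2!mulrA -powRD ?(gt_eqF c0) ?implybT//.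
  have -> : 1 - s + (s - 1) = 0 by ring.
  by rewrite powRr0 mul1r.
rewrite ge0_integralZl_EFin//=; last 3 first.
- by move=> t _; rewrite lee_fin.
- apply/measurable_EFinP; apply: measurableT_comp => //; apply: measurable_funD => //; exact: measurable_funM.
- exact: powR_ge0.
rewrite A GammafE// -!EFinM; congr EFin; rewrite mulrA; congr (_ * _).
by rewrite -powR_inv1 ?ltW// -powRD ?(gt_eqF c0) ?implybT//; congr powR; ring.
Qed.

End gamma.

Section heat_kernel_product.
Context (R : realType) (d : nat).
Local Notation L := (@lebesgue_measure R).
Local Notation T := (rspace R d).

Lemma measurable_heat_kernel1 e (X : measurableType e) (f g h : X -> R) :
  measurable_fun setT f -> measurable_fun setT g -> measurable_fun setT h ->
  measurable_fun setT (fun w => heat_kernel1 (f w) (g w) (h w)).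
Proof.
move=> mf mg mh; rewrite /heat_kernel1 /mehler_exponent.
have mr : measurable_fun setT (fun w => expR (- (2 * f w))).
  by apply: measurableT_comp => //; apply: measurableT_comp => //; exact: measurable_funM.
have m2 : measurable_fun setT (fun w => g w ^+ 2 + h w ^+ 2).
  by apply: measurable_funD; exact: measurable_funX.
have m1r : measurable_fun setT (fun w => 1 - expR (- (2 * f w)) ^+ 2).
  by apply: measurable_funB => //; exact: measurable_funX.
apply: measurable_funM; first apply: measurable_funM.
- by apply: measurable_funM => //; apply: measurableT_comp => //; exact: measurableT_comp.
- apply: measurableT_comp => //; apply: measurable_funM => //; exact: measurableT_comp.
apply: measurableT_comp => //; apply: measurableT_comp => //; apply: measurable_funB.
  by apply: measurable_funM => //; apply: measurableT_comp => //; exact: measurable_ln.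
apply: measurable_funM; last exact: measurable_invr.
apply: measurable_funB.
  by apply: measurable_funM => //; apply: measurable_funM => //; exact: measurable_funM.
by apply: measurable_funM => //; exact: measurable_funX.
Qed.

Lemma heat_kernel1C (t x y : R) : heat_kernel1 t x y = heat_kernel1 t y x.
Proof.
rewrite /heat_kernel1 /mehler_exponent [y ^+ 2 + _]addrC.
by rewrite (_ : 2 * y * x = 2 * x * y)//; ring.
Qed.

Definition sqdist (x y : T) : R := \sum_(i < d) (tnth x i - tnth y i) ^+ 2.

Lemma sqdist_ge0 x y : 0 <= sqdist x y.
Proof. by apply: sumr_ge0 => i _; exact: sqr_ge0. Qed.

Lemma measurable_sqdist : measurable_fun setT (fun z : T * T => sqdist z.1 z.2).
Proof.
apply: measurable_sum => i; apply: measurable_funX; apply: measurable_funB.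
  exact: measurable_tnth_fst.
exact: measurable_tnth_snd.
Qed.

Definition heat_prod (t : R) (x y : T) : R := \prod_(i < d) heat_kernel1 t (tnth x i) (tnth y i).

Lemma heat_prod_ge0 t x y : 0 <= heat_prod t x y.
Proof. by apply: prodr_ge0 => i _; exact/ltW/heat_kernel1_gt0. Qed.

Lemma heat_prodC t x y : heat_prod t x y = heat_prod t y x.
Proof. by apply: eq_bigr => i _; exact: heat_kernel1C. Qed.

Lemma heat_prod_le t x y : 0 < t ->
  heat_prod t x y <= t `^ (- (d%:R / 2)) * expR (- (d%:R / 2 * t)) * expR (- (sqdist x y / (8 * t))).
Proof.
move=> t0.
apply: (@le_trans _ _ (\prod_(i < d) (t `^ (- 2^-1) * expR (- (t / 2)) * expR (- ((tnth x i - tnth y i) ^+ 2 / (8 * t)))))).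
  by apply: ler_prod => i _; rewrite heat_kernel1_le// ltW// heat_kernel1_gt0.
rewrite !big_split/= !prodr_const card_ord -expR_sum -expRM_natl -powR_mulrn ?powR_ge0// -powRrM.
rewrite sumrN -mulr_suml -/(sqdist x y) mulNr [2^-1 * _]mulrC (_ : d%:R * - (t / 2) = - (d%:R / 2 * t))//.
by field.
Qed.

(** The power t^(-1/2) cancels the width sqrt(8t) of the Gaussian, so only the exponential decay in
    t remains. *)
Lemma integral_heat_gauss (t v : R) : 0 < t ->
  (\int[L]_u (t `^ (- 2^-1) * expR (- (t / 2)) * expR (- ((u - v) ^+ 2 / (8 * t))))%:E =
   (Num.sqrt 8 * Num.sqrt pi * expR (- (t / 2)))%:E)%E.
Proof.
move=> t0; pose s := Num.sqrt (8 * t).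
have t8 : 0 < 8 * t by exact: mulr_gt0.
have s0 : 0 < s by rewrite sqrtr_gt0.
have ss : s ^+ 2 = 8 * t by rewrite sqr_sqrtr// ltW.
have mg : measurable_fun setT (fun u : R => (gauss_fun u)%:E).
  by apply/measurable_EFinP; apply: measurableT_comp => //; apply: measurableT_comp => //; exact: measurable_funX.
have si : 0 < s^-1 by rewrite invr_gt0.
have A := ge0_integral_affine (- (v / s)) si mg (fun u => expR_ge0 _).
under eq_integral => u _.
  rewrite (_ : expR (- ((u - v) ^+ 2 / (8 * t))) = gauss_fun (s^-1 * u + - (v / s))); last first.
    by rewrite /gauss_fun -ss; congr (expR (- _)); field; rewrite gt_eqF.
  rewrite EFinM; over.
rewrite ge0_integralZl_EFin//=; last 3 first.
- by move=> u _; rewrite lee_fin expR_ge0.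
- apply: (measurableT_comp mg); apply: measurable_funD => //; exact: measurable_funM.
- by rewrite mulr_ge0 ?powR_ge0 ?expR_ge0.
rewrite A integralT_gauss -!EFinM invrK; congr EFin.
rewrite /s sqrtrM// powRN powR12_sqrt ?(ltW t0)//.
by field; rewrite sqrtr_eq0 -ltNge.
Qed.

Lemma integral_heat_prod_le (t : R) (y : T) : 0 < t ->
  (\int[leb d]_x (heat_prod t x y)%:E <= (((Num.sqrt 8 * Num.sqrt pi) ^+ d * expR (- (d%:R / 2 * t)))%:E))%E.
Proof.
move=> t0.
pose phi (i : 'I_d) u := t `^ (- 2^-1) * expR (- (t / 2)) * expR (- ((u - tnth y i) ^+ 2 / (8 * t))).
have phi0 i s : 0 <= phi i s by rewrite !mulr_ge0 ?powR_ge0 ?expR_ge0.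
have mphi i : measurable_fun setT (phi i).
  apply: measurable_funM => //; apply: measurableT_comp => //; apply: measurableT_comp => //.
  by apply: measurable_funM => //; apply: measurable_funX; exact: measurable_funB.
apply: (@le_trans _ _ (\int[leb d]_x (prod_fun phi x)%:E)%E).
  apply: ge0_le_integral => //.
  - by move=> x _; rewrite lee_fin heat_prod_ge0.
  - apply/measurable_EFinP; apply: measurable_prod => i _; apply: measurable_heat_kernel1 => //.
    exact: measurable_tnth.
  - by apply/measurable_EFinP; exact: measurable_prod_fun.
  move=> x _; rewrite lee_fin; apply: ler_prod => i _.
  by rewrite heat_kernel1_le// ltW// heat_kernel1_gt0.
rewrite (ge0_integral_prod mphi phi0 (fun i => integral_heat_gauss (tnth y i) t0)).
rewrite big_split/= !prodr_const card_ord -expRM_natl (_ : d%:R * - (t / 2) = - (d%:R / 2 * t))//.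
by field.
Qed.

End heat_kernel_product.

(** * The potential kernel: symmetry, measurability and a uniform integral bound *)

Section potential_kernel.
Context (R : realType) (d : nat) (sigma : R).
Hypotheses (d_gt0 : (0 < d)%N) (sigma_gt0 : 0 < sigma).
Local Notation L := (@lebesgue_measure R).
Local Notation T := (rspace R d).
Local Notation K := (@potential_kernel R d sigma).

(** The closed form [heat_prod] agrees with the heat series only for t > 0; the extension by 0 turns
    the time integral into one over the line. *)
Definition potential_integrand (z : T * T) (t : R) : R :=
  if 0 < t then heat_prod t z.1 z.2 * t `^ (sigma - 1) else 0.

Lemma potential_integrand_ge0 z t : 0 <= potential_integrand z t.
Proof. by rewrite /potential_integrand; case: ifP => // _; rewrite mulr_ge0 ?powR_ge0 ?heat_prod_ge0. Qed.

Lemma measurable_potential_integrand :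
  measurable_fun setT (fun w : (T * T) * measurableTypeR R => potential_integrand w.1 w.2).
Proof.
have m2 : measurable_fun setT (fun w : (T * T) * measurableTypeR R => w.2 : R) by exact: measurable_snd.
apply: measurable_fun_ifT => //; first exact: measurable_fun_ltr.
apply: measurable_funM; last exact: measurable_powR_comp.
apply: measurable_prod => i _; apply: measurable_heat_kernel1 => //.
- exact: (measurableT_comp (@measurable_tnth_fst R d i) measurable_fst).
- exact: (measurableT_comp (@measurable_tnth_snd R d i) measurable_fst).
Qed.

Lemma potential_kernelE x y :
  K x y = ((Gammaf sigma)^-1%:E * \int[L]_t (potential_integrand (x, y) t)%:E)%E.
Proof.
rewrite /potential_kernel (@integral_pos_line _ _ (potential_integrand (x, y)))// => t t0.
  by rewrite /potential_integrand t0 heat_kernelE.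
by rewrite /potential_integrand ltNge t0.
Qed.

Lemma Gammaf_inv_ge0 : (0 <= (Gammaf sigma)^-1%:E)%E.
Proof. by rewrite lee_fin invr_ge0 ltW// Gammaf_gt0. Qed.

Lemma potential_kernel_ge0 x y : (0 <= K x y)%E.
Proof.
rewrite potential_kernelE mule_ge0 ?Gammaf_inv_ge0//; apply: integral_ge0 => t _.
by rewrite lee_fin potential_integrand_ge0.
Qed.

Lemma potential_kernelC x y : K x y = K y x.
Proof.
have E : potential_integrand (x, y) = potential_integrand (y, x).
  by apply/funext => t; rewrite /potential_integrand/= heat_prodC.
by rewrite (potential_kernelE x y) (potential_kernelE y x) E.
Qed.

Lemma measurable_potential_kernel : measurable_fun setT (fun z : T * T => K z.1 z.2).
Proof.
under eq_fun do rewrite potential_kernelE.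
apply: measurable_funeM.
have := @measurable_fun_fubini_tonelli_F _ _ (T * T)%type (measurableTypeR R) R L
  (fun w : (T * T) * measurableTypeR R => (potential_integrand w.1 w.2)%:E).
apply => [|w]; last by rewrite lee_fin potential_integrand_ge0.
by apply/measurable_EFinP; exact: measurable_potential_integrand.
Qed.

Lemma integral_potential_kernel : exists2 C : R, 0 <= C & forall y, (\int[leb d]_x K x y <= C%:E)%E.
Proof.
have d2 : 0 < d%:R / 2 :> R by rewrite divr_gt0// ltr0n.
pose A : R := (Num.sqrt 8 * Num.sqrt pi) ^+ d.
have A0 : 0 <= A by rewrite exprn_ge0// mulr_ge0 ?sqrtr_ge0.
(* The heat kernel has mass at most A e^(-dt/2); integrating t^(sigma - 1) against this gives a
   Gamma integral of rate d/2, and the Gamma factors cancel. *)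
exists (A * (d%:R / 2) `^ (- sigma)) => [|y]; first by rewrite mulr_ge0 ?powR_ge0.
under eq_integral do rewrite potential_kernelE.
pose F (w : T * measurableTypeR R) := (potential_integrand (w.1, y) w.2)%:E.
have mF : measurable_fun setT F.
  apply/measurable_EFinP.
  have mw : measurable_fun setT (fun w : T * measurableTypeR R => ((w.1, y), w.2)).
    apply: measurable_fun_pair => /=; last exact: measurable_snd.
    by apply: measurable_fun_pair => /=; [exact: measurable_fst|exact: measurable_cst].
  exact: (measurableT_comp measurable_potential_integrand mw).
have F0 w : (0 <= F w)%E by rewrite lee_fin potential_integrand_ge0.
rewrite ge0_integralZl//; last 3 first.
- exact: (@measurable_fun_fubini_tonelli_F _ _ T (measurableTypeR R) R L F mF F0).
- by move=> x _; apply: integral_ge0 => t _; rewrite lee_fin potential_integrand_ge0.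
- exact: Gammaf_inv_ge0.
have -> : (\int[leb d]_x \int[L]_t (potential_integrand (x, y) t)%:E =
    \int[L]_t \int[leb d]_x (potential_integrand (x, y) t)%:E)%E.
  exact: (@fubini_tonelli _ _ T (measurableTypeR R) R (leb d) L F mF F0).
apply: (@le_trans _ _ ((Gammaf sigma)^-1%:E * (\int[L]_t (A * gamma_fun sigma (d%:R / 2) t)%:E))%E).
  apply: lee_wpmul2l; first exact: Gammaf_inv_ge0.
  apply: ge0_le_integral => //.
  - by move=> t _; apply: integral_ge0 => x _; exact: (F0 (x, t)).
  - exact: (@measurable_fun_fubini_tonelli_G _ _ T (measurableTypeR R) R (leb d) F mF F0).
  - by apply/measurable_EFinP; apply: measurable_funM => //; exact: measurable_gamma_fun.
  move=> t _; rewrite /potential_integrand /gamma_fun/=; case: ifPn => [t0|_]; last by rewrite integral0 mulr0.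
  under eq_integral do rewrite mulrC EFinM.
  rewrite ge0_integralZl_EFin ?powR_ge0//; last 2 first.
  - by move=> x _; rewrite lee_fin heat_prod_ge0.
  - apply/measurable_EFinP; apply: measurable_prod => i _; apply: measurable_heat_kernel1 => //.
    exact: measurable_tnth.
  apply: le_trans (lee_wpmul2l _ (integral_heat_prod_le y t0)) _; first by rewrite lee_fin powR_ge0.
  by rewrite -EFinM lee_fin -/A mulrCA.
under eq_integral do rewrite EFinM.
rewrite ge0_integralZl_EFin//=; last 2 first.
- by move=> t _; rewrite lee_fin gamma_fun_ge0.
- by apply/measurable_EFinP; exact: measurable_gamma_fun.
rewrite integral_gamma_fun// -!EFinM lee_fin.
rewrite le_eqVlt; apply/orP; left; apply/eqP; field.
by rewrite gt_eqF// Gammaf_gt0.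
Qed.

End potential_kernel.

Lemma exp_inv_le (R : realType) (N C D t : R) : (forall x, 0 < x -> x `^ N * expR (- (8^-1 * x)) <= C) ->
  0 < D -> 0 < t -> expR (- (D / (8 * t))) <= C * (D `^ (- N) * t `^ N).
Proof.
move=> h D0 t0; have Dt : 0 < D / t by rewrite divr_gt0.
have {}h := h _ Dt.
have -> : D / (8 * t) = 8^-1 * (D / t) by field; rewrite gt_eqF.
have E : D `^ (- N) * t `^ N = ((D / t) `^ N)^-1.
  by rewrite powRM ?invr_ge0 ?ltW// powRVl// invfM invrK powRN.
by rewrite E ler_pdivlMr ?powR_gt0// mulrC.
Qed.

Section potential_kernel_riesz.
Context (R : realType) (d : nat) (sigma : R).
Hypotheses (d_gt0 : (0 < d)%N) (sigma_gt0 : 0 < sigma).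
Local Notation L := (@lebesgue_measure R).
Local Notation T := (rspace R d).
Local Notation K := (@potential_kernel R d sigma).

(* Up to [t = D] the Gaussian factor makes the integrand integrable at [0]; beyond
   it, the exponential decay of the heat kernel makes up for the missing power
   [t `^ (sigma - s)]. *)
Lemma integrand_riesz_le (s de C1 C2 D t : R) : de = d%:R / 2 - s -> 0 < D -> 0 < t -> 0 <= C1 -> 0 <= C2 -> 0 < de ->
  t `^ (sigma - s) * expR (- (d%:R / 2 * t)) <= C1 ->
  expR (- (D / (8 * t))) <= C2 * (D `^ (- (2 * de)) * t `^ (2 * de)) ->
  t `^ (- (d%:R / 2)) * expR (- (d%:R / 2 * t)) * expR (- (D / (8 * t))) * t `^ (sigma - 1) <=
  C1 * D `^ (- de) * (C2 * (D `^ (- de) * near_pow de D t) + D `^ de * far_pow de D t).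
Proof.
move=> deE D0 t0 C10 C20 de0 h1 h2.
have tP (a b : R) : t `^ a * t `^ b = t `^ (a + b) by rewrite powRD// (gt_eqF t0) implybT.
have DP (a b : R) : D `^ a * D `^ b = D `^ (a + b) by rewrite powRD// (gt_eqF D0) implybT.
have -> : t `^ (- (d%:R / 2)) * expR (- (d%:R / 2 * t)) * expR (- (D / (8 * t))) * t `^ (sigma - 1) =
   (t `^ (sigma - s) * expR (- (d%:R / 2 * t))) * (t `^ (- de - 1) * expR (- (D / (8 * t)))).
  transitivity (t `^ (- (d%:R / 2)) * t `^ (sigma - 1) * (expR (- (d%:R / 2 * t)) * expR (- (D / (8 * t))))).
    by ring.
  transitivity (t `^ (sigma - s) * t `^ (- de - 1) * (expR (- (d%:R / 2 * t)) * expR (- (D / (8 * t))))).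
    by rewrite !tP; congr (t `^ _ * _); rewrite deE; ring.
  by ring.
rewrite -[C1 * _ * _]mulrA; apply: ler_pM => //.
- by rewrite mulr_ge0 ?powR_ge0 ?expR_ge0.
- by rewrite mulr_ge0 ?powR_ge0 ?expR_ge0.
rewrite /near_pow /far_pow; have [tD|Dt] := leP t D.
  apply: (@le_trans _ _ (D `^ (- de) * (C2 * (D `^ (- de) * t `^ (de - 1))))); last first.
    rewrite ler_wpM2l ?powR_ge0// lerDl mulr_ge0 ?powR_ge0//.
    by case: ifP => // _; exact: powR_ge0.
  apply: (@le_trans _ _ (t `^ (- de - 1) * (C2 * (D `^ (- (2 * de)) * t `^ (2 * de))))).
    by rewrite ler_wpM2l ?powR_ge0.
  have -> : t `^ (- de - 1) * (C2 * (D `^ (- (2 * de)) * t `^ (2 * de))) =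
     C2 * D `^ (- (2 * de)) * (t `^ (- de - 1) * t `^ (2 * de)) by ring.
  have -> : D `^ (- de) * (C2 * (D `^ (- de) * t `^ (de - 1))) =
     C2 * (D `^ (- de) * D `^ (- de)) * t `^ (de - 1) by ring.
  rewrite tP DP.
  have -> : - de - 1 + 2 * de = de - 1 by ring.
  by have -> : - de + - de = - (2 * de) by ring.
rewrite (ltW Dt) mulr0 mulr0 add0r mulrA DP addNr powRr0 mul1r.
by rewrite ler_piMr ?powR_ge0// -expR0 ler_expR oppr_le0 divr_ge0 ?ltW// mulr_gt0.
Qed.

(** In terms of D = |x - y|^2 the two truncated powers of radius D have integrals bounded
    independently of D, so that only the prefactor D^(s - d/2), a power of |x - y| with exponent 2s
    - d, is left. *)
Lemma potential_kernel_le (s : R) : s <= sigma -> s < d%:R / 2 ->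
  exists2 C : R, 0 <= C &
    forall x y, 0 < sqdist x y -> (K x y <= (C * sqdist x y `^ (- (d%:R / 2 - s)))%:E)%E.
Proof.
move=> ss sd; pose de := d%:R / 2 - s.
have de0 : 0 < de by rewrite subr_gt0.
have d2 : 0 < d%:R / 2 :> R by rewrite divr_gt0// ltr0n.
(* [C1] takes care of the surplus power t^(sigma - s). The exponent 2 de behind [C2] turns t^(-de -
   1) into t^(de - 1), which is integrable at 0. *)
have [|C1 C10 h1] := @powR_expR_bound R (sigma - s) (d%:R / 2) _ d2; first by rewrite subr_ge0.
have i80 : 0 < 8^-1 :> R by rewrite invr_gt0.
have [|C2 C20 h2] := @powR_expR_bound R (2 * de) 8^-1 _ i80; first by rewrite mulr_ge0 ?ltW.
have G0 : 0 < (Gammaf sigma)^-1 by rewrite invr_gt0 Gammaf_gt0.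
exists ((Gammaf sigma)^-1 * (C1 * (C2 * (2 / de) + 2 / de))).
  by rewrite mulr_ge0 ?(ltW G0)// mulr_ge0// addr_ge0 ?mulr_ge0// ?invr_ge0 ltW.
move=> x y; set D := sqdist x y => D0; rewrite potential_kernelE.
rewrite -mulrA EFinM; apply: lee_wpmul2l; first by rewrite lee_fin ltW.
have mn : measurable_fun [set: measurableTypeR R] (fun t => near_pow de D `|(t : R) - 0|).
  apply: measurable_near_pow => //; apply: measurableT_comp; first exact: normr_measurable.
  exact: measurable_funB.
have mr : measurable_fun [set: measurableTypeR R] (fun t => far_pow de D `|(t : R) - 0|).
  apply: measurable_far_pow => //; apply: measurableT_comp; first exact: normr_measurable.
  exact: measurable_funB.
pose f (t : R) := (D `^ (- de) * near_pow de D `|t - 0|)%:E.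
pose g (t : R) := (D `^ de * far_pow de D `|t - 0|)%:E.
have mf : measurable_fun setT f by apply/measurable_EFinP; exact: measurable_funM.
have mg : measurable_fun setT g by apply/measurable_EFinP; exact: measurable_funM.
have f0 t : (0 <= f t)%E by rewrite lee_fin mulr_ge0 ?powR_ge0 ?near_pow_ge0.
have g0 t : (0 <= g t)%E by rewrite lee_fin mulr_ge0 ?powR_ge0 ?far_pow_ge0.
have c0 : 0 <= C1 * D `^ (- de) by rewrite mulr_ge0 ?powR_ge0.
apply: (@le_trans _ _ (\int[L]_t ((C1 * D `^ (- de))%:E * (C2%:E * f t + g t)))%E).
  apply: ge0_le_integral => //.
  - by move=> t _; rewrite lee_fin potential_integrand_ge0.
  - apply/measurable_EFinP.
    have mw : measurable_fun setT (fun t : measurableTypeR R => ((x, y), t)).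
      by apply: measurable_fun_pair; [exact: measurable_cst|exact: measurable_id].
    have h := measurableT_comp (measurable_potential_integrand (d := d) sigma) mw.
    exact: h.
  - by apply: measurable_funeM; apply: emeasurable_funD => //; exact: measurable_funeM.
  move=> t _.
  rewrite -[leRHS]/((C1 * D `^ (- de) * (C2 * (D `^ (- de) * near_pow de D `|t - 0|) + D `^ de * far_pow de D `|t - 0|))%:E).
  rewrite lee_fin /potential_integrand; case: ifPn => t0; last first.
    by rewrite mulr_ge0// addr_ge0 ?mulr_ge0 ?powR_ge0 ?near_pow_ge0 ?far_pow_ge0.
  rewrite subr0 (gtr0_norm t0).
  apply: le_trans (integrand_riesz_le erefl D0 t0 C10 C20 de0 (h1 _ t0) (exp_inv_le h2 D0 t0)).
  by rewrite ler_wpM2r ?powR_ge0//; exact: heat_prod_le.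
have C2E : (0 <= C2%:E)%E by rewrite lee_fin.
rewrite ge0_integralZl//=; last 2 first.
- by apply: emeasurable_funD => //; exact: measurable_funeM.
- by move=> t _; apply: adde_ge0 => //; exact: mule_ge0.
rewrite ge0_integralD//=; last 2 first.
- by move=> t _; exact: mule_ge0.
- exact: measurable_funeM.
rewrite ge0_integralZl//=.
have h3 := integral_near_pow (0 : R) de0 (ltW D0).
have h4 := integral_far_pow (0 : R) de0 (ltW D0).
rewrite [X in (_ <= X)%E](_ : _ = ((C1 * D `^ (- de))%:E * (C2%:E * (2 / de)%:E + (2 / de)%:E))%E); last first.
  by congr EFin; rewrite -/de; ring.
apply: lee_wpmul2l; first by rewrite lee_fin.
by apply: leeD; [exact: (lee_wpmul2l C2E h3)|exact: h4].
Qed.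

End potential_kernel_riesz.

(** * Weighted estimates for the potential kernel *)

Section null_sets.
Context (R : realType).
Local Notation L := (@lebesgue_measure R).
Local Open Scope ereal_scope.

Lemma leb_consE d (A : set (rspace R d.+1)) :
  leb d.+1 A = (L \x leb d) (@consp R d @^-1` A).
Proof. by []. Qed.

Lemma leb_hyperplane d (i : 'I_d) (c : R) : leb d [set x : rspace R d | tnth x i = c] = 0.
Proof.
elim: d i => [[]//|d IH] i; rewrite leb_consE.
have [j ->|->] := unliftP ord0 i.
  rewrite (_ : _ @^-1` _ = setT `*` [set y : rspace R d | tnth y j = c]); last first.
    by apply/seteqP; split => [z|z [_]] /=; rewrite tnth_conspS.
  rewrite product_measure1E//; last first.
    rewrite -[X in measurable X]setTI.
    exact: (@measurable_tnth _ (measurableTypeR R) d j measurableT [set c] (measurable_set1 c)).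
  by rewrite [X in _ * X]IH mule0.
rewrite (_ : _ @^-1` _ = [set c] `*` setT); last by apply/seteqP; split => [z|z []].
by rewrite product_measure1E// [X in X * _](lebesgue_measure_set1 c) mul0e.
Qed.

Lemma measurable_hyperplane d (i : 'I_d) (c : R) : measurable [set x : rspace R d | tnth x i = c].
Proof.
rewrite -[X in measurable X]setTI.
exact: (@measurable_tnth _ (measurableTypeR R) d i measurableT [set c] (measurable_set1 c)).
Qed.

Lemma ae_tnth_neq d (i : 'I_d) (c : R) : {ae leb d, forall x, tnth x i != c}.
Proof.
exists [set x | tnth x i = c]; split; [exact: measurable_hyperplane|exact: leb_hyperplane|].
by move=> x /=; case: eqP.
Qed.

(** The product of one-dimensional kernels is singular as soon as one coordinate vanishes or two
    corresponding ones coincide, not only at the origin and on the diagonal. All of this set is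
    avoided. *)
Definition generic d (z : rspace R d * rspace R d) :=
  forall i : 'I_d, [/\ tnth z.1 i != 0%R, tnth z.2 i != 0%R & tnth z.1 i != tnth z.2 i].

Lemma ae_generic d : {ae (leb d \x leb d), forall z, generic z}.
Proof.
suff H (i : 'I_d) : {ae (leb d \x leb d), forall z : rspace R d * rspace R d,
    [/\ tnth z.1 i != 0%R, tnth z.2 i != 0%R & tnth z.1 i != tnth z.2 i]}.
  (* The finite intersection over coordinates is written as a countable one, with a void condition
     for n >= d. *)
  have := @ae_foralln _ _ R (leb d \x leb d) (fun n z => forall i : 'I_d, i = n :> nat ->
    [/\ tnth z.1 i != 0%R, tnth z.2 i != 0%R & tnth z.1 i != tnth z.2 i]).
  have {}H n : {ae (leb d \x leb d), forall z : rspace R d * rspace R d, forall i : 'I_d, i = n :> nat ->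
    [/\ tnth z.1 i != 0%R, tnth z.2 i != 0%R & tnth z.1 i != tnth z.2 i]}.
    have [nd|dn] := ltnP n d; last first.
      by apply: aeW => z i ni; move: (ltn_ord i); rewrite ni ltnNge dn.
    apply: filterS (H (Ordinal nd)) => z hz i ni.
    by have -> : i = Ordinal nd by exact: val_inj.
  by move=> /(_ H); apply: filterS => z hz i; exact: hz.
have mD : measurable [set z : rspace R d * rspace R d | tnth z.1 i = tnth z.2 i].
  have mf : measurable_fun setT (fun z : rspace R d * rspace R d => (tnth z.1 i - tnth z.2 i)%R).
    by apply: measurable_funB; [exact: measurable_tnth_fst|exact: measurable_tnth_snd].
  have := mf measurableT [set 0%R] (measurable_set1 0%R); rewrite setTI.
  congr measurable; apply/seteqP; split => z /=.
    by move=> /eqP; rewrite subr_eq0 => /eqP.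
  by move=> ->; rewrite subrr.
suff N : (leb d \x leb d).-negligible (([set x | tnth x i = 0%R] `*` setT) `|`
  (setT `*` [set x | tnth x i = 0%R]) `|` [set z : rspace R d * rspace R d | tnth z.1 i = tnth z.2 i]).
  apply: negligibleS N => z /= h; apply: contrapT => hz; apply: h.
  by split; apply/eqP => e; apply: hz; [left; left|left; right|right].
apply: negligibleU; first apply: negligibleU.
- apply/negligibleP; first by apply: measurableX => //; exact: measurable_hyperplane.
  apply: etrans (product_measure1E _ _ _ _) _ => //; first exact: measurable_hyperplane.
  by rewrite [X in X * _](leb_hyperplane i 0%R) mul0e.
- apply/negligibleP; first by apply: measurableX => //; exact: measurable_hyperplane.
  apply: etrans (product_measure1E _ _ _ _) _ => //; first exact: measurable_hyperplane.
  by rewrite [X in _ * X](leb_hyperplane i 0%R) mule0.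
apply/negligibleP; first exact: mD.
(* The sections of the set where the i-th coordinates agree are hyperplanes. *)
transitivity (\int[leb d]_x leb d (xsection [set z : rspace R d * rspace R d | tnth z.1 i = tnth z.2 i] x)) => //.
rewrite integral0_eq// => x _ /=.
rewrite (_ : xsection _ _ = [set y | tnth y i = tnth x i]); first exact: leb_hyperplane.
by apply/seteqP; split => y; rewrite /xsection/= ?inE/= => ->.
Qed.

End null_sets.

Section bilinear_bound_ae.
Context (R : realType) d (T : measurableType d).
Variable mu : {sigma_finite_measure set T -> \bar R}.
Local Open Scope ereal_scope.

Lemma bilinear_bound_ae_le (k k' : T * T -> R) (P Q C : R) : measurable_fun setT k -> measurable_fun setT k' ->
  (forall z, 0 <= k z)%R -> (forall z, 0 <= k' z)%R ->
  {ae (mu \x mu), forall z, (k z <= k' z)%R} ->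
  bilinear_bound mu k' P Q C -> bilinear_bound mu k P Q C.
Proof.
move=> mk mk' k0 k'0 kk' b u v mu_ mv u0 v0 u1 v1.
apply: le_trans (b u v mu_ mv u0 v0 u1 v1).
apply: ae_ge0_le_integral => //.
- by move=> z _; rewrite lee_fin !mulr_ge0 ?powR_ge0.
- exact: measurable_EFin_integrand.
- by move=> z _; rewrite lee_fin !mulr_ge0 ?powR_ge0.
- exact: measurable_EFin_integrand.
apply: filterS kk' => z h _; rewrite lee_fin.
by rewrite ler_wpM2r ?powR_ge0// ler_wpM2r ?powR_ge0.
Qed.

Lemma bilinear_bound_weaken (k : T * T -> R) (P Q C C' : R) : (C <= C')%R ->
  bilinear_bound mu k P Q C -> bilinear_bound mu k P Q C'.
Proof.
by move=> CC b u v mu_ mv u0 v0 u1 v1; apply: le_trans (b u v mu_ mv u0 v0 u1 v1) _; rewrite lee_fin.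
Qed.

End bilinear_bound_ae.

(** * The Stein-Weiss inequality in R^d *)

Section stein_weiss_space.
Context (R : realType) (d : nat).
Hypothesis d_gt0 : (0 < d)%N.
Local Notation L := (@lebesgue_measure R).
Local Notation T := (rspace R d).

Let dR0 : 0 < d%:R :> R. Proof. by rewrite ltr0n. Qed.

Lemma le_enorm (x : T) i : `|tnth x i| <= enorm x.
Proof.
rewrite -sqrtr_sqr ler_wsqrtr// (bigD1 i)//= lerDl.
by apply: sumr_ge0 => j _; exact: sqr_ge0.
Qed.

Lemma le_sqdist (x y : T) i : (tnth x i - tnth y i) ^+ 2 <= sqdist x y.
Proof. by rewrite /sqdist (bigD1 i)//= lerDl; apply: sumr_ge0 => j _; exact: sqr_ge0. Qed.

(** Split r^(-a) into d equal factors; each increases when r is replaced by a smaller c_i. *)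
Lemma powRN_le_prod (a r : R) (c : 'I_d -> R) : 0 <= a -> (forall i, 0 < c i) -> (forall i, c i <= r) ->
  r `^ (- a) <= \prod_(i < d) c i `^ (- (a / d%:R)).
Proof.
move=> a0 c0 cr.
have -> : r `^ (- a) = \prod_(i < d) r `^ (- (a / d%:R)).
  rewrite prodr_const card_ord -powR_mulrn ?powR_ge0// -powRrM; congr (_ `^ _).
  by rewrite mulNr divfK// gt_eqF.
apply: ler_prod => i _; rewrite powR_ge0 lepowRN// divr_ge0// ltW//.
Qed.

Definition weighted_kernel (k : T * T -> R) (a b : R) (z : T * T) : R :=
  k z * enorm z.2 `^ (- a) * enorm z.1 `^ (- b).

Lemma weighted_kernel_ge0 k a b z : (forall z, 0 <= k z) -> 0 <= weighted_kernel k a b z.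
Proof. by move=> k0; rewrite /weighted_kernel !mulr_ge0 ?powR_ge0. Qed.

Lemma measurable_weighted_kernel k a b : measurable_fun setT k ->
  measurable_fun setT (weighted_kernel k a b).
Proof.
move=> mk; apply: measurable_funM; first apply: measurable_funM => //.
  by apply: measurable_powR_comp; exact: (measurableT_comp (@measurable_enorm R d) measurable_snd).
by apply: measurable_powR_comp; exact: (measurableT_comp (@measurable_enorm R d) measurable_fst).
Qed.

Definition sqdist_kernel (l : R) (z : T * T) : R := sqdist z.1 z.2 `^ (- l).

Lemma measurable_sqdist_kernel l : measurable_fun setT (sqdist_kernel l).
Proof. by apply: measurable_powR_comp; exact: measurable_sqdist. Qed.

(* Since the Euclidean norm dominates every coordinate, the kernel is bounded by a
   product of one-dimensional Stein-Weiss kernels, among which the exponents are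
   evenly distributed. *)
Lemma stein_weiss_space (P Q a b s : R) : P < 1 -> Q < 1 -> 1 <= P + Q -> 0 <= a -> 0 <= b ->
  a < d%:R * (1 - P) -> b < d%:R * (1 - Q) -> 0 < s ->
  s = (d%:R * (P + Q - 1) + a + b) / 2 ->
  exists2 C, 0 <= C & bilinear_bound (leb d) (weighted_kernel (sqdist_kernel (d%:R / 2 - s)) a b) P Q C.
Proof.
move=> P1 Q1 PQ a0 b0 aP bQ s0 sE.
have P0 : 0 < P by lra.
have Q0 : 0 < Q by lra.
have l0 : 0 <= d%:R / 2 - s.
  by have := dR0; rewrite sE; nra.
(* The d-th part of the exponent d - 2s of the distance. With a/d and b/d it satisfies the
   homogeneity relation on the line, by the choice of s. *)
pose l := 1 - 2 * s / d%:R.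
have [C HC] : exists C, bilinear_bound L (stein_weiss_kernel (a / d%:R) (b / d%:R) l) P Q C.
  apply: stein_weiss_line => //.
  - by rewrite divr_ge0// ltW.
  - by rewrite divr_ge0// ltW.
  - by rewrite ltr_pdivrMr// mulrC.
  - by rewrite ltr_pdivrMr// mulrC.
  - by rewrite /l ltrBlDr ltrDl divr_gt0// mulr_gt0.
  - by rewrite /l sE; field; rewrite gt_eqF.
(* Tensorization multiplies constants and needs a nonnegative one. *)
have C0 : 0 <= Num.max C 0 by rewrite le_max lexx orbT.
exists (Num.max C 0 ^+ d); first by rewrite exprn_ge0.
have H := @bilinear_bound_prod R d _ P Q _ (measurable_stein_weiss_kernel (a / d%:R) (b / d%:R) l)
  (stein_weiss_kernel_ge0 _ _ _) P0 Q0 C0.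
have {}H := H (bilinear_bound_weaken (_ : C <= Num.max C 0) HC).
apply: bilinear_bound_ae_le (H _); last by rewrite le_max lexx.
- by apply: measurable_weighted_kernel; exact: measurable_sqdist_kernel.
- by apply: measurable_prod_kernel; exact: measurable_stein_weiss_kernel.
- by move=> z; apply: weighted_kernel_ge0 => w; exact: powR_ge0.
- by move=> z; apply: prod_kernel_ge0; exact: stein_weiss_kernel_ge0.
apply: filterS (@ae_generic R d) => z gz; rewrite /weighted_kernel /prod_kernel.
under eq_bigr => i _.
  have [z1 z2 z12] := gz i.
  rewrite /stein_weiss_kernel/= !normr_gt0 z1 z2 subr_eq0 z12/=; over.
have c1 i : 0 < `|tnth z.1 i| by rewrite normr_gt0; have [] := gz i.
have c2 i : 0 < `|tnth z.2 i| by rewrite normr_gt0; have [] := gz i.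
have c3 i : 0 < `|tnth z.1 i - tnth z.2 i| by rewrite normr_gt0 subr_eq0; have [] := gz i.
rewrite !big_split/= /sqdist_kernel -mulrA mulrC.
rewrite ler_pM ?mulr_ge0 ?powR_ge0//; first rewrite ler_pM ?powR_ge0//.
- by apply: powRN_le_prod => // i; exact: le_enorm.
- by apply: powRN_le_prod => // i; exact: le_enorm.
apply: le_trans (powRN_le_prod (c := fun i => (tnth z.1 i - tnth z.2 i) ^+ 2) l0 _ _) _.
- by move=> i; rewrite -real_normK ?num_real// exprn_gt0.
- by move=> i; exact: le_sqdist.
rewrite le_eqVlt; apply/orP; left; apply/eqP; apply: eq_bigr => i _.
rewrite -real_normK ?num_real// -powR_mulrn// -powRrM; congr (_ `^ _).
by rewrite /l; field; rewrite gt_eqF.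
Qed.

End stein_weiss_space.

Lemma fine_le_EFin (R : realType) (x : \bar R) (r : R) : (0 <= x)%E -> (x <= r%:E)%E -> fine x <= r.
Proof. by case: x => [x|//|//]; rewrite !lee_fin. Qed.

(** * Weighted bilinear bounds for the potential kernel *)

Section potential_bilinear.
Context (R : realType) (d : nat) (sigma : R).
Hypotheses (d_gt0 : (0 < d)%N) (sigma_gt0 : 0 < sigma).
Local Notation T := (rspace R d).
Local Notation K := (@potential_kernel R d sigma).

Let dR0 : 0 < d%:R :> R.
Proof. by rewrite ltr0n. Qed.

(* [fine] sends the value [+oo] of the kernel on the diagonal to [0], which only
   matters outside of [generic] pairs. *)
Definition fine_kernel (z : T * T) : R := fine (K z.1 z.2).

Lemma fine_kernel_ge0 z : 0 <= fine_kernel z.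
Proof. by apply: fine_ge0; exact: potential_kernel_ge0. Qed.

Lemma measurable_fine_kernel : measurable_fun setT fine_kernel.
Proof.
exact: (measurableT_comp (fine_measurable measurableT) (@measurable_potential_kernel R d sigma)).
Qed.

Lemma generic_sqdist_gt0 (z : T * T) : generic z -> 0 < sqdist z.1 z.2.
Proof.
move=> gz; have i0 : 'I_d by exact: Ordinal d_gt0.
apply: lt_le_trans (le_sqdist z.1 z.2 i0).
have [_ _ h] := gz i0.
by rewrite -real_normK ?num_real// exprn_gt0// normr_gt0 subr_eq0.
Qed.

Lemma fine_kernel_le s : s <= sigma -> s < d%:R / 2 -> exists2 C, 0 <= C &
  forall z, generic z -> fine_kernel z <= C * sqdist_kernel (d%:R / 2 - s) z.
Proof.
move=> ss sd; have [C C0 h] := potential_kernel_le d_gt0 sigma_gt0 ss sd.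
exists C => // z gz; apply: fine_le_EFin; first exact: potential_kernel_ge0.
by apply: h; exact: generic_sqdist_gt0.
Qed.

Lemma integral_fine_kernel : exists2 C, 0 <= C & forall y, (\int[leb d]_x (fine_kernel (x, y))%:E <= C%:E)%E.
Proof.
have [C C0 h] := integral_potential_kernel d_gt0 sigma_gt0.
exists C => // y; apply: le_trans (h y).
have mp : measurable_fun setT (fun x : T => (x, y)).
  by apply: measurable_fun_pair; [exact: measurable_id|exact: measurable_cst].
apply: ge0_le_integral => //.
- by move=> x _; rewrite lee_fin fine_kernel_ge0.
- by apply/measurable_EFinP; exact: (measurableT_comp measurable_fine_kernel mp).
- exact: (measurableT_comp (@measurable_potential_kernel R d sigma) mp).
move=> x _; rewrite /fine_kernel/=; have := @potential_kernel_ge0 R d sigma sigma_gt0 x y.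
by case: (K x y) => [r|//|//] _ /=; rewrite ?leey.
Qed.

Lemma fine_kernelC z : fine_kernel (z.2, z.1) = fine_kernel z.
Proof. by rewrite /fine_kernel/= potential_kernelC. Qed.

Lemma schur_fine_kernel P Q : 0 < P -> 0 < Q -> P + Q = 1 ->
  exists2 C, 0 <= C & bilinear_bound (leb d) (weighted_kernel fine_kernel 0 0) P Q C.
Proof.
move=> P0 Q0 PQ; have [C C0 HC] := integral_fine_kernel.
exists (C + C); first exact: addr_ge0.
move=> u v mu_ mv u0 v0 u1 v1.
have mk := measurable_fine_kernel.
have k0 := fine_kernel_ge0.
pose w z := weighted_kernel fine_kernel 0 0 z * u z.2 `^ P * v z.1 `^ Q.
have mw : measurable_fun setT w.
  apply/measurable_EFinP; exact: (measurable_EFin_integrand P Q (measurable_weighted_kernel 0 0 mk) mu_ mv).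
have w0 z : 0 <= w z by rewrite !mulr_ge0 ?powR_ge0// weighted_kernel_ge0.
have HC' x : (\int[leb d]_y (fine_kernel (x, y))%:E <= C%:E)%E.
  by under eq_integral do rewrite -fine_kernelC/=; exact: HC.
have le z : w z <= u z.2 * fine_kernel z + v z.1 * fine_kernel z + 0 * (u z.2 * v z.1).
  rewrite mul0r addr0 /w /weighted_kernel oppr0 !powRr0 !mulr1.
  have h := @powR_mul3_le R P Q 0 (u z.2) (v z.1) 0 (ltW P0) (ltW Q0) (lexx _).
  rewrite addr0 PQ powRr0 mulr1 addr0 in h.
  by rewrite -mulrA [u _ * _]mulrC [v _ * _]mulrC -mulrDr ler_wpM2l// h.
have := bilinear_majorant mw w0 mu_ mv u0 v0 u1 v1 mk mk k0 k0 C0 C0 (lexx 0) HC HC' le.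
by rewrite addr0.
Qed.

Lemma potential_bilinear_ge0 P Q a b : P < 1 -> Q < 1 -> 1 <= P + Q -> 0 <= a -> 0 <= b ->
  a < d%:R * (1 - P) -> b < d%:R * (1 - Q) -> (d%:R * (P + Q - 1) + a + b) / 2 <= sigma ->
  exists2 C, 0 <= C & bilinear_bound (leb d) (weighted_kernel fine_kernel a b) P Q C.
Proof.
move=> P1 Q1 PQ a0 b0 aP bQ.
set s := (X in X <= sigma) => ss.
have mk := measurable_fine_kernel.
have k0 := fine_kernel_ge0.
have dPQ : 0 <= d%:R * (P + Q - 1) by rewrite mulr_ge0// subr_ge0.
have : 0 <= s by rewrite divr_ge0// !addr_ge0.
rewrite le_eqVlt => /predU1P[s0|s0].
  have h : d%:R * (P + Q - 1) + a + b = 0 by move: s0; rewrite /s; lra.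
  have -> : a = 0 by lra.
  have -> : b = 0 by lra.
  have PQ1 : P + Q = 1.
    have : d%:R * (P + Q - 1) = 0 by lra.
    by move/eqP; rewrite mulf_eq0 (gt_eqF dR0)/= subr_eq0 => /eqP.
  by apply: schur_fine_kernel => //; lra.
(* The sum of the strict bounds on a and b is 2s < d. *)
have sd : s < d%:R / 2 by rewrite /s; have := dR0; move: aP bQ; rewrite !mulrBr !mulrDr !mulr1; lra.
have [C C0 kC] := fine_kernel_le ss sd.
have [C' C'0 H] := stein_weiss_space d_gt0 P1 Q1 PQ a0 b0 aP bQ s0 erefl.
exists (C * C'); first exact: mulr_ge0.
pose k' := weighted_kernel (@sqdist_kernel R d (d%:R / 2 - s)) a b.
have mk' : measurable_fun setT k' by apply: measurable_weighted_kernel; exact: measurable_sqdist_kernel.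
have k'0 z : 0 <= k' z by apply: weighted_kernel_ge0 => w; exact: powR_ge0.
apply: (@bilinear_bound_ae_le _ _ _ _ _ (fun z => C * k' z)).
- exact: measurable_weighted_kernel.
- exact: measurable_funM.
- by move=> z; exact: weighted_kernel_ge0.
- by move=> z; rewrite mulr_ge0.
- apply: filterS (@ae_generic R d) => z gz; rewrite /k' /weighted_kernel !mulrA.
  by rewrite ler_wpM2r ?powR_ge0// ler_wpM2r ?powR_ge0// kC.
exact: bilinear_boundZ.
Qed.

Lemma enorm_pow_le (al : R) (x y : T) : 0 <= al ->
  enorm y `^ al <= 4 `^ (al / 2) * (enorm x `^ al + sqdist x y `^ (al / 2)).
Proof.
move=> al0.
have e2 (w : T) : enorm w `^ al = (enorm w ^+ 2) `^ (al / 2).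
  by rewrite -powR_mulrn ?sqrtr_ge0// -powRrM; congr (_ `^ _); field.
have sq (w : T) : enorm w ^+ 2 = \sum_(i < d) tnth w i ^+ 2.
  by rewrite sqr_sqrtr// sumr_ge0// => i _; exact: sqr_ge0.
(* Coordinatewise the difference of the two sides is (y_i - 2 x_i)^2. Bounding the sum by twice the
   larger term then gives the constant 4. *)
have yx : enorm y ^+ 2 <= 2 * (enorm x ^+ 2 + sqdist x y).
  rewrite !sq /sqdist -big_split/= mulr_sumr; apply: ler_sum => i _.
  have := sqr_ge0 (tnth y i - 2 * tnth x i); rewrite !expr2; nra.
have D0 := sqdist_ge0 x y.
have x0 : 0 <= enorm x ^+ 2 by exact: sqr_ge0.
have y0 : 0 <= enorm y ^+ 2 by exact: sqr_ge0.
rewrite !e2; set X := enorm x ^+ 2 in yx x0 *; set D := sqdist x y in yx D0 *.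
have al2 : 0 <= al / 2 by rewrite divr_ge0.
move: (enorm y ^+ 2) y0 yx => Y y0 yx; clearbody X D.
have [xD|Dx] := leP X D.
  apply: (@le_trans _ _ ((4 * D) `^ (al / 2))).
    by rewrite ge0_ler_powR ?nnegrE ?mulr_ge0//; lra.
  by rewrite powRM// ler_wpM2l ?powR_ge0// lerDr powR_ge0.
apply: (@le_trans _ _ ((4 * X) `^ (al / 2))).
  by rewrite ge0_ler_powR ?nnegrE ?mulr_ge0//; lra.
by rewrite powRM// ler_wpM2l ?powR_ge0// lerDl powR_ge0.
Qed.

(* A growing weight is moved across the kernel by
   [|y|^-a <= C (|x|^-a + |x - y|^-a)]. *)
Lemma potential_bilinear_neg P Q a b : P < 1 -> Q < 1 -> 1 <= P + Q -> a < 0 -> 0 <= a + b ->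
  b < d%:R * (1 - Q) -> (d%:R * (P + Q - 1) + a + b) / 2 <= sigma ->
  exists2 C, 0 <= C & bilinear_bound (leb d) (weighted_kernel fine_kernel a b) P Q C.
Proof.
move=> P1 Q1 PQ a0 ab bQ.
set s := (X in X <= sigma) => ss.
have mk := measurable_fine_kernel.
have k0 := fine_kernel_ge0.
have dPQ : 0 <= d%:R * (P + Q - 1) by rewrite mulr_ge0// subr_ge0.
have dP : 0 < d%:R * (1 - P) by rewrite mulr_gt0// subr_gt0.
have b0 : 0 < b by lra.
(* The part |x|^-a of the weight leads to the exponents 0 and a + b, both nonnegative and with the
   same index s. *)
have [C1 C10 H1] : exists2 C, 0 <= C & bilinear_bound (leb d) (weighted_kernel fine_kernel 0 (a + b)) P Q C.
  by apply: potential_bilinear_ge0 => //; move: ss; rewrite /s; lra.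
have sd : s < d%:R / 2.
  by move: dP bQ; rewrite /s !mulrBr !mulrDr !mulr1; lra.
have [C C0 kC] := fine_kernel_le ss sd.
(* The part |x - y|^-a raises the Riesz index to s', the homogeneous value for the weights 0 and b.
   Only the Riesz kernel has this index, which may exceed sigma; the potential kernel itself is
   estimated with s. *)
pose s' := s - a / 2.
have [||C2 C20 H2] := @stein_weiss_space R d d_gt0 P Q 0 b s' P1 Q1 PQ (lexx _) (ltW b0) dP bQ.
- by rewrite /s' /s; lra.
- by rewrite /s' /s; lra.
pose k1 := weighted_kernel fine_kernel 0 (a + b).
pose k2 := weighted_kernel (@sqdist_kernel R d (d%:R / 2 - s')) 0 b.
pose M : R := 4 `^ (- a / 2).
have M0 : 0 <= M by exact: powR_ge0.
have mk1 : measurable_fun setT k1 by exact: measurable_weighted_kernel.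
have mk2 : measurable_fun setT k2 by apply: measurable_weighted_kernel; exact: measurable_sqdist_kernel.
have k10 z : 0 <= k1 z by exact: weighted_kernel_ge0.
have k20 z : 0 <= k2 z by apply: weighted_kernel_ge0 => w; exact: powR_ge0.
exists (M * (C1 + C * C2)); first by rewrite mulr_ge0 ?addr_ge0 ?mulr_ge0.
have mC : measurable_fun setT (fun z => C * k2 z) by exact: measurable_funM.
have mS : measurable_fun setT (fun z => k1 z + C * k2 z) by exact: measurable_funD.
have C2k0 z : 0 <= C * k2 z by exact: mulr_ge0.
have S0 z : 0 <= k1 z + C * k2 z by exact: addr_ge0.
apply: (@bilinear_bound_ae_le _ _ _ _ _ (fun z => M * (k1 z + C * k2 z))).
- exact: measurable_weighted_kernel.
- exact: measurable_funM.
- by move=> z; exact: weighted_kernel_ge0.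
- by move=> z; rewrite mulr_ge0.
- apply: filterS (@ae_generic R d) => z gz; rewrite /k1 /k2 /weighted_kernel oppr0 !powRr0 !mulr1.
  have e1 : 0 < enorm z.1.
    have i0 : 'I_d by exact: Ordinal d_gt0.
    by apply: lt_le_trans (le_enorm z.1 i0); rewrite normr_gt0; have [] := gz i0.
  have D0 := generic_sqdist_gt0 gz.
  have e2 : enorm z.2 `^ (- a) <= M * (enorm z.1 `^ (- a) + sqdist z.1 z.2 `^ (- a / 2)).
    by apply: enorm_pow_le; rewrite oppr_ge0 ltW.
  apply: (@le_trans _ _ (fine_kernel z * (M * (enorm z.1 `^ (- a) + sqdist z.1 z.2 `^ (- a / 2))) * enorm z.1 `^ (- b))).
    by rewrite ler_wpM2r ?powR_ge0// ler_wpM2l.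
  rewrite mulrCA -!mulrA ler_wpM2l// mulrDl mulrDr.
  rewrite -powRD ?(gt_eqF e1) ?implybT// -opprD lerD2l.
  rewrite !mulrA ler_wpM2r ?powR_ge0//.
  apply: le_trans (ler_wpM2r (powR_ge0 _ _) (kC z gz)) _.
  rewrite -mulrA /sqdist_kernel -powRD ?(gt_eqF D0) ?implybT//.
  rewrite (_ : - (d%:R / 2 - s) + - a / 2 = - (d%:R / 2 - s')) ?lexx//.
  by rewrite /s'; field.
apply: bilinear_boundZ => //.
apply: bilinear_boundD => //.
exact: bilinear_boundZ.
Qed.

Lemma potential_bilinear P Q a b : P < 1 -> Q < 1 -> 1 <= P + Q -> 0 <= a + b ->
  a < d%:R * (1 - P) -> b < d%:R * (1 - Q) -> (d%:R * (P + Q - 1) + a + b) / 2 <= sigma ->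
  exists2 C, 0 <= C & bilinear_bound (leb d) (weighted_kernel fine_kernel a b) P Q C.
Proof.
move=> P1 Q1 PQ ab aP bQ ss.
have [a0|a0] := ltP a 0; first exact: potential_bilinear_neg.
have [b0|b0] := ltP b 0; last exact: potential_bilinear_ge0.
have [|||C C0 H] := @potential_bilinear_neg Q P b a Q1 P1 _ b0 _ aP.
- by rewrite addrC.
- by rewrite addrC.
- by rewrite [Q + P]addrC addrAC.
exists C; first exact: C0.
have -> : weighted_kernel fine_kernel a b = fun z => weighted_kernel fine_kernel b a (z.2, z.1).
  by apply/funext => z; rewrite /weighted_kernel fine_kernelC mulrAC.
exact: (bilinear_bound_swap (measurable_weighted_kernel b a measurable_fine_kernel)
  (fun z => weighted_kernel_ge0 b a z fine_kernel_ge0) H).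
Qed.

End potential_bilinear.

(** * Weighted norms and duality *)

Section density.
Context d (T : measurableType d) (R : realType).
Variables (mu nu : {measure set T -> \bar R}) (g : T -> R).
Hypotheses (mg : measurable_fun setT g) (g0 : forall x, 0 <= g x)
  (nuE : forall A, measurable A -> nu A = (\int[mu]_(x in A) (g x)%:E)%E).
Local Open Scope ereal_scope.
Import HBNNSimple.

(** It turns integrals for the measure [wleb], which is given by its values on sets, into weighted
    Lebesgue integrals. Simple functions are immediate, and both sides pass to monotone limits. *)
Lemma ge0_integral_density (f : T -> \bar R) : measurable_fun setT f -> (forall x, 0 <= f x) ->
  \int[nu]_x f x = \int[mu]_x (f x * (g x)%:E).
Proof.
move=> mf f0; pose h := nnsfun_approx measurableT mf.
have mgE : measurable_fun setT (EFin \o g) by exact/measurable_EFinP.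
have mh n : measurable_fun setT (EFin \o h n) by apply/measurable_EFinP; exact: measurable_funP.
have hf x : EFin (h n x) @[n --> \oo] --> f x by exact: cvg_nnsfun_approx.
have hnd x : {homo (fun n => (h n x)%:E) : n m / (n <= m)%N >-> n <= m}.
  by move=> n m nm; rewrite lee_fin; exact/lefP/nd_nnsfun_approx.
have c1 : \int[nu]_x (h n x)%:E @[n --> \oo] --> \int[nu]_x f x.
  rewrite (_ : \int[nu]_x f x = \int[nu]_x limn (fun n => (h n x)%:E)); last first.
    by apply: eq_integral => x _; apply/esym/cvg_lim => //; exact: hf.
  apply: cvg_monotone_convergence => //.
  by move=> n x _; rewrite lee_fin.
have c2 : \int[mu]_x ((h n x)%:E * (g x)%:E) @[n --> \oo] --> \int[mu]_x (f x * (g x)%:E).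
  rewrite (_ : \int[mu]_x (f x * _) = \int[mu]_x limn (fun n => (h n x)%:E * (g x)%:E)); last first.
    apply: eq_integral => x _; apply/esym/cvg_lim => //.
    by apply: cvgeZr => //; exact: hf.
  apply: cvg_monotone_convergence => //.
  - by move=> n; apply: emeasurable_funM; [exact: mh|exact: mgE].
  - by move=> n x _; rewrite mule_ge0// lee_fin.
  - by move=> x _ n m nm; rewrite lee_wpmul2r ?lee_fin//; exact/lefP/nd_nnsfun_approx.
suff E n : \int[nu]_x (h n x)%:E = \int[mu]_x ((h n x)%:E * (g x)%:E).
  by move: c1; rewrite (funext E) => c1; exact: (cvg_unique _ c1 c2).
have mi r : measurable_fun setT (fun x => (r * \1_(h n @^-1` [set r]) x)%:E).
  by apply/measurable_EFinP; exact: measurable_funM.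
transitivity (\int[nu]_x (\sum_(y \in range (h n)) (y * \1_(h n @^-1` [set y]) x)%:E)).
  by apply: eq_integral => x _; rewrite /= fimfunE -fsumEFin.
rewrite ge0_integral_fsum//; last by move=> m y _; exact: nnfun_muleindic_ge0.
transitivity (\int[mu]_x (\sum_(y \in range (h n)) ((y * \1_(h n @^-1` [set y]) x)%:E * (g x)%:E))); last first.
  apply: eq_integral => x _.
  rewrite -ge0_mule_fsuml => [|y]; last exact: nnfun_muleindic_ge0.
  by rewrite fsumEFin // -(fimfunE _ x).
rewrite ge0_integral_fsum//; last 2 first.
- by move=> y; exact: emeasurable_funM.
- by move=> m y _; apply: mule_ge0; [exact: nnfun_muleindic_ge0|rewrite lee_fin].
apply: eq_fsbigr => r rhn.
under eq_integral do rewrite EFinM.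
rewrite integralZl_indic_nnsfun//.
have mA : measurable (h n @^-1` [set r]) by [].
rewrite integral_indic// setIT nuE//.
have [s _ sr] : range (h n) r by rewrite inE in rhn.
have r0 : (0 <= r)%R by rewrite -sr.
under [RHS]eq_integral do rewrite EFinM -muleA.
rewrite ge0_integralZl//=; last 2 first.
- by apply: emeasurable_funM => //; exact/measurable_EFinP.
- by move=> x _; rewrite -EFinM lee_fin mulr_ge0.
congr (_ * _); rewrite integral_mkcond; apply: eq_integral => x _.
by rewrite epatch_indic muleC.
Qed.

End density.

(* Test with [g = w `^ (q - 1)], cut off to a set where [w `^ q] is integrable. *)
Lemma dual_bound d (T : measurableType d) (R : realType) (mu : {sigma_finite_measure set T -> \bar R})
    (w : T -> R) (q r C : R) :
  measurable_fun setT w -> (forall x, 0 <= w x) -> 1 < q -> q^-1 + r^-1 = 1 -> 0 <= C ->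
  (forall (g : T -> R) (B : R), measurable_fun setT g -> (forall x, 0 <= g x) -> 0 <= B ->
     (\int[mu]_x (g x `^ r)%:E <= B%:E)%E -> (\int[mu]_x (w x * g x)%:E <= (C * B `^ r^-1)%:E)%E) ->
  (\int[mu]_x (w x `^ q)%:E <= (C `^ q)%:E)%E.
Proof.
move=> mw w0 q1 qr C0 dual.
have q0 : 0 < q by lra.
have ri0 : 0 < r^-1 by have := invf_lt1 q0; rewrite q1; lra.
have r0 : 0 < r by rewrite -invr_gt0.
have q1r : (q - 1) * r = q.
  have : (q - 1) * r * (q^-1 + r^-1) = (q - 1) * r by rewrite qr mulr1.
  have -> : (q - 1) * r * (q^-1 + r^-1) = (q - 1) * r / q + (q - 1) by field; rewrite !gt_eqF.
  have -> : (q - 1) * r / q = r - r / q by field; rewrite gt_eqF.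
  have : r / q = r - 1 by have -> : r / q = r * (1 - r^-1) by [rewrite -qr addrK]; field; rewrite gt_eqF.
  by move=> -> e; rewrite -e; ring.
have /sigma_finiteP[F [FT ndF mF]] := sigma_finiteT mu.
(* Finite measure and bounded [w] make the integral over [E n] finite, so that the final inequality
   can be divided by a power of it. *)
pose E n := F n `&` [set x | w x <= n%:R].
have mE n : measurable (E n).
  apply: measurableI; first by case: (mF n).
  rewrite -[X in measurable X]setTI.
  by have := mw measurableT `]-oo, n%:R]%classic (measurable_itv _); congr (measurable (_ `&` _));
    apply/seteqP; split => x /=; rewrite in_itv.
have mwq : measurable_fun setT (fun x => (w x `^ q)%:E).
  by apply/measurable_EFinP; exact: measurable_powR_comp.
have <- : \bigcup_n E n = setT.
  rewrite -subTset => x _; have [m _ Fm] : (\bigcup_n F n) x by rewrite -FT.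
  exists (maxn m (Num.truncn (w x)).+1) => //; split.
    by move: Fm; exact/subsetPset/ndF/leq_maxl.
  by apply: ltW; apply: (lt_le_trans (truncnS_gt (w x))); rewrite ler_nat leq_maxr.
apply: ge0_integral_bigcup_le => //.
- apply/nondecreasing_seqP => n; apply/subsetPset => x [Fx wx]; split.
    by move: Fx; exact/subsetPset/ndF.
  by apply: (le_trans wx); rewrite ler_nat.
- by move=> n; exact: measurable_funTS.
- by move=> n x _; rewrite lee_fin powR_ge0.
move=> n; rewrite integral_mkcond.
pose g x := w x `^ (q - 1) * \1_(E n) x.
have gE x : (((fun x => (w x `^ q)%:E) \_ (E n)) x = (w x `^ q * \1_(E n) x)%:E)%E.
  by rewrite /patch indicE; case: ifP => _; rewrite ?mulr1 ?mulr0.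
under eq_integral do rewrite gE.
have mg : measurable_fun setT g.
  by apply: measurable_funM; [exact: measurable_powR_comp|exact: measurable_indic].
have g0 x : 0 <= g x by rewrite mulr_ge0 ?powR_ge0.
have gr x : g x `^ r = w x `^ q * \1_(E n) x.
  rewrite /g indicE; case: (x \in E n) => /=; last by rewrite !mulr0 powR0 ?gt_eqF.
  by rewrite !mulr1 -powRrM q1r.
have wg x : w x * g x = w x `^ q * \1_(E n) x.
  rewrite /g mulrA; congr (_ * _).
  have := w0 x; rewrite le_eqVlt => /predU1P[<-|wx0]; first by rewrite mul0r powR0// gt_eqF.
  by rewrite -{1}[w x]powRr1// -powRD ?(gt_eqF wx0) ?implybT// addrC subrK.
set I := (\int[mu]_x _)%E.
have I0 : (0 <= I)%E by apply: integral_ge0 => x _; rewrite lee_fin mulr_ge0 ?powR_ge0.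
have Ifin : I \is a fin_num.
  rewrite ge0_fin_numE//; apply: (@le_lt_trans _ _ (\int[mu]_x ((n%:R `^ q)%:E * (\1_(F n) x)%:E))%E).
    apply: ge0_le_integral => //.
    - by move=> x _; rewrite lee_fin mulr_ge0 ?powR_ge0.
    - by under eq_fun do rewrite -gr; apply/measurable_EFinP; exact: measurable_powR_comp.
    - by apply: measurable_funeM; apply/measurable_EFinP; apply: measurable_indic; case: (mF n).
    move=> x _; rewrite -EFinM lee_fin !indicE.
    have [/set_mem[Fx wx]|_] := boolP (x \in E n); last by rewrite mulr0 mulr_ge0 ?powR_ge0.
    by rewrite mem_set// !mulr1 ge0_ler_powR ?nnegrE// ltW.
  rewrite ge0_integralZl_EFin ?powR_ge0//; last first.
    by apply/measurable_EFinP; apply: measurable_indic; case: (mF n).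
  have [mFn Foo] := mF n.
  by rewrite integral_indic// setIT lte_mul_pinfty// lee_fin powR_ge0.
have := dual g (fine I) mg g0 (fine_ge0 I0).
rewrite (_ : (\int[mu]_x (g x `^ r)%:E)%E = I); last by apply: eq_integral => x _; rewrite gr.
rewrite (_ : (\int[mu]_x (w x * g x)%:E)%E = I); last by apply: eq_integral => x _; rewrite wg.
rewrite fineK// => /(_ (lexx _)).
rewrite -[X in (X <= _)%E -> _]fineK// -[X in _ -> (X <= _)%E]fineK// !lee_fin.
move: (fine_ge0 I0); move: (fine I) => i i0 ile.
move: i0 ile; rewrite le_eqVlt => /predU1P[<- _|i0 ile]; first exact: powR_ge0.
(* Divide i <= C i^(1/r) by i^(1/r). *)
have : i `^ q^-1 <= C.
  rewrite -(ler_pM2r (powR_gt0 r^-1 i0)); apply: le_trans ile.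
  by rewrite -powRD ?(gt_eqF i0) ?implybT// qr powRr1// ltW.
move=> h; have := ge0_ler_powR (ltW q0) _ _ h.
by rewrite -powRrM mulVf ?(gt_eqF q0)// powRr1 ?(ltW i0)//; apply; rewrite nnegrE ?powR_ge0.
Qed.

Section modulus.
Context (R : realType).
Implicit Types z : R[i].
Local Notation Re := complex.Re.
Local Notation Im := complex.Im.

Lemma modulusE z : modulus z = Num.sqrt (Re z ^+ 2 + Im z ^+ 2).
Proof. by rewrite /modulus normc_def. Qed.

Lemma modulus_ge0 z : 0 <= modulus z.
Proof. by rewrite modulusE sqrtr_ge0. Qed.

Lemma abs_Re_le z : `|Re z| <= modulus z.
Proof. by rewrite modulusE -sqrtr_sqr ler_wsqrtr// lerDl sqr_ge0. Qed.

Lemma abs_Im_le z : `|Im z| <= modulus z.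
Proof. by rewrite modulusE -sqrtr_sqr ler_wsqrtr// lerDr sqr_ge0. Qed.

Lemma modulus_le z (h : R) : `|Re z| <= h -> `|Im z| <= h -> modulus z <= 2 * h.
Proof.
move=> h1 h2; have h0 : 0 <= h by exact: le_trans h1.
rewrite modulusE -[leRHS]ger0_norm ?mulr_ge0// -sqrtr_sqr ler_wsqrtr//.
have {}h1 : Re z ^+ 2 <= h ^+ 2 by rewrite -[leLHS]real_normK ?num_real// lerXn2r ?nnegrE.
have {}h2 : Im z ^+ 2 <= h ^+ 2 by rewrite -[leLHS]real_normK ?num_real// lerXn2r ?nnegrE.
rewrite exprMn; have := sqr_ge0 h; lra.
Qed.

Lemma measurable_modulus d (f : rspace R d -> R[i]) : cmeasurable f ->
  measurable_fun setT (fun x => modulus (f x)).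
Proof.
move=> [mr mi]; under eq_fun do rewrite modulusE.
apply: measurableT_comp; first by apply: continuous_measurable_fun; exact: sqrt_continuous.
by apply: measurable_funD; exact: measurable_funX.
Qed.

Lemma wLnormE d (c p : R) (f : rspace R d -> R[i]) : cmeasurable f -> 0 < p ->
  (wLnorm c p f = (\int[leb d]_x (modulus (f x) `^ p * enorm x `^ c)%:E) `^ p^-1)%E.
Proof.
move=> mf p0; rewrite /wLnorm unlock /=; congr (_ `^ _)%E.
rewrite (@ge0_integral_density _ _ R (leb d) (wleb d c) (fun x => enorm x `^ c)).
- by apply: eq_integral => x _; rewrite ger0_norm ?modulus_ge0.
- exact: measurable_powR_comp (@measurable_enorm R d).
- by move=> x; exact: powR_ge0.
- by [].
- apply/measurable_EFinP; apply: measurable_powR_comp; apply: measurableT_comp => //.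
  exact: measurable_modulus.
by move=> x; rewrite lee_fin powR_ge0.
Qed.

End modulus.

(** * Hermite functions in weighted Lebesgue spaces *)

Section hermite_integrability.
Context (R : realType).
Local Notation L := (@lebesgue_measure R).

Lemma hermite_fun1_decay n : exists2 C : R, 0 <= C & forall s : R, `|hermite_fun1 n s| <= C * expR (- (4^-1 * s ^+ 2)).
Proof.
have q0 : 0 < 4^-1 :> R by rewrite invr_gt0.
have [C C0 pC] := poly_gauss_bound (hermite R n) q0.
pose a : R := (Num.sqrt (Num.sqrt pi * 2 ^+ n * (n`!)%:R))^-1.
have a0 : 0 <= a by rewrite invr_ge0 sqrtr_ge0.
exists (a * C) => [|s]; first exact: mulr_ge0.
have E : expR (- (s ^+ 2 / 2)) = expR (- (4^-1 * s ^+ 2)) * expR (- (4^-1 * s ^+ 2)).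
  by rewrite -expRD; congr expR; field.
rewrite /hermite_fun1 -/a E !normrM (ger0_norm a0) (ger0_norm (expR_ge0 _)).
by rewrite -!(mulrA a) ler_wpM2l// mulrA ler_wpM2r ?expR_ge0.
Qed.

Lemma integrable_hermite_fun1_weight n (r e N A : R) (W : R -> R) : 0 < r -> 0 < e -> 0 <= N -> 0 <= A ->
  measurable_fun setT W -> (forall s, 0 <= W s) ->
  (forall s, `|s| <= 1 -> W s <= A * `|s| `^ (e - 1)) ->
  (forall s, 1 <= `|s| -> W s <= A * `|s| `^ N) ->
  L.-integrable setT (EFin \o (fun s => `|hermite_fun1 n s| `^ r * W s)).
Proof.
move=> r0 e0 N0 A0 mW W0 near far.
have [C C0 hC] := hermite_fun1_decay n.
have r4 : 0 < r / 4 by rewrite divr_gt0.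
(* The exponential bound is applied in the variable s^2: |s|^N s^2 is its power N/2 + 1. *)
have N1 : 0 <= N / 2 + 1 by rewrite addr_ge0// divr_ge0.
have [B B0 HB] := powR_expR_bound N1 r4.
have hr s : `|hermite_fun1 n s| `^ r <= C `^ r * expR (- (r / 4 * s ^+ 2)).
  apply: (@le_trans _ _ ((C * expR (- (4^-1 * s ^+ 2))) `^ r)).
    by rewrite ge0_ler_powR ?nnegrE ?mulr_ge0 ?expR_ge0// ltW.
  rewrite powRM ?expR_ge0// [X in _ * X <= _]powR_expR_ln ?expR_gt0// expRK.
  by rewrite (_ : r * - (4^-1 * s ^+ 2) = - (r / 4 * s ^+ 2))//; field.
have Cr0 : 0 <= C `^ r by exact: powR_ge0.
have f0 s : 0 <= `|hermite_fun1 n s| `^ r * W s by rewrite mulr_ge0 ?powR_ge0.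
apply: (@integrable_decay _ _ e (C `^ r * A * Num.max 1 B) e0).
- apply: measurable_funM => //; apply: measurable_powR_comp.
  by apply: measurableT_comp => //; exact: measurable_hermite_fun1.
- move=> s s1; rewrite ger0_norm// -2!mulrA; apply: ler_pM; rewrite ?powR_ge0//.
    apply: le_trans (hr s) _; rewrite ler_piMr// expR_le1 oppr_le0.
    by rewrite (mulr_ge0 (ltW r4) (sqr_ge0 s)).
  apply: le_trans (near s s1) _; rewrite ler_wpM2l// ler_peMl ?powR_ge0//.
  by rewrite le_max lexx.
- move=> s s1; rewrite ger0_norm//.
  have s0 : 0 < s ^+ 2 by rewrite -real_normK ?num_real// exprn_gt0// (lt_le_trans ltr01).
  rewrite ler_pdivlMr//.
  apply: (@le_trans _ _ (C `^ r * expR (- (r / 4 * s ^+ 2)) * (A * `|s| `^ N) * s ^+ 2)).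
    by rewrite (ler_wpM2r (ltW s0))// ler_pM ?powR_ge0// far.
  have -> : C `^ r * expR (- (r / 4 * s ^+ 2)) * (A * `|s| `^ N) * s ^+ 2 =
    C `^ r * A * (`|s| `^ N * s ^+ 2 * expR (- (r / 4 * s ^+ 2))) by ring.
  rewrite ler_wpM2l ?mulr_ge0// le_max; apply/orP; right.
  apply: le_trans (HB (s ^+ 2) s0).
  have -> : `|s| `^ N = (s ^+ 2) `^ (N / 2).
    by rewrite -real_normK ?num_real// -powR_mulrn// -powRrM; congr (_ `^ _); field.
  by rewrite powRD ?(gt_eqF s0) ?implybT// powRr1// ltW.
Qed.

Lemma le_prod1D (I : Type) (s : seq I) (a : I -> R) : (forall i, 0 <= a i) ->
  1 + \sum_(i <- s) a i <= \prod_(i <- s) (1 + a i).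
Proof.
move=> a0; elim: s => [|i s IH]; first by rewrite !big_nil addr0.
rewrite !big_cons; have S0 : 0 <= \sum_(j <- s) a j by exact: sumr_ge0.
apply: (@le_trans _ _ ((1 + a i) * (1 + \sum_(j <- s) a j))); last first.
  by rewrite ler_wpM2l// addr_ge0.
by have := mulr_ge0 (a0 i) S0; rewrite mulrDr mulr1 mulrDl mul1r; lra.
Qed.

Context (d : nat).
Hypothesis d_gt0 : (0 < d)%N.

Lemma powR_prod (I : Type) (s : seq I) (a : I -> R) (c : R) : (forall i, 0 <= a i) ->
  (\prod_(i <- s) a i) `^ c = \prod_(i <- s) a i `^ c.
Proof.
move=> a0; elim: s => [|i s IH]; first by rewrite !big_nil powR1.
by rewrite !big_cons powRM ?IH// prodr_ge0.
Qed.

Lemma enorm_powR_le (c : R) (x : rspace R d) : 0 <= c -> enorm x `^ c <= \prod_(i < d) (1 + `|tnth x i|) `^ c.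
Proof.
move=> c0; rewrite -powR_prod => [|i]; last by rewrite addr_ge0.
have P0 : 0 <= \prod_(i < d) (1 + `|tnth x i|) by apply: prodr_ge0 => i _; rewrite addr_ge0.
rewrite ge0_ler_powR ?nnegrE ?sqrtr_ge0// -ler_sqr ?nnegrE ?sqrtr_ge0//.
rewrite sqr_sqrtr; last by apply: sumr_ge0 => i _; exact: sqr_ge0.
apply: (@le_trans _ _ (1 + \sum_(i < d) tnth x i ^+ 2)); first by rewrite lerDr.
apply: le_trans (le_prod1D _ (fun i => sqr_ge0 (tnth x i))) _.
rewrite -prodrXl; apply: ler_prod => i _; rewrite addr_ge0 ?sqr_ge0//=.
by rewrite -[tnth x i ^+ 2]real_normK ?num_real// sqrrD expr1n mul1r lerD2r lerDl mulrn_wge0.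
Qed.

Lemma ae_forall_ord (P : 'I_d -> rspace R d -> Prop) :
  (forall i, {ae leb d, forall x, P i x}) -> {ae leb d, forall x, forall i, P i x}.
Proof.
move=> aeP; have := @ae_foralln _ _ R (leb d) (fun n x => forall i : 'I_d, i = n :> nat -> P i x).
have aeP' n : {ae leb d, forall x, forall i : 'I_d, i = n :> nat -> P i x}.
  have [nd|dn] := ltnP n d; last first.
    by apply: aeW => x i ni; move: (ltn_ord i); rewrite ni ltnNge dn.
  apply: filterS (aeP (Ordinal nd)) => x hx i ni.
  by have -> : i = Ordinal nd by exact: val_inj.
by move=> /(_ aeP'); apply: filterS => x hx i; exact: hx.
Qed.

Lemma measurable_hermite_fun (k : d.-tuple nat) : measurable_fun setT (@hermite_fun R d k).
Proof. exact: (measurable_prod_fun (fun i => @measurable_hermite_fun1 R (tnth k i))). Qed.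

(** The weight is bounded by a product over the coordinates, of |x_i|^(c/d) with c/d > -1 when c < 0
    and of (1 + |x_i|)^c otherwise, and the integral factors. This makes Hermite functions
    admissible test functions in the dual weighted spaces. *)
Lemma integral_hermite_fun_weight (k : d.-tuple nat) (r c : R) : 0 < r -> - d%:R < c ->
  exists2 B : R, 0 <= B & (\int[leb d]_x (`|hermite_fun k x| `^ r * enorm x `^ c)%:E <= B%:E)%E.
Proof.
move=> r0 cd; have dR0 : 0 < d%:R :> R by rewrite ltr0n.
suff [W [mW W0 iW leW]] : exists W : R -> R, [/\ measurable_fun setT W, forall s, 0 <= W s,
    forall n, L.-integrable setT (EFin \o (fun s => `|hermite_fun1 n s| `^ r * W s)) &
    {ae leb d, forall x, enorm x `^ c <= \prod_(i < d) W (tnth x i)}].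
  pose phi (i : 'I_d) s := `|hermite_fun1 (tnth k i) s| `^ r * W s.
  have phi0 i s : 0 <= phi i s by rewrite mulr_ge0 ?powR_ge0.
  have mphi i : measurable_fun setT (phi i).
    apply: measurable_funM => //; apply: measurable_powR_comp.
    by apply: measurableT_comp => //; exact: measurable_hermite_fun1.
  have E i : (\int[L]_s (phi i s)%:E = (fine (\int[L]_s (phi i s)%:E))%:E)%E.
    by rewrite fineK//; apply: integrable_fin_num => //; exact: iW.
  exists (\prod_(i < d) fine (\int[L]_s (phi i s)%:E)%E).
    by apply: prodr_ge0 => i _; apply: fine_ge0; apply: integral_ge0 => s _; rewrite lee_fin.
  rewrite -(ge0_integral_prod mphi phi0 E).
  apply: ae_ge0_le_integral => //.
  - by move=> x _; rewrite lee_fin mulr_ge0 ?powR_ge0.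
  - apply/measurable_EFinP; apply: measurable_funM; apply: measurable_powR_comp; last exact: measurable_enorm.
    by apply: measurableT_comp => //; exact: measurable_hermite_fun.
  - by move=> x _; rewrite lee_fin; apply: prodr_ge0.
  - by apply/measurable_EFinP; exact: measurable_prod_fun.
  apply: filterS leW => x hx _; rewrite lee_fin /prod_fun big_split/=.
  apply: ler_pM; rewrite ?powR_ge0//.
  by rewrite /hermite_fun normr_prod powR_prod.
have [c0|c0] := ltP c 0.
  exists (fun s => `|s| `^ (c / d%:R)); split.
  - by apply: measurable_powR_comp; exact: normr_measurable.
  - by move=> s; exact: powR_ge0.
  - move=> n; apply: (@integrable_hermite_fun1_weight n r (c / d%:R + 1) 0 1) => //.
    + by rewrite -ltrBlDr sub0r ltr_pdivlMr// mulN1r.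
    + by apply: measurable_powR_comp; exact: normr_measurable.
    + by move=> s s1; rewrite mul1r addrK.
    + move=> s s1; have := @lepowRN R (- (c / d%:R)) 1 `|s|.
      rewrite opprK powR1 powRr0 mulr1; apply => //.
      by rewrite oppr_ge0 ltW// pmulr_llt0 ?invr_gt0.
  have : {ae leb d, forall x : rspace R d, forall i : 'I_d, tnth x i != 0}.
    by apply: ae_forall_ord => i; exact: ae_tnth_neq.
  apply: filterS => x hx; rewrite -[c]opprK.
  apply: (le_trans (@powRN_le_prod R d d_gt0 (- c) (enorm x) (fun i => `|tnth x i|) _ _ _)) => //.
  - by rewrite oppr_ge0 ltW.
  - by move=> i; rewrite normr_gt0.
  - by move=> i; exact: le_enorm.
  by rewrite le_eqVlt; apply/orP; left; apply/eqP; apply: eq_bigr => i _; rewrite mulNr !opprK.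
exists (fun s => (1 + `|s|) `^ c); split.
- by apply: measurable_powR_comp; apply: measurable_funD => //; exact: normr_measurable.
- by move=> s; exact: powR_ge0.
- move=> n; apply: (@integrable_hermite_fun1_weight n r 1 c (2 `^ c)) => //.
  + by apply: measurable_powR_comp; apply: measurable_funD => //; exact: normr_measurable.
  + move=> s s1; rewrite subrr powRr0 mulr1 ge0_ler_powR ?nnegrE ?addr_ge0//; lra.
  + move=> s s1; rewrite -powRM// ge0_ler_powR ?nnegrE ?addr_ge0 ?mulr_ge0//; lra.
by apply: aeW => x; exact: enorm_powR_le.
Qed.

End hermite_integrability.

Section exponents.
Context (R : realType).
Implicit Types p q r a b D : R.

Lemma exponent_facts p q r : 1 < p -> p <= q -> q^-1 + r^-1 = 1 ->
  [/\ 0 < p, 1 < q, 0 < r, p^-1 < 1 & q^-1 <= p^-1 ].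
Proof.
move=> p1 pq qr.
have p0 : 0 < p by exact: lt_trans p1.
have q1 : 1 < q by exact: lt_le_trans pq.
have q0 : 0 < q by exact: lt_trans q1.
split => //.
- have qi1 : q^-1 < 1 by rewrite invf_lt1.
  by rewrite -invr_gt0; move: qr qi1; lra.
- by rewrite invf_lt1.
- by rewrite lef_pV2 ?posrE.
Qed.

(** b >= -a > -D (1 - 1/p) >= -D (1 - 1/q) = -D/r. Hence the weight |x|^(br) of the dual norm is
    locally integrable. *)
Lemma weight_index_gt p q r a b D : 0 < D -> 1 < p -> p <= q -> q^-1 + r^-1 = 1 -> 0 <= a + b ->
  a < D * (1 - p^-1) -> - D < b * r.
Proof.
move=> D0 p1 pq qr ab ap; have [p0 q1 r0 pi1 qpi] := exponent_facts p1 pq qr.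
have rE : r^-1 = 1 - q^-1 by move: qr; lra.
rewrite -ltr_pdivrMr// rE.
have : D * (1 - p^-1) <= D * (1 - q^-1) by rewrite ler_wpM2l ?(ltW D0)// lerD2l lerN2.
by move: ap ab; rewrite !mulrBr mulr1 mulNr mulr1; lra.
Qed.

(** Equality fails at [e = 0], where the product is 0 unless x = 0. *)
Lemma powRN_mul_le1 (e x : R) : e `^ (- x) * e `^ x <= 1.
Proof.
have [->|x0] := eqVneq x 0; first by rewrite oppr0 !powRr0 mulr1.
have [e0|e0] := eqVneq (e `^ x) 0; first by rewrite e0 mulr0.
by rewrite powRN mulVf.
Qed.

Lemma powR_weightK (x e a p : R) : 0 <= x -> 0 < p -> (x `^ p * e `^ (a * p)) `^ p^-1 = x * e `^ a.
Proof.
move=> x0 p0; rewrite powRM ?powR_ge0// -!powRrM mulfV ?(gt_eqF p0)// powRr1//.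
by rewrite -mulrA mulfV ?(gt_eqF p0)// mulr1.
Qed.

End exponents.

(** * The potential of real functions on weighted Lebesgue spaces *)

Section weighted_estimate.
Context (R : realType) (d : nat) (sigma : R).
Hypotheses (d_gt0 : (0 < d)%N) (sigma_gt0 : 0 < sigma).
Local Notation T := (rspace R d).
Local Notation K := (@potential_kernel R d sigma).

Let dR0 : 0 < d%:R :> R.
Proof. by rewrite ltr0n. Qed.

Lemma potential_kernel_fineK (z : T * T) : generic z -> K z.1 z.2 = (fine_kernel sigma z)%:E.
Proof.
move=> gz; have d2 : 0 < d%:R / 2 :> R by rewrite divr_gt0.
(* The index s = 0 is admissible for every positive sigma; only finiteness matters here. *)
have [C C0 h] := potential_kernel_le d_gt0 sigma_gt0 (ltW sigma_gt0) d2.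
have {}h := h z.1 z.2 (generic_sqdist_gt0 d_gt0 gz).
rewrite /fine_kernel fineK// ge0_fin_numE; last exact: potential_kernel_ge0.
by apply: le_lt_trans h _; rewrite ltry.
Qed.

Lemma generic_enorm_gt0 (z : T * T) : generic z -> 0 < enorm z.1 /\ 0 < enorm z.2.
Proof.
move=> gz; have i0 : 'I_d by exact: Ordinal d_gt0.
have [h1 h2 _] := gz i0.
by split; apply: lt_le_trans (le_enorm _ i0); rewrite normr_gt0.
Qed.

Lemma measurable_potential_kernel2 (x : T) : measurable_fun setT (K x).
Proof.
have mp : measurable_fun setT (fun y : T => (x, y)).
  by apply: measurable_fun_pair; [exact: measurable_cst|exact: measurable_id].
exact: (measurableT_comp (@measurable_potential_kernel R d sigma) mp).
Qed.

Section real_potential.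
Implicit Types F phi : T -> R.

Definition kernel_fun phi (z : T * T) : \bar R := (K z.1 z.2 * (phi z.2)%:E)%E.

Lemma measurable_kernel_fun phi : measurable_fun setT phi -> measurable_fun setT (kernel_fun phi).
Proof.
move=> mphi; apply: emeasurable_funM; first exact: measurable_potential_kernel.
by apply/measurable_EFinP; exact: (measurableT_comp mphi measurable_snd).
Qed.

Lemma kernel_fun_ge0 F z : (forall y, 0 <= F y) -> (0 <= kernel_fun F z)%E.
Proof. by move=> F0; rewrite mule_ge0 ?potential_kernel_ge0// lee_fin. Qed.

Definition rpot phi (x : T) : \bar R := (\int[leb d]_y kernel_fun phi (x, y))%E.

Lemma rpot_ge0 F x : (forall y, 0 <= F y) -> (0 <= rpot F x)%E.
Proof. by move=> F0; apply: integral_ge0 => y _; exact: kernel_fun_ge0. Qed.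

Lemma measurable_ge0_rpot F : measurable_fun setT F -> (forall y, 0 <= F y) ->
  measurable_fun setT (rpot F).
Proof.
move=> mF F0; apply: (@measurable_fun_fubini_tonelli_F _ _ T T R (leb d) (kernel_fun F)).
  exact: measurable_kernel_fun.
by move=> z; exact: kernel_fun_ge0.
Qed.

(** No integrability is assumed: the integral is by definition the difference of the integrals of
    the positive and negative parts, each measurable in x by Tonelli. *)
Lemma measurable_rpot phi : measurable_fun setT phi -> measurable_fun setT (rpot phi).
Proof.
move=> mphi; have mk := measurable_kernel_fun mphi.
rewrite (_ : rpot phi = fun x => (\int[leb d]_y (kernel_fun phi)^\+ (x, y) - \int[leb d]_y (kernel_fun phi)^\- (x, y))%E); last first.
  apply/funext => x; rewrite /rpot integralE.
  under eq_integral do rewrite funepos_comp/=.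
  by under [X in (_ - X)%E = _]eq_integral do rewrite funeneg_comp/=.
have mP := measurable_funepos mk.
have mN := measurable_funeneg mk.
apply: emeasurable_funB.
- exact: (@measurable_fun_fubini_tonelli_F _ _ T T R (leb d) _ mP (fun z => funepos_ge0 _ z)).
- exact: (@measurable_fun_fubini_tonelli_F _ _ T T R (leb d) _ mN (fun z => funeneg_ge0 _ z)).
Qed.

Lemma abse_kernel_fun phi z : (`|kernel_fun phi z| = K z.1 z.2 * `|phi z.2|%:E)%E.
Proof. by rewrite /kernel_fun abseM gee0_abs// potential_kernel_ge0. Qed.

Lemma abse_kernel_fun_le phi F z : (forall y, `|phi y| <= F y) -> (`|kernel_fun phi z| <= kernel_fun F z)%E.
Proof.
by move=> h; rewrite abse_kernel_fun lee_wpmul2l ?potential_kernel_ge0// lee_fin.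
Qed.

Lemma integrable_kernel_fun phi F x : measurable_fun setT phi -> measurable_fun setT F ->
  (forall y, `|phi y| <= F y) -> (rpot F x < +oo)%E ->
  (leb d).-integrable setT (fun y => kernel_fun phi (x, y)).
Proof.
move=> mphi mF h oo.
have m psi : measurable_fun setT psi -> measurable_fun setT (fun y => kernel_fun psi (x, y)).
  move=> mpsi; apply: emeasurable_funM; first exact: measurable_potential_kernel2.
  exact/measurable_EFinP.
have F0 y : 0 <= F y by apply: le_trans (h y).
apply/integrableP; split; first exact: m.
apply: le_lt_trans oo; apply: ge0_le_integral => //.
- by apply: measurableT_comp => //; exact: m.
- exact: m.
- by move=> y _; exact: abse_kernel_fun_le.
Qed.

Lemma fine_rpot_le phi F x : measurable_fun setT phi -> measurable_fun setT F ->
  (forall y, `|phi y| <= F y) -> (rpot F x < +oo)%E -> `|fine (rpot phi x)| <= fine (rpot F x).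
Proof.
move=> mphi mF h oo.
have F0 y : 0 <= F y by apply: le_trans (h y).
have i1 := integrable_kernel_fun mphi mF h oo.
have f1 : rpot phi x \is a fin_num by exact: integrable_fin_num i1.
have f2 : rpot F x \is a fin_num by rewrite ge0_fin_numE ?rpot_ge0.
rewrite -lee_fin -abse_EFin !fineK//.
have m psi : measurable_fun setT psi -> measurable_fun setT (fun y => kernel_fun psi (x, y)).
  move=> mpsi; apply: emeasurable_funM; first exact: measurable_potential_kernel2.
  exact/measurable_EFinP.
apply: le_trans (le_abse_integral _ _ _) _ => //; first exact: m.
apply: ge0_le_integral => //.
- by apply: measurableT_comp => //; exact: m.
- exact: m.
- by move=> y _; exact: abse_kernel_fun_le.
Qed.

End real_potential.

Section estimate.
Variables (p q r a b : R).
Hypotheses (p1 : 1 < p) (pq : p <= q) (qr : q^-1 + r^-1 = 1) (ab : 0 <= a + b)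
  (ap : a < d%:R * (1 - p^-1)) (bq : b < d%:R / q)
  (ss : (d%:R * (p^-1 - q^-1) + a + b) / 2 <= sigma).

(** The densities F^p |y|^(ap) and G^r |x|^(br) have the powers F |y|^a and G |x|^b, whose weights
    cancel those of the weighted kernel almost everywhere. *)
Lemma weighted_bilinear : exists2 C : R, 0 <= C & forall (F G : T -> R) (A B : R),
  measurable_fun setT F -> measurable_fun setT G -> (forall x, 0 <= F x) -> (forall x, 0 <= G x) ->
  0 <= A -> 0 <= B ->
  (\int[leb d]_x (F x `^ p * enorm x `^ (a * p))%:E <= A%:E)%E ->
  (\int[leb d]_x (G x `^ r * enorm x `^ (b * r))%:E <= B%:E)%E ->
  (\int[leb d \x leb d]_z (kernel_fun F z * (G z.1)%:E) <= (C * A `^ p^-1 * B `^ r^-1)%:E)%E.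
Proof.
have [p0 q1 r0 pi1 qpi] := exponent_facts p1 pq qr.
have q0 : 0 < q by exact: lt_trans q1.
have pi0 : 0 < p^-1 by rewrite invr_gt0.
have qi0 : 0 < q^-1 by rewrite invr_gt0.
have ri0 : 0 < r^-1 by rewrite invr_gt0.
have rE : r^-1 = 1 - q^-1 by rewrite -qr addrAC subrr add0r.
have [||||C C0 H] := @potential_bilinear R d sigma d_gt0 sigma_gt0 p^-1 r^-1 a b pi1 _ _ ab ap.
- by rewrite rE gtrBl.
- by rewrite rE addrCA lerDl subr_ge0.
- by rewrite rE opprB addrC subrK.
- by have -> : p^-1 + r^-1 - 1 = p^-1 - q^-1 by rewrite rE; ring.
exists C => // F G A B mF mG F0 G0 A0 B0 HA HB.
have mfk := @measurable_fine_kernel R d sigma.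
have fk0 (z : T * T) := fine_kernel_ge0 sigma_gt0 z.
have mk := measurable_weighted_kernel a b mfk.
have k0 z := weighted_kernel_ge0 a b z fk0.
pose u x := F x `^ p * enorm x `^ (a * p).
pose v x := G x `^ r * enorm x `^ (b * r).
have men c : measurable_fun setT (fun x : T => enorm x `^ c).
  by apply: measurable_powR_comp; exact: measurable_enorm.
have mu_ : measurable_fun setT u by apply: measurable_funM => //; exact: measurable_powR_comp.
have mv : measurable_fun setT v by apply: measurable_funM => //; exact: measurable_powR_comp.
have u0 x : 0 <= u x by rewrite mulr_ge0 ?powR_ge0.
have v0 x : 0 <= v x by rewrite mulr_ge0 ?powR_ge0.
apply: le_trans (bilinear_bound_homogeneous mk k0 pi0 ri0 C0 H mu_ mv u0 v0 A0 B0 HA HB).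
apply: ae_ge0_le_integral => //.
- by move=> z _; rewrite mule_ge0 ?kernel_fun_ge0// lee_fin.
- apply: emeasurable_funM; first exact: measurable_kernel_fun.
  by apply/measurable_EFinP; exact: (measurableT_comp mG measurable_fst).
- by move=> z _; rewrite lee_fin !mulr_ge0 ?powR_ge0.
- exact: (measurable_EFin_integrand p^-1 r^-1 mk mu_ mv).
apply: filterS (@ae_generic R d) => z gz _.
have [e1 e2] := generic_enorm_gt0 gz.
rewrite /kernel_fun potential_kernel_fineK// -!EFinM lee_fin.
have uE : u z.2 `^ p^-1 = F z.2 * enorm z.2 `^ a by exact: powR_weightK.
have vE : v z.1 `^ r^-1 = G z.1 * enorm z.1 `^ b by exact: powR_weightK.
rewrite uE vE /weighted_kernel !powRN le_eqVlt; apply/orP; left; apply/eqP.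
have p1' := powR_gt0 b e1; have p2' := powR_gt0 a e2.
move: (enorm z.1 `^ b) (enorm z.2 `^ a) p1' p2' => eb ea eb0 ea0.
by field; rewrite !gt_eqF.
Qed.

Lemma weighted_rpot : exists2 C : R, 0 <= C & forall (F G : T -> R) (A B : R),
  measurable_fun setT F -> measurable_fun setT G -> (forall x, 0 <= F x) -> (forall x, 0 <= G x) ->
  0 <= A -> 0 <= B ->
  (\int[leb d]_x (F x `^ p * enorm x `^ (a * p))%:E <= A%:E)%E ->
  (\int[leb d]_x (G x `^ r * enorm x `^ (b * r))%:E <= B%:E)%E ->
  (\int[leb d]_x (rpot F x * (G x)%:E) <= (C * A `^ p^-1 * B `^ r^-1)%:E)%E.
Proof.
have [C C0 H] := weighted_bilinear; exists C => // F G A B mF mG F0 G0 A0 B0 HA HB.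
apply: le_trans (H F G A B mF mG F0 G0 A0 B0 HA HB).
rewrite fubini_tonelli1; last 2 first.
- apply: emeasurable_funM; first exact: measurable_kernel_fun.
  by apply/measurable_EFinP; exact: (measurableT_comp mG measurable_fst).
- by move=> z; rewrite mule_ge0 ?kernel_fun_ge0// lee_fin.
rewrite le_eqVlt; apply/orP; left; apply/eqP; apply: eq_integral => x _; rewrite /fubini_F/=.
under eq_integral do rewrite muleC.
rewrite ge0_integralZl//; last 3 first.
- apply: emeasurable_funM; first exact: measurable_potential_kernel2.
  exact/measurable_EFinP.
- by move=> y _; exact: kernel_fun_ge0.
- by rewrite lee_fin.
by rewrite muleC.
Qed.

(** Test with the ground state h_0, a Gaussian: it is strictly positive and lies in the dual space,
    so the finite pairing forces the potential to be finite almost everywhere. *)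
Lemma rpot_lty (F : T -> R) (A : R) : measurable_fun setT F -> (forall x, 0 <= F x) -> 0 <= A ->
  (\int[leb d]_x (F x `^ p * enorm x `^ (a * p))%:E <= A%:E)%E ->
  {ae leb d, forall x, (rpot F x < +oo)%E}.
Proof.
move=> mF F0 A0 HA; have [p0 q1 r0 pi1 qpi] := exponent_facts p1 pq qr.
have [C C0 H] := weighted_rpot.
pose k0 : d.-tuple nat := [tuple 0%N | i < d].
have [B B0 HB] := integral_hermite_fun_weight d_gt0 k0 r0 (weight_index_gt dR0 p1 pq qr ab ap).
pose G x := `|@hermite_fun R d k0 x|.
have G0 x : 0 < G x.
  rewrite normr_gt0; apply/prodf_neq0 => i _; rewrite tnth_mktuple /hermite_fun1 gt_eqF//.
  rewrite !mulr_gt0 ?expR_gt0// ?invr_gt0 ?sqrtr_gt0.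
    by rewrite mulr1 mulr1 sqrtr_gt0 pi_gt0.
  by rewrite hornerC.
have mG : measurable_fun setT G by apply: measurableT_comp => //; exact: measurable_hermite_fun.
have := H F G A B mF mG F0 (fun x => ltW (G0 x)) A0 B0 HA HB => {}H.
have mr := measurable_ge0_rpot mF F0.
have i : (leb d).-integrable setT (fun x => rpot F x * (G x)%:E)%E.
  apply/integrableP; split; first by apply: emeasurable_funM => //; exact/measurable_EFinP.
  under eq_integral do rewrite gee0_abs ?mule_ge0 ?rpot_ge0 ?lee_fin ?(ltW (G0 _))//.
  by apply: le_lt_trans H _; rewrite ltry.
apply: filterS (integrable_ae measurableT i) => x /(_ I).
have := rpot_ge0 x F0; case: (rpot F x) => [s|//|//]; first by rewrite ltry.
by rewrite gt0_mulye// lte_fin.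
Qed.

Lemma rpot_Lq : exists2 C : R, 0 <= C & forall (F : T -> R) (A : R), measurable_fun setT F ->
  (forall x, 0 <= F x) -> 0 <= A ->
  (\int[leb d]_x (F x `^ p * enorm x `^ (a * p))%:E <= A%:E)%E ->
  (\int[leb d]_x (fine (rpot F x) `^ q * enorm x `^ (- (b * q)))%:E <= ((C * A `^ p^-1) `^ q)%:E)%E.
Proof.
have [p0 q1 r0 pi1 qpi] := exponent_facts p1 pq qr.
have [C C0 H] := weighted_rpot; exists C => // F A mF F0 A0 HA.
have mr := measurable_ge0_rpot mF F0.
have fr0 x : 0 <= fine (rpot F x) by apply: fine_ge0; exact: rpot_ge0.
pose w x := fine (rpot F x) * enorm x `^ (- b).
have men c : measurable_fun setT (fun x : T => enorm x `^ c).
  by apply: measurable_powR_comp; exact: measurable_enorm.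
have mw : measurable_fun setT w.
  by apply: measurable_funM => //; exact: (measurableT_comp (fine_measurable measurableT) mr).
have w0 x : 0 <= w x by rewrite mulr_ge0 ?powR_ge0.
have D := @dual_bound _ T R (leb d) w q r (C * A `^ p^-1) mw w0 q1 qr (mulr_ge0 C0 (powR_ge0 _ _)).
rewrite (eq_integral (fun x => (w x `^ q)%:E)); last first.
  move=> x _; rewrite /w powRM ?powR_ge0// -powRrM mulNr//.
apply: D => g B mg g0 B0 gB.
(* The factor |x|^-b makes the dual weighted norm of G at most the unweighted norm of g. *)
pose G x := g x * enorm x `^ (- b).
have mG : measurable_fun setT G by exact: measurable_funM.
have G0 x : 0 <= G x by rewrite mulr_ge0 ?powR_ge0.
apply: le_trans (H F G A B mF mG F0 G0 A0 B0 HA _).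
  apply: ge0_le_integral => //.
  - by move=> x _; rewrite lee_fin mulr_ge0.
  - by apply/measurable_EFinP; exact: measurable_funM.
  - by apply: emeasurable_funM => //; exact/measurable_EFinP.
  move=> x _; have := rpot_ge0 x F0; rewrite /w.
  (* Where the potential is infinite, [fine] makes the left-hand side 0. *)
  case: (rpot F x) => [s|//|//] _; first by rewrite /= -EFinM lee_fin /G mulrAC mulrA.
  by rewrite /= !mul0r mule_ge0// ?leey// lee_fin.
apply: le_trans gB; apply: ge0_le_integral => //.
- by move=> x _; rewrite lee_fin mulr_ge0 ?powR_ge0.
- by apply/measurable_EFinP; apply: measurable_funM => //; exact: measurable_powR_comp.
- by apply/measurable_EFinP; exact: measurable_powR_comp.
move=> x _; rewrite lee_fin /G powRM ?powR_ge0// -powRrM mulNr -mulrA.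
by rewrite ler_piMr ?powR_ge0// powRN_mul_le1.
Qed.

End estimate.

End weighted_estimate.

Section potential_bounded.
Context (R : realType) (d : nat) (sigma p q r a b : R).
Hypotheses (d_gt0 : (0 < d)%N) (sigma_gt0 : 0 < sigma).
Hypotheses (p1 : 1 < p) (pq : p <= q) (qr : q^-1 + r^-1 = 1) (ab : 0 <= a + b)
  (ap : a < d%:R * (1 - p^-1)) (bq : b < d%:R / q)
  (ss : (d%:R * (p^-1 - q^-1) + a + b) / 2 <= sigma).
Local Notation T := (rspace R d).
Local Notation K := (@potential_kernel R d sigma).
Local Notation Re := complex.Re.
Local Notation Im := complex.Im.

Lemma in_wLpE (c s : R) (f : T -> R[i]) : 0 < s -> in_wLp c s f ->
  exists2 A, 0 <= A & (\int[leb d]_x (modulus (f x) `^ s * enorm x `^ c)%:E = A%:E)%E /\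
    wLnorm c s f = (A `^ s^-1)%:E.
Proof.
move=> s0 [mf]; rewrite (wLnormE _ mf s0); set I := (\int[_]_x _)%E => Ioo.
have I0 : (0 <= I)%E by apply: integral_ge0 => x _; rewrite lee_fin mulr_ge0 ?powR_ge0.
have {}Ioo : (I < +oo)%E by apply: lty_poweRy Ioo; rewrite invr_neq0// gt_eqF.
have If : I \is a fin_num by rewrite ge0_fin_numE.
exists (fine I); first exact: fine_ge0.
by rewrite fineK//; split => //; rewrite -{1}(fineK If) poweR_EFin.
Qed.

Lemma cmeasurable_potential (f : T -> R[i]) : cmeasurable f -> cmeasurable (potential sigma f).
Proof.
move=> [mr mi]; split.
- rewrite (_ : (fun x => Re (potential sigma f x)) = fine \o rpot sigma (fun y => Re (f y)))//.
  have h : measurable_fun setT (rpot sigma (fun y => Re (f y))) by exact: measurable_rpot.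
  by apply: measurableT_comp h; exact: fine_measurable.
- rewrite (_ : (fun x => Im (potential sigma f x)) = fine \o rpot sigma (fun y => Im (f y)))//.
  have h : measurable_fun setT (rpot sigma (fun y => Im (f y))) by exact: measurable_rpot.
  by apply: measurableT_comp h; exact: fine_measurable.
Qed.

Lemma ae_rpot_modulus_lty (f : T -> R[i]) : in_wLp (a * p) p f ->
  {ae leb d, forall x, (rpot sigma (fun y => modulus (f y)) x < +oo)%E}.
Proof.
move=> hf; have [p0 q1 r0 pi1 qpi] := exponent_facts p1 pq qr.
have [A A0 [HA _]] := in_wLpE p0 hf.
apply: (rpot_lty d_gt0 sigma_gt0 p1 pq qr ab ap bq ss) A0 _.
- exact: measurable_modulus hf.1.
- by move=> x; exact: modulus_ge0.
by rewrite HA.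
Qed.

Lemma potential_domain_wLp (f : T -> R[i]) : in_wLp (a * p) p f -> potential_domain sigma f.
Proof.
move=> hf; have [mr mi] := hf.1; split; first exact: hf.1.
have mF := measurable_modulus hf.1.
apply: filterS (ae_rpot_modulus_lty hf) => x hx; split.
  exact: (integrable_kernel_fun sigma_gt0 mr mF (fun y => abs_Re_le (f y)) hx).
exact: (integrable_kernel_fun sigma_gt0 mi mF (fun y => abs_Im_le (f y)) hx).
Qed.

Lemma ae_modulus_potential_le (f : T -> R[i]) : in_wLp (a * p) p f ->
  {ae leb d, forall x, modulus (potential sigma f x) <= 2 * fine (rpot sigma (fun y => modulus (f y)) x)}.
Proof.
move=> hf; have [mr mi] := hf.1; have mF := measurable_modulus hf.1.
apply: filterS (ae_rpot_modulus_lty hf) => x hx; apply: modulus_le.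
  exact: (fine_rpot_le sigma_gt0 mr mF (fun y => abs_Re_le (f y)) hx).
exact: (fine_rpot_le sigma_gt0 mi mF (fun y => abs_Im_le (f y)) hx).
Qed.

Lemma potential_wLnorm_le : exists2 C : R, 0 <= C & forall f : T -> R[i], in_wLp (a * p) p f ->
  (wLnorm (- (b * q)) q (potential sigma f) <= C%:E * wLnorm (a * p) p f)%E.
Proof.
have [p0 q1 r0 pi1 qpi] := exponent_facts p1 pq qr.
have q0 : 0 < q by exact: lt_trans q1.
have [C C0 H] := rpot_Lq d_gt0 sigma_gt0 p1 pq qr ab ap bq ss.
exists (2 * C) => [|f hf]; first by rewrite mulr_ge0.
have [A A0 [HA ->]] := in_wLpE p0 hf.
have mF := measurable_modulus hf.1.
have F0 x : 0 <= modulus (f x) by exact: modulus_ge0.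
have {}H := H _ A mF F0 A0; rewrite HA lexx in H.
have {}H := H isT.
have mp := cmeasurable_potential hf.1.
rewrite (wLnormE _ mp q0).
have mr := measurable_ge0_rpot sigma_gt0 mF F0.
have men c : measurable_fun setT (fun x : T => enorm x `^ c).
  by apply: measurable_powR_comp; exact: measurable_enorm.
set h := fun x => fine (rpot sigma (fun y => modulus (f y)) x).
have h0 x : 0 <= h x by apply: fine_ge0; exact: rpot_ge0.
have mh : measurable_fun setT h by exact: (measurableT_comp (fine_measurable measurableT) mr).
have q2 : 0 <= 2 `^ q :> R by exact: powR_ge0.
have le : (\int[leb d]_x (modulus (potential sigma f x) `^ q * enorm x `^ (- (b * q)))%:E <=
    ((2 * C * A `^ p^-1) `^ q)%:E)%E.
  apply: (@le_trans _ _ (\int[leb d]_x ((2 `^ q)%:E * (h x `^ q * enorm x `^ (- (b * q)))%:E))%E).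
    apply: ae_ge0_le_integral => //.
    - by move=> x _; rewrite lee_fin mulr_ge0 ?powR_ge0.
    - apply/measurable_EFinP; apply: measurable_funM => //; apply: measurable_powR_comp.
      exact: measurable_modulus.
    - by move=> x _; rewrite -EFinM lee_fin !mulr_ge0 ?powR_ge0.
    - by apply: measurable_funeM; apply/measurable_EFinP; apply: measurable_funM => //; exact: measurable_powR_comp.
    apply: filterS (ae_modulus_potential_le hf) => x hx _.
    rewrite -EFinM lee_fin mulrA ler_wpM2r ?powR_ge0// -powRM//.
    by rewrite ge0_ler_powR ?nnegrE ?modulus_ge0 ?mulr_ge0// ltW.
  rewrite ge0_integralZl_EFin//; last 2 first.
  - by move=> x _; rewrite lee_fin !mulr_ge0 ?powR_ge0.
  - by apply/measurable_EFinP; apply: measurable_funM => //; exact: measurable_powR_comp.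
  rewrite -mulrA powRM ?mulr_ge0 ?powR_ge0// EFinM.
  by apply: lee_wpmul2l; [rewrite lee_fin|exact: H].
have B0 : 0 <= 2 * C * A `^ p^-1 by rewrite !mulr_ge0 ?powR_ge0.
have -> : ((2 * C)%:E * (A `^ p^-1)%:E = (((2 * C * A `^ p^-1) `^ q)%:E) `^ q^-1)%E.
  by rewrite poweR_EFin -powRrM mulfV ?(gt_eqF q0)// powRr1.
apply: gt0_ler_poweR le; rewrite ?invr_ge0 ?(ltW q0)//.
  by rewrite in_itv/= leey andbT; apply: integral_ge0 => x _; rewrite lee_fin mulr_ge0 ?powR_ge0.
by rewrite in_itv/= leey andbT lee_fin powR_ge0.
Qed.

Lemma potential_boundedP : potential_bounded d sigma (a * p) p (- (b * q)) q.
Proof.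
have [p0 q1 r0 pi1 qpi] := exponent_facts p1 pq qr.
have [C C0 H] := potential_wLnorm_le.
split; last by exists C.
move=> f hf; split; first exact: potential_domain_wLp.
split; first exact: cmeasurable_potential hf.1.
apply: le_lt_trans (H f hf) _.
by have [A A0 [_ ->]] := in_wLpE p0 hf; rewrite -EFinM ltry.
Qed.

End potential_bounded.

(** * The potential of a Hermite function *)

Section potential_eigen.
Context (R : realType) (d : nat) (sigma : R).
Hypotheses (d_gt0 : (0 < d)%N) (sigma_gt0 : 0 < sigma).
Local Notation T := (rspace R d).
Local Notation L := (@lebesgue_measure R).
Local Notation K := (@potential_kernel R d sigma).

Lemma hermite_fun_bounded (k : d.-tuple nat) : exists2 C : R, 0 <= C & forall x : T, `|hermite_fun k x| <= C.
Proof.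
have H n : exists C : R, 0 <= C /\ forall s : R, `|hermite_fun1 n s| <= C.
  have [C C0 hC] := hermite_fun1_decay R n; exists C; split => // s.
  apply: le_trans (hC s) _; rewrite ler_piMr// expR_le1 oppr_le0.
  by rewrite (mulr_ge0 _ (sqr_ge0 s))// invr_ge0.
have [B hB] := choice H.
exists (\prod_(i < d) B (tnth k i)) => [|x]; first by apply: prodr_ge0 => i _; have [] := hB (tnth k i).
rewrite /hermite_fun normr_prod; apply: ler_prod => i _; rewrite normr_ge0/=.
by have [_] := hB (tnth k i).
Qed.

Lemma eigenval_gt0 (k : d.-tuple nat) : 0 < eigenval R k.
Proof. by rewrite /eigenval ltr0n addn_gt0 d_gt0 orbT. Qed.

Lemma integral_potential_kernel2 : exists2 C : R, 0 <= C & forall y, (\int[leb d]_x K y x <= C%:E)%E.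
Proof.
have [C C0 h] := integral_potential_kernel d_gt0 sigma_gt0; exists C; first exact: C0.
move=> y; by under eq_integral do rewrite potential_kernelC.
Qed.

(** Hermite functions are bounded and the kernel has uniformly bounded integrals, so finiteness
    holds at every y and not just almost everywhere. *)
Lemma rpot_hermite_fun_lty (k : d.-tuple nat) y :
  (rpot sigma (fun x => `|@hermite_fun R d k x|%R) y < +oo)%E.
Proof.
have [B B0 hB] := hermite_fun_bounded k.
have [C C0 hC] := integral_potential_kernel2.
have mh : measurable_fun setT (fun x : T => `|hermite_fun k x|).
  by apply: measurableT_comp => //; exact: measurable_hermite_fun.
have mK := measurable_potential_kernel2 sigma y.
apply: (@le_lt_trans _ _ (\int[leb d]_x (B%:E * K y x))%E).
  apply: ge0_le_integral => //.
  - by move=> x _; exact: kernel_fun_ge0.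
  - by apply: emeasurable_funM => //; exact/measurable_EFinP.
  - exact: measurable_funeM.
  move=> x _; rewrite /kernel_fun/= muleC.
  by rewrite lee_wpmul2r ?potential_kernel_ge0// lee_fin.
rewrite ge0_integralZl//; last by move=> x _; exact: potential_kernel_ge0.
apply: (@le_lt_trans _ _ (B%:E * C%:E)%E); last by rewrite -EFinM ltry.
by apply: lee_wpmul2l; [rewrite lee_fin|exact: hC].
Qed.

Lemma rpot_hermite_fun (k : d.-tuple nat) y :
  rpot sigma (@hermite_fun R d k) y = (eigenval R k `^ (- sigma) * hermite_fun k y)%:E.
Proof.
pose la := eigenval R k; have la0 : 0 < la by exact: eigenval_gt0.
have G0 : 0 < Gammaf sigma by exact: Gammaf_gt0.
pose h := @hermite_fun R d k.
have mh : measurable_fun setT h by exact: measurable_hermite_fun.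
pose w (z : T * measurableTypeR R) := potential_integrand sigma (y, z.1) z.2.
have w0 z : 0 <= w z by exact: potential_integrand_ge0.
have mw : measurable_fun setT w.
  have mz : measurable_fun setT (fun z : T * measurableTypeR R => ((y, z.1), z.2)).
    apply: measurable_fun_pair => /=; last exact: measurable_snd.
    by apply: measurable_fun_pair => /=; [exact: measurable_cst|exact: measurable_fst].
  have mc := measurableT_comp (measurable_potential_integrand (d := d) sigma) mz.
  exact: mc.
have mw1 x : measurable_fun setT (fun t : measurableTypeR R => w (x, t)).
  by have := measurableT_comp mw (measurable_pair1 x).
pose Phi (z : T * measurableTypeR R) := (w z * h z.1)%:E.
have mPhi : measurable_fun setT Phi.
  by apply/measurable_EFinP; apply: measurable_funM => //; exact: (measurableT_comp mh measurable_fst).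
have KE x : K y x = ((Gammaf sigma)^-1%:E * \int[L]_t (w (x, t))%:E)%E by exact: potential_kernelE.
have I0 x : (0 <= \int[L]_t (w (x, t))%:E)%E by apply: integral_ge0 => t _; rewrite lee_fin.
have KE' x : (\int[L]_t (w (x, t))%:E = (Gammaf sigma)%:E * K y x)%E.
  by rewrite KE muleA -EFinM mulfV ?gt_eqF// mul1e.
have mI : measurable_fun setT (fun x : T => \int[L]_t (w (x, t))%:E)%E.
  apply: (@measurable_fun_fubini_tonelli_F _ _ T (measurableTypeR R) R L (EFin \o w)).
    exact/measurable_EFinP.
  by move=> z; rewrite lee_fin.
have iPhi : (leb d \x L)%E.-integrable setT Phi.
  apply/integrableP; split => //.
  rewrite fubini_tonelli1//; last exact: measurableT_comp.
  apply: (@le_lt_trans _ _ ((Gammaf sigma)%:E * rpot sigma (fun x => `|h x|%R) y)%E); last first.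
    by rewrite lte_mul_pinfty ?lee_fin ?(ltW G0)//; exact: rpot_hermite_fun_lty.
  rewrite /rpot -ge0_integralZl//; last 3 first.
  - apply: emeasurable_funM; first exact: measurable_potential_kernel2.
    by apply/measurable_EFinP; exact: measurableT_comp.
  - by move=> x _; exact: kernel_fun_ge0.
  - by rewrite lee_fin ltW.
  rewrite le_eqVlt; apply/orP; left; apply/eqP; apply: eq_integral => x _.
  rewrite /fubini_F /kernel_fun/= muleA -KE'.
  under eq_integral do rewrite normrM (ger0_norm (w0 _)) EFinM.
  rewrite ge0_integralZr//; first by apply/measurable_EFinP; exact: mw1.
  by move=> t _; rewrite lee_fin.
have [C C0 hC] := integral_potential_kernel2.
(* Moving the factor h(x) out of the time integral requires that integral to be finite. *)
have aeK : {ae leb d, forall x, K y x \is a fin_num}.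
  have iK : (leb d).-integrable setT (K y).
    apply/integrableP; split; first exact: measurable_potential_kernel2.
    under eq_integral do rewrite gee0_abs ?potential_kernel_ge0//.
    by apply: le_lt_trans (hC y) _; rewrite ltry.
  by apply: filterS (integrable_ae measurableT iK) => x /(_ I).
have e1 : (rpot sigma h y = \int[leb d]_x ((Gammaf sigma)^-1%:E * fubini_F L Phi x))%E.
  apply: ae_eq_integral => //.
  - apply: emeasurable_funM; first exact: measurable_potential_kernel2.
    exact/measurable_EFinP.
  - by apply: measurable_funeM; exact: measurable_fubini_F iPhi.
  apply: filterS aeK => x Kx _; rewrite /kernel_fun /fubini_F /Phi/= KE -muleA; congr (_ * _)%E.
  under [RHS]eq_integral do rewrite EFinM.
  have If : (\int[L]_t (w (x, t))%:E)%E \is a fin_num by rewrite KE' fin_numM.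
  rewrite integralZr//=; apply/integrableP; split; first by apply/measurable_EFinP; exact: mw1.
  by under eq_integral do rewrite gee0_abs ?lee_fin//; rewrite -ge0_fin_numE.
rewrite e1 integralZl//; last exact: integrable_fubini_F iPhi.
rewrite integral12_prod_meas1// -integral21_prod_meas1//.
have -> : fubini_G (leb d) Phi = fun t => ((h y)%:E * (gamma_fun sigma la t)%:E)%E.
  apply/funext => t; rewrite /fubini_G /Phi /w /potential_integrand /gamma_fun/=; case: ifPn => [t0|_]; last first.
    by under eq_integral do rewrite mul0r; rewrite integral0 mule0.
  have [i e] := heat_kernel_eigen y k t0.
  have hE x : heat_kernel t x y = heat_prod t y x by rewrite heat_kernelE// -/(heat_prod t x y) heat_prodC.
  under eq_integral do rewrite mulrAC mulrC EFinM -hE.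
  rewrite integralZl// e -!EFinM; congr EFin; rewrite -/la -/h; ring.
rewrite integralZl//=; last first.
  apply/integrableP; split; first by apply/measurable_EFinP; exact: measurable_gamma_fun.
  under eq_integral do rewrite gee0_abs ?lee_fin ?gamma_fun_ge0//.
  by rewrite integral_gamma_fun// ltry.
rewrite integral_gamma_fun// -!EFinM; congr EFin; rewrite -/la -/h; field.
by rewrite gt_eqF.
Qed.

End potential_eigen.

(** * The pairing of a potential with a Hermite function *)

Section hermite_pairing.
Context (R : realType) (d : nat) (sigma p q r a b : R).
Hypotheses (d_gt0 : (0 < d)%N) (sigma_gt0 : 0 < sigma).
Hypotheses (p1 : 1 < p) (pq : p <= q) (qr : q^-1 + r^-1 = 1) (ab : 0 <= a + b)
  (ap : a < d%:R * (1 - p^-1)) (bq : b < d%:R / q)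
  (ss : (d%:R * (p^-1 - q^-1) + a + b) / 2 <= sigma).
Local Notation T := (rspace R d).
Local Notation K := (@potential_kernel R d sigma).
Variables (k : d.-tuple nat) (phi F : T -> R) (A : R).
Hypotheses (mphi : measurable_fun setT phi) (mF : measurable_fun setT F)
  (phiF : forall y, `|phi y| <= F y) (A0 : 0 <= A)
  (HA : (\int[leb d]_x (F x `^ p * enorm x `^ (a * p))%:E <= A%:E)%E).
Local Notation h := (@hermite_fun R d k).

Let dR0 : 0 < d%:R :> R.
Proof. by rewrite ltr0n. Qed.

Let F0 y : 0 <= F y.
Proof. exact: le_trans (normr_ge0 _) (phiF y). Qed.

Let mh : measurable_fun setT h.
Proof. exact: measurable_hermite_fun. Qed.

Let mabsh : measurable_fun setT (fun x => `|h x|).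
Proof. exact: measurableT_comp. Qed.

(** By Young's inequality |phi h| <= F^p |x|^(ap) + |h|^p' |x|^(-ap'), and a < d/p' means that the
    last weight has exponent above -d. *)
Lemma integrable_mul_hermite_fun : (leb d).-integrable setT (fun x => (phi x * h x)%:E).
Proof.
have [p0 q1 r0 pi1 qpi] := exponent_facts p1 pq qr.
pose p' := (1 - p^-1)^-1.
have p'0 : 0 < p' by rewrite invr_gt0 subr_gt0.
have ap' : - d%:R < - a * p'.
  by rewrite mulNr ltrN2 -ltr_pdivlMr// invrK.
have [B B0 HB] := integral_hermite_fun_weight d_gt0 k p'0 ap'.
have men c : measurable_fun setT (fun x : T => enorm x `^ c).
  by apply: measurable_powR_comp; exact: measurable_enorm.
pose X x := F x `^ p * enorm x `^ (a * p).
pose Y x := `|h x| `^ p' * enorm x `^ (- a * p').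
have X0 x : 0 <= X x by rewrite mulr_ge0 ?powR_ge0.
have Y0 x : 0 <= Y x by rewrite mulr_ge0 ?powR_ge0.
have mX : measurable_fun setT X by apply: measurable_funM => //; exact: measurable_powR_comp.
have mY : measurable_fun setT Y by apply: measurable_funM => //; exact: measurable_powR_comp.
have mXE : measurable_fun setT (EFin \o X) by exact/measurable_EFinP.
have mYE : measurable_fun setT (EFin \o Y) by exact/measurable_EFinP.
have mp : measurable_fun setT (fun x => phi x * h x) by exact: measurable_funM.
apply/integrableP; split; first exact/measurable_EFinP.
apply: (@le_lt_trans _ _ (\int[leb d]_x ((X x)%:E + (Y x)%:E))%E); last first.
  rewrite (@ge0_integralD _ _ R (leb d))//; last 2 first.
  - by move=> x _; rewrite lee_fin.
  - by move=> x _; rewrite lee_fin.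
  apply: (@le_lt_trans _ _ (A%:E + B%:E)%E); last by rewrite -EFinD ltry.
  by apply: leeD; [exact: HA|exact: HB].
apply: ae_ge0_le_integral => //.
- by apply: measurableT_comp => //; exact/measurable_EFinP.
- by move=> x _; rewrite -EFinD lee_fin addr_ge0.
- exact: emeasurable_funD.
have : {ae leb d, forall x : T, forall i : 'I_d, tnth x i != 0}.
  by apply: ae_forall_ord => i; exact: ae_tnth_neq.
apply: filterS => x hx _; rewrite -EFinD lee_fin normrM.
have e0 : 0 < enorm x.
  have i0 : 'I_d by exact: Ordinal d_gt0.
  by apply: lt_le_trans (le_enorm x i0); rewrite normr_gt0.
apply: (@le_trans _ _ (F x * `|h x|)); first by rewrite ler_wpM2r.
have Xp : X x `^ p^-1 = F x * enorm x `^ a by exact: powR_weightK.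
have Yp : Y x `^ p'^-1 = `|h x| * enorm x `^ (- a) by exact: powR_weightK.
have p'i0 : 0 <= p'^-1 by rewrite invr_ge0 ltW.
have pi0 : 0 <= p^-1 by rewrite invr_ge0 ltW.
have := @powR_mul3_le R p^-1 p'^-1 0 (X x) (Y x) 0 pi0 p'i0 (lexx _).
have -> : p^-1 + p'^-1 + 0 = 1 by rewrite invrK addr0 addrC subrK.
move=> /(_ erefl (X0 x) (Y0 x) (lexx _)); rewrite powRr0 mulr1 addr0 Xp Yp.
have -> : F x * enorm x `^ a * (`|h x| * enorm x `^ (- a)) =
    F x * `|h x| * (enorm x `^ a * enorm x `^ (- a)) by ring.
by rewrite -powRD ?(gt_eqF e0) ?implybT// subrr powRr0 mulr1.
Qed.

Lemma integral_rpot_abs_hermite_fun_lty :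
  (\int[leb d \x leb d]_z (kernel_fun sigma F z * (`|h z.1|)%:E) < +oo)%E /\
  (\int[leb d]_x (rpot sigma F x * (`|h x|)%:E) < +oo)%E.
Proof.
have [p0 q1 r0 pi1 qpi] := exponent_facts p1 pq qr.
have [B B0 HB] := integral_hermite_fun_weight d_gt0 k r0 (weight_index_gt dR0 p1 pq qr ab ap).
have habs0 x : 0 <= `|h x| by [].
have [C C0 H] := weighted_bilinear d_gt0 sigma_gt0 p1 pq qr ab ap bq ss.
have [C' C'0 H'] := weighted_rpot d_gt0 sigma_gt0 p1 pq qr ab ap bq ss.
split.
  by apply: le_lt_trans (H F (fun x => `|h x|) A B mF mabsh F0 habs0 A0 B0 HA HB) _; rewrite ltry.
by apply: le_lt_trans (H' F (fun x => `|h x|) A B mF mabsh F0 habs0 A0 B0 HA HB) _; rewrite ltry.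
Qed.

Let ae_lty : {ae leb d, forall x, (rpot sigma F x < +oo)%E}.
Proof. exact: (rpot_lty d_gt0 sigma_gt0 p1 pq qr ab ap bq ss mF F0 A0 HA). Qed.

Let mrphi : measurable_fun setT (fun x => fine (rpot sigma phi x)).
Proof.
have m : measurable_fun setT (rpot sigma phi) by exact: measurable_rpot.
by apply: measurableT_comp m; exact: fine_measurable.
Qed.

Lemma integrable_rpot_mul_hermite_fun :
  (leb d).-integrable setT (fun x => (fine (rpot sigma phi x) * h x)%:E).
Proof.
have [_ H] := integral_rpot_abs_hermite_fun_lty.
apply/integrableP; split; first by apply/measurable_EFinP; exact: measurable_funM.
apply: le_lt_trans H; apply: ae_ge0_le_integral => //.
- by apply: measurableT_comp => //; apply/measurable_EFinP; exact: measurable_funM.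
- by move=> x _; rewrite mule_ge0 ?rpot_ge0// lee_fin.
- apply: emeasurable_funM; first exact: measurable_ge0_rpot.
  exact/measurable_EFinP.
apply: filterS ae_lty => x hx _; rewrite abse_EFin normrM EFinM.
apply: lee_wpmul2r; first by rewrite lee_fin.
have fF : rpot sigma F x \is a fin_num by rewrite ge0_fin_numE ?rpot_ge0.
rewrite -(fineK fF) lee_fin.
exact: (fine_rpot_le sigma_gt0 mphi mF phiF hx).
Qed.

Lemma integral_rpot_mul_hermite_fun :
  (\int[leb d]_x (fine (rpot sigma phi x) * h x)%:E =
   (eigenval R k `^ (- sigma))%:E * \int[leb d]_x (phi x * h x)%:E)%E.
Proof.
have [H _] := integral_rpot_abs_hermite_fun_lty.
pose Phi (z : T * T) : \bar R := (kernel_fun sigma phi z * (h z.1)%:E)%E.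
have mk psi : measurable_fun setT psi -> measurable_fun setT (kernel_fun sigma psi).
  by move=> mpsi; exact: measurable_kernel_fun.
have mPhi : measurable_fun setT Phi.
  apply: emeasurable_funM; first exact: mk.
  by apply/measurable_EFinP; exact: (measurableT_comp mh measurable_fst).
have iPhi : (leb d \x leb d)%E.-integrable setT Phi.
  apply/integrableP; split => //; apply: le_lt_trans H.
  apply: ge0_le_integral => //.
  - exact: measurableT_comp.
  - apply: emeasurable_funM; first exact: mk.
    by apply/measurable_EFinP; exact: (measurableT_comp mabsh measurable_fst).
  move=> z _; rewrite /Phi abseM; apply: lee_wpmul2r; first by rewrite lee_fin.
  exact: abse_kernel_fun_le.
have E1 : (\int[leb d]_x (fine (rpot sigma phi x) * h x)%:E = \int[leb d]_x fubini_F (leb d) Phi x)%E.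
  apply: ae_eq_integral => //.
  - by apply/measurable_EFinP; exact: measurable_funM.
  - exact: measurable_fubini_F iPhi.
  apply: filterS ae_lty => x hx _.
  have i1 := integrable_kernel_fun sigma_gt0 mphi mF phiF hx.
  by rewrite /fubini_F /Phi/= integralZr// EFinM fineK//; exact: integrable_fin_num i1.
rewrite E1 (Fubini iPhi).
rewrite -(integralZl measurableT integrable_mul_hermite_fun).
apply: eq_integral => y _; rewrite /Phi.
have mabs : measurable_fun setT (fun x : T => `|h x|) by [].
have i2 := integrable_kernel_fun sigma_gt0 mh mabs (fun x => lexx _) (rpot_hermite_fun_lty d_gt0 sigma_gt0 k y).
(* By symmetry of the kernel the inner integral is phi(y) times the potential of h at y. *)
rewrite (eq_integral (fun x => (phi y)%:E * kernel_fun sigma h (y, x))%E); last first.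
  by move=> x _; rewrite /kernel_fun/= potential_kernelC muleCA muleA muleAC.
rewrite integralZl// -[X in (_ * X)%E]/(rpot sigma h y) rpot_hermite_fun//.
by rewrite -!EFinM; congr EFin; ring.
Qed.

End hermite_pairing.

Section complex_pairing.
Context (R : realType).
Local Notation Re := complex.Re.
Local Notation Im := complex.Im.

Lemma Re_mul_conj_real (z : R[i]) (s : R) : Re (z * conjc s%:C) = Re z * s.
Proof. by case: z => u v /=; rewrite oppr0 mulr0 subr0. Qed.

Lemma Im_mul_conj_real (z : R[i]) (s : R) : Im (z * conjc s%:C) = Im z * s.
Proof. by case: z => u v /=; rewrite oppr0 mulr0 add0r. Qed.

(** For s >= d/2 the left-hand side is below d/2 by the bounds on a and b alone; otherwise the claim
    rearranges the additional condition. *)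
Lemma critical_index_le (d s p p' q a b : R) : 0 < d -> p^-1 + p'^-1 = 1 -> a < d / p' -> b < d / q ->
  d / 2 <= s \/ (s < d / 2 /\ p^-1 - (2 * s - a - b) / d <= q^-1) ->
  (d * (p^-1 - q^-1) + a + b) / 2 <= s.
Proof.
move=> d0 pp' ap bq.
have p'E : p'^-1 = 1 - p^-1 by rewrite -pp' addrAC subrr add0r.
move: ap bq; rewrite p'E; move: (p^-1) (q^-1) => P Q ap bq [h|[_ h]].
  by move: ap bq h; rewrite !mulrBr mulr1; lra.
move: h; rewrite lerBlDr -lerBlDl ler_pdivlMr// => h.
rewrite ler_pdivrMr// mulrC; move: h; rewrite mulrC; lra.
Qed.

End complex_pairing.

(** Since [cdot] assigns a value to any two functions, the integrability of both pairings is part of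
    the conclusion; it gives the last identity its meaning. *)
Theorem theorem2p5 (R : realType) (d : nat) (sigma p p' q a b : R)
    (d_ge1 : (1 <= d)%N) (sigma_gt0 : 0 < sigma)
    (p_gt1 : 1 < p) (p_le_q : p <= q) (pp' : p^-1 + p'^-1 = 1)
    (a_lt : a < d%:R / p') (b_lt : b < d%:R / q) (ab_ge0 : 0 <= a + b) :
  [/\ d%:R / 2 <= sigma ->
        potential_bounded d sigma (a * p) p (- (b * q)) q,
      sigma < d%:R / 2 ->
        p^-1 - (2 * sigma - a - b) / d%:R <= q^-1 ->
        potential_bounded d sigma (a * p) p (- (b * q)) q &
      d%:R / 2 <= sigma \/
        (sigma < d%:R / 2 /\ p^-1 - (2 * sigma - a - b) / d%:R <= q^-1) ->
      forall (k : d.-tuple nat) (f : rspace R d -> R[i]),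
        in_wLp (a * p) p f ->
        let h x := (hermite_fun k x)%:C in
        [/\ cintegrable (fun x => f x * conjc (h x)),
            cintegrable (fun x => potential sigma f x * conjc (h x)) &
            cdot (potential sigma f) h =
              (eigenval R k `^ (- sigma))%:C * cdot f h]].
Proof.
have d0 : 0 < d%:R :> R by rewrite ltr0n.
have p'E : p'^-1 = 1 - p^-1 by rewrite -pp' addrAC subrr add0r.
have ap : a < d%:R * (1 - p^-1) by rewrite -p'E.
(* The exponent conjugate to q, in the role of [r] above. *)
have qr : q^-1 + (1 - q^-1)^-1^-1 = 1 by rewrite invrK addrC subrK.
have crit := critical_index_le d0 pp' a_lt b_lt.
split=> [h|h1 h2|/crit ss k f hf h].
- apply: (potential_boundedP d_ge1 sigma_gt0 p_gt1 p_le_q qr ab_ge0 ap b_lt).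
  by apply: crit; left.
- apply: (potential_boundedP d_ge1 sigma_gt0 p_gt1 p_le_q qr ab_ge0 ap b_lt).
  by apply: crit; right.
have [mr mi] := hf.1.
have mF := measurable_modulus hf.1.
have [A A0 [HA _]] := in_wLpE (lt_trans ltr01 p_gt1) hf.
have HA' : (\int[leb d]_x (modulus (f x) `^ p * enorm x `^ (a * p))%:E <= A%:E)%E by rewrite HA.
(* Real and imaginary parts are treated separately, each dominated by the modulus of f, which
   carries the norm. *)
have reh := fun y => abs_Re_le (f y).
have imh := fun y => abs_Im_le (f y).
have RE (g : rspace R d -> R[i]) : (fun x => complex.Re (g x * conjc (h x))) = fun x => complex.Re (g x) * hermite_fun k x.
  by apply/funext => x; exact: Re_mul_conj_real.
have IM (g : rspace R d -> R[i]) : (fun x => complex.Im (g x * conjc (h x))) = fun x => complex.Im (g x) * hermite_fun k x.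
  by apply/funext => x; exact: Im_mul_conj_real.
have REx (g : rspace R d -> R[i]) x : complex.Re (g x * conjc (h x)) = complex.Re (g x) * hermite_fun k x.
  exact: Re_mul_conj_real.
have IMx (g : rspace R d -> R[i]) x : complex.Im (g x * conjc (h x)) = complex.Im (g x) * hermite_fun k x.
  exact: Im_mul_conj_real.
have r1 := integrable_mul_hermite_fun d_ge1 p_gt1 p_le_q qr ap k mr mF reh HA'.
have i1 := integrable_mul_hermite_fun d_ge1 p_gt1 p_le_q qr ap k mi mF imh HA'.
have r2 := integrable_rpot_mul_hermite_fun d_ge1 sigma_gt0 p_gt1 p_le_q qr ab_ge0 ap b_lt ss k mr mF reh A0 HA'.
have i2 := integrable_rpot_mul_hermite_fun d_ge1 sigma_gt0 p_gt1 p_le_q qr ab_ge0 ap b_lt ss k mi mF imh A0 HA'.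
have r3 := integral_rpot_mul_hermite_fun d_ge1 sigma_gt0 p_gt1 p_le_q qr ab_ge0 ap b_lt ss k mr mF reh A0 HA'.
have i3 := integral_rpot_mul_hermite_fun d_ge1 sigma_gt0 p_gt1 p_le_q qr ab_ge0 ap b_lt ss k mi mF imh A0 HA'.
split.
- split; first by under eq_fun do rewrite REx.
  by under eq_fun do rewrite IMx.
- split; first by under eq_fun do rewrite REx.
  by under eq_fun do rewrite IMx.
rewrite /cdot /cintegral.
under eq_Rintegral do rewrite REx.
under [X in _ +i* X = _]eq_Rintegral do rewrite IMx.
under [X in _ = _ * (X +i* _)]eq_Rintegral do rewrite REx.
under [X in _ = _ * (_ +i* X)]eq_Rintegral do rewrite IMx.
rewrite /Rintegral r3 i3 !fineM//; [|exact: integrable_fin_num i1|exact: integrable_fin_num r1].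
by apply/eqP; rewrite eq_complex /= !mul0r subr0 addr0 !eqxx.
Qed.
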